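(* Let $I=(a,b)\subset\mathbb R$ be a bounded interval with $a+b>0$, and let $d\xi=p\,dx$ be a measure on $I$, where $p\in C^1([a,b])$ is a positive function on $[a,b]$ which satisfies one of the following conditions: (i) if $0\notin I$: $p'(x)\ne0$ for all $x\in I$; (ii) if $0\in I$: $p(x)=p(-x)$ on $(a,-a)$ and $p'(x)\ne0$ on $(0,b)$. Then a minimizer realizing the log-Sobolev constant $\Lambda_{LS}(\xi)$ exists.
   Context: Let $\bar\xi=\xi/\xi(I)$ be the normalized probability measure and $\mathrm{Ent}_{\bar\xi}(f^2)=\int f^2\log f^2\,d\bar\xi-\int f^2d\bar\xi\,\log\int f^2d\bar\xi$. $\Lambda_{LS}(\xi)=\Lambda_{LS}(\bar\xi)$ is the largest constant $C$ such that $\frac C2\mathrm{Ent}_{\bar\xi}(f^2)\le\int f'^2d\bar\xi$ for all $f\in C^\infty([a,b])$. Let $\mathcal H$ be the completion of $C^\infty([a,b])$ in the norm $\|f\|=\big(\int(f^2+f'^2)\,d\xi\big)^{1/2}$. A minimizer realizing $\Lambda_{LS}(\xi)$ is a non-constant $f\in\mathcal H$ with $\frac{\Lambda_{LS}(\xi)}2\mathrm{Ent}_{\bar\xi}(f^2)=\int f'^2d\bar\xi$. *)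

(* Defs.v *)
(* MathComp-Analysis *)
From HB Require Import structures.
From mathcomp Require Import all_boot all_order all_algebra.
From mathcomp Require Import all_classical all_reals all_analysis.

Set Implicit Arguments.
Unset Strict Implicit.
Unset Printing Implicit Defensive.

Import Order.TTheory GRing.Theory Num.Theory.
Import numFieldNormedType.Exports.

Local Open Scope ring_scope.
Local Open Scope classical_set_scope.

Section LogSobolev.
Context {R : realType}.
Implicit Types (a b : R) (xi : {measure set (measurableTypeR R) -> \bar R}).

(** [C^k([a, b])]: the derivatives up to order [k] exist in the open interval
    and extend continuously to the closed one. Functions are total on [R]; their
    values outside [[a, b]] play no role. *)
Definition Ck a b (k : nat) (f : R -> R) : Prop :=
  {within `[a, b], continuous f} /\
  forall n, (n < k)%N ->
    {in `]a, b[, forall x, derivable f^`(n) x 1} /\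
    exists2 g : R -> R, {within `[a, b], continuous g} &
      {in `]a, b[, f^`(n.+1) =1 g}.

Definition Cinfty a b (f : R -> R) : Prop := forall k, Ck a b k f.

(** [d xi = p dx] on the interval [(a, b)], viewed as a measure on the line that
    does not charge the complement of [(a, b)]. *)
Definition has_density xi a b (p : R -> R) : Prop :=
  forall A : set (measurableTypeR R), measurable A ->
    xi A = (\int[lebesgue_measure]_(x in A `&` `]a, b[) (p x)%:E)%E.

(** The fallback [\d_0] is only used by [mnormalize] when the total mass is [0]
    or [+oo]. *)
Definition normalized xi : probability (measurableTypeR R) R :=
  mnormalize xi \d_(0 : measurableTypeR R).

(** [Ent (f^2)]; the library's [ln 0 = 0] gives the convention [0 log 0 = 0]. *)
Definition Ent_sq (mu : probability (measurableTypeR R) R) a b (f : R -> R) : R :=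
  (\int[mu]_(x in `]a, b[) (f x ^+ 2 * ln (f x ^+ 2))) -
  (\int[mu]_(x in `]a, b[) (f x ^+ 2)) *
    ln (\int[mu]_(x in `]a, b[) (f x ^+ 2)).

(** The set of constants is closed, contains [0] and, for the measures at hand,
    is bounded above, so that its supremum is its largest element. *)
Definition LambdaLS xi a b : R :=
  sup [set C : R | forall f : R -> R, Cinfty a b f ->
    C / 2 * Ent_sq (normalized xi) a b f <=
    \int[normalized xi]_(x in `]a, b[) (derive1 f x ^+ 2)].

Definition L2 xi a b (f : R -> R) : Prop :=
  measurable_fun (`]a, b[ : set (measurableTypeR R)) f /\
  xi.-integrable `]a, b[ (fun x => (f x ^+ 2)%:E).

(** The map [phi |-> (phi, phi')] embeds [C^infty([a, b])] with the norm
    [(\int (phi^2 + phi'^2) d xi)^(1/2)] isometrically in the complete space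
    [L^2(xi) * L^2(xi)], so the completion is the closure of its image. An
    element is thus a pair [(f, g)], with [g] playing the role of [f']. *)
Definition in_H xi a b (f g : R -> R) : Prop :=
  [/\ L2 xi a b f, L2 xi a b g &
    exists2 phi : nat -> R -> R, (forall n, Cinfty a b (phi n)) &
      (\int[xi]_(x in `]a, b[)
         ((phi n x - f x) ^+ 2 + (derive1 (phi n) x - g x) ^+ 2)%:E)%E
        @[n --> \oo] --> 0%E].

Definition is_minimizer xi a b (f g : R -> R) : Prop :=
  [/\ in_H xi a b f g,
      ~ (exists c : R, ae_eq xi `]a, b[ f (cst c)) &
      LambdaLS xi a b / 2 * Ent_sq (normalized xi) a b f =
      \int[normalized xi]_(x in `]a, b[) (g x ^+ 2)].

End LogSobolev.

(* Main.v *)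
Require Import Defs.
From HB Require Import structures.
From mathcomp Require Import all_boot all_order all_algebra.
From mathcomp Require Import all_classical all_reals all_analysis.
From mathcomp Require Import measurable_realfun.
From mathcomp Require Import ring lra.
Set Implicit Arguments.
Unset Strict Implicit.
Unset Printing Implicit Defensive.
Import Order.TTheory GRing.Theory Num.Theory.
Import numFieldNormedType.Exports.
Local Open Scope ring_scope.
Local Open Scope classical_set_scope.

(** Second order expansion at the constants shows that a minimizing sequence [f_n]
    with [int f_n^2 = 1] can only degenerate to a constant when the log-Sobolev
    constant equals the spectral gap [lam] of the Neumann problem. Let [phi] be the
    first Neumann eigenfunction. Testing with [1 + eps phi] and expanding to third
    order gives a constant strictly below [lam] as soon as [int phi^3 d xi <> 0],
    and integrating by parts, [int phi^3 p] is a negative multiple of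
    [int phi'^3 p']. Here [phi' > 0] and [p'] has a constant sign in case (i); in
    case (ii) a Sturm comparison gives [phi' x > phi' (- x)] for [0 < x < - a], so
    that the integral of the odd function [p'] against [phi'^3] does not cancel.
    Hence a minimizing sequence stays bounded in the energy norm and, along an
    ultrafilter, converges uniformly to a nonconstant function; the parallelogram
    law makes the derivatives converge strongly. *)

(** * Calculus on a segment *)

(** The constant is tested on smooth functions only, whereas the eigenfunction inherits limited
    regularity from the density. Polynomials are dense for the C^1 norm, in which energy and entropy
    are continuous, so C^1 test functions are allowed and minimizing sequences can be taken
    polynomial. The eigenvalue comes from shooting: solve from [a] with [phi = -1] and zero flux,
    and take the infimum of the parameters for which the flux vanishes again in [(a, b]]. There the
    flux is positive inside, and Picone's identity, applied to the primitive of [rho f], identifies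
    this eigenvalue with the spectral gap. In case (ii), [a + b > 0] leaves the part [(- a, b)]
    without mirror image; this makes the Sturm comparison on [(a, - a)] strict. Integral estimates
    are proved as monotonicity of explicit functions on the segment, and quadratic ones take the
    form [2 x y <= t x^2 + y^2 / t] with a free [t]. *)

Section Calculus.
Context {R : realType}.
Implicit Types (f g h : R -> R) (x y a b c l m : R).

Definition der f x l := is_derive x 1 f l.

(** Two-sided continuity, even at the end points: together with [der] it avoids one-sided limits.
    Functions known only on the segment are extended through [clamp] before entering this class. *)
Definition C0 a b f := forall x, a <= x <= b -> {for x, continuous f}.

Lemma ltW2 a b x : a < x < b -> a <= x <= b.
Proof. by case/andP=> /ltW-> /ltW->. Qed.

Lemma der_cont f x l : der f x l -> {for x, continuous f}.
Proof. by case=> df _; apply: differentiable_continuous; apply/derivable1_diffP. Qed.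

Lemma derE f x l l' : der f x l -> l = l' -> der f x l'.
Proof. by move=> ? <-. Qed.

Lemma derD f g x l m : der f x l -> der g x m -> der (fun y => f y + g y) x (l + m).
Proof. by move=> ? ?; apply: is_deriveD. Qed.

Lemma derB f g x l m : der f x l -> der g x m -> der (fun y => f y - g y) x (l - m).
Proof. by move=> ? ?; apply: is_deriveB. Qed.

Lemma derN f x l : der f x l -> der (fun y => - f y) x (- l).
Proof. by move=> ?; apply: is_deriveN. Qed.

Lemma derM f g x l m : der f x l -> der g x m ->
  der (fun y => f y * g y) x (l * g x + f x * m).
Proof.
move=> df dg; have H := @is_deriveM _ _ f g x 1 l m df dg.
by apply: derE H _; rewrite /GRing.scale /=; ring.
Qed.

Lemma der_cst c x : der (fun=> c) x 0.
Proof. exact: is_derive_cst. Qed.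

Lemma der_id x : der (fun y => y) x 1.
Proof. exact: is_derive_id. Qed.

Lemma derZ c f x l : der f x l -> der (fun y => c * f y) x (c * l).
Proof. by move=> df; apply: derE (derM (der_cst c x) df) _; ring. Qed.

Lemma derV f x l : f x != 0 -> der f x l ->
  der (fun y => (f y)^-1) x (- l / f x ^+ 2).
Proof.
move=> f0 df; have := @is_deriveV _ f x l 1 f0 df.
by move=> H; apply: derE H _; rewrite /GRing.scale /=; ring.
Qed.

Lemma derX2 f x l : der f x l -> der (fun y => f y ^+ 2) x (2 * f x * l).
Proof.
move=> df; have H := derM df df.
have -> : (fun y => f y ^+ 2) = (fun y => f y * f y) by apply/funext.
by apply: derE H _; ring.
Qed.

Lemma derX3 f x l : der f x l -> der (fun y => f y ^+ 3) x (3 * f x ^+ 2 * l).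
Proof.
move=> df; have H := derM (derX2 df) df.
have -> : (fun y => f y ^+ 3) = (fun y => f y ^+ 2 * f y) by apply/funext=> y; ring.
by apply: derE H _; ring.
Qed.

Lemma der_comp f g x l m : der g x m -> der f (g x) l -> der (fun y => f (g y)) x (l * m).
Proof. by move=> dg df; have := @is_derive1_comp R f g x l m df dg. Qed.

Lemma der_exp c x : der (fun y => expR (c * y)) x (c * expR (c * x)).
Proof.
apply: derE (@der_comp expR (fun y => c * y) x _ c _ (is_derive_expR (c * x))) _.
  by apply: derE (derZ c (der_id x)) _; rewrite mulr1.
by rewrite mulrC.
Qed.

Lemma der_near f g x l : (\forall y \near x, f y = g y) -> der f x l -> der g x l.
Proof. by move=> fg df; apply: (near_eq_is_derive fg). Qed.

Lemma C0_within a b f : C0 a b f -> {within `[a, b], continuous f}.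
Proof.
by move=> cf; apply: continuous_in_subspaceT => x; rewrite inE /= in_itv /= => /cf.
Qed.

Lemma C0_der a b f f' : (forall x, a <= x <= b -> der f x (f' x)) -> C0 a b f.
Proof. by move=> df x /df/der_cont. Qed.

Lemma C0D a b f g : C0 a b f -> C0 a b g -> C0 a b (fun x => f x + g x).
Proof. by move=> cf cg x xab; apply: continuousD; [apply: cf|apply: cg]. Qed.

Lemma C0N a b f : C0 a b f -> C0 a b (fun x => - f x).
Proof. by move=> cf x xab; apply: continuousN; apply: cf. Qed.

Lemma C0B a b f g : C0 a b f -> C0 a b g -> C0 a b (fun x => f x - g x).
Proof. by move=> cf cg; apply: C0D => //; apply: C0N. Qed.

Lemma C0M a b f g : C0 a b f -> C0 a b g -> C0 a b (fun x => f x * g x).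
Proof. by move=> cf cg x xab; apply: continuousM; [apply: cf|apply: cg]. Qed.

Lemma C0_cst a b c : C0 a b (fun=> c).
Proof. by move=> x xab; apply: cvg_cst. Qed.

Lemma C0X a b f n : C0 a b f -> C0 a b (fun x => f x ^+ n).
Proof.
move=> cf; elim: n => [|n IH]; first exact: C0_cst.
have -> : (fun x => f x ^+ n.+1) = (fun x => f x * f x ^+ n).
  by apply/funext=> x; rewrite exprS.
exact: C0M.
Qed.

Lemma C0V a b f : (forall x, a <= x <= b -> f x != 0) -> C0 a b f ->
  C0 a b (fun x => (f x)^-1).
Proof. by move=> f0 cf x xab; apply: continuousV; [apply: f0|apply: cf]. Qed.

Lemma C0_comp a b f g : continuous g -> C0 a b f -> C0 a b (fun x => g (f x)).
Proof. by move=> cg cf x /cf cfx; apply: continuous_comp => //; apply: cg. Qed.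

Lemma C0_sub a b c d f : a <= c -> d <= b -> C0 a b f -> C0 c d f.
Proof. by move=> ac db cf x /andP[cx xd]; apply: cf; apply/andP; split; lra. Qed.

Lemma C0_bounded a b f : a <= b -> C0 a b f ->
  exists M, 0 < M /\ forall x, a <= x <= b -> `|f x| <= M.
Proof.
move=> ab cf.
have cn : {within `[a, b], continuous (fun x => `|f x|)}.
  by apply: C0_within; apply: C0_comp cf; exact: norm_continuous.
have [c cab H] := EVT_max ab cn.
exists (`|f c| + 1); split=> [|x xab]; first by rewrite ltr_wpDl.
by rewrite (le_trans (H x _)) ?in_itv ?lerDl.
Qed.

Lemma C0_pos_lb a b f : a <= b -> C0 a b f -> (forall x, a <= x <= b -> 0 < f x) ->
  exists m, 0 < m /\ forall x, a <= x <= b -> m <= f x.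
Proof.
move=> ab cf f0; have [c cab H] := EVT_min ab (C0_within cf).
by exists (f c); split=> [|x xab]; [apply: f0; rewrite in_itv in cab|apply: H; rewrite in_itv].
Qed.

Lemma ler_der a b f f' : C0 a b f -> (forall x, a < x < b -> der f x (f' x)) ->
  (forall x, a < x < b -> 0 <= f' x) ->
  forall x y, a <= x -> x <= y -> y <= b -> f x <= f y.
Proof.
move=> cf df f'0 x y ax xy yb.
apply: (@ger0_derive1_le_cc R f a b).
- by move=> z; rewrite in_itv => /df[].
- by move=> z; rewrite in_itv derive1E => /[dup] zab /df dz;
    rewrite (@derive_val _ _ _ _ _ _ _ dz) f'0.
- exact: C0_within.
- by rewrite in_itv /= ax (le_trans xy).
- by rewrite in_itv /= yb (le_trans ax).
- by [].
Qed.

Lemma ltr_der a b f f' : C0 a b f -> (forall x, a < x < b -> der f x (f' x)) ->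
  (forall x, a < x < b -> 0 < f' x) ->
  forall x y, a <= x -> x < y -> y <= b -> f x < f y.
Proof.
move=> cf df f'0 x y ax xy yb.
apply: (@gtr0_derive1_lt_cc R f a b).
- by move=> z; rewrite in_itv => /df[].
- by move=> z; rewrite in_itv derive1E => /[dup] zab /df dz;
    rewrite (@derive_val _ _ _ _ _ _ _ dz) f'0.
- exact: C0_within.
- by rewrite in_itv /= ax (le_trans (ltW xy)).
- by rewrite in_itv /= yb (le_trans ax (ltW xy)).
- by [].
Qed.

Lemma ler_der2 a b f g f' g' : C0 a b f -> C0 a b g ->
  (forall x, a < x < b -> der f x (f' x)) -> (forall x, a < x < b -> der g x (g' x)) ->
  (forall x, a < x < b -> f' x <= g' x) ->
  forall x y, a <= x -> x <= y -> y <= b -> f y - f x <= g y - g x.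
Proof.
move=> cf cg df dg fg x y ax xy yb.
suff : g x - f x <= g y - f y by lra.
apply: (@ler_der a b (fun t => g t - f t) (fun t => g' t - f' t)) => //.
- exact: C0B.
- by move=> t tab; apply: derB; [apply: dg|apply: df].
- by move=> t /fg; rewrite subr_ge0.
Qed.

Lemma normr_der a b f g f' g' : C0 a b f -> C0 a b g ->
  (forall x, a < x < b -> der f x (f' x)) -> (forall x, a < x < b -> der g x (g' x)) ->
  (forall x, a < x < b -> `|f' x| <= g' x) ->
  forall x y, a <= x -> x <= y -> y <= b -> `|f y - f x| <= g y - g x.
Proof.
move=> cf cg df dg fg x y ax xy yb; rewrite ler_norml; apply/andP; split.
  rewrite lerNl.
  have := @ler_der2 a b (fun t => - f t) g (fun t => - f' t) g' (C0N cf) cg _ dg _ x y ax xy yb.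
  rewrite opprB => H; have -> : f x - f y = - f y - - f x by rewrite opprK addrC.
  apply: H => t tab; first exact: derN (df t tab).
  by rewrite (le_trans _ (fg t tab)) // -normrN ler_norm.
apply: (@ler_der2 a b f g f' g' cf cg df dg) => // t tab.
by rewrite (le_trans _ (fg t tab)) // ler_norm.
Qed.

(** The function [exp(- K (t - a)) f - c (t - a)] is nonincreasing, because the exponential is at
    most 1 and multiplies [f' - K f <= c]. [Num.max 0 (f a)] keeps the bound valid for negative
    [f a] when [x - a] is enlarged to [b - a]. *)
Lemma gronwall a b f f' K c : 0 <= c -> 0 <= K -> C0 a b f -> (forall x, a < x < b ->
  der f x (f' x)) ->
  (forall x, a < x < b -> f' x <= K * f x + c) ->
  forall x, a <= x <= b -> f x <= (Num.max 0 (f a) + c * (b - a)) * expR (K * (b - a)).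
Proof.
move=> c0 K0 cf df f'K x /andP[ax xb].
pose e t := expR (- K * t) * f t * expR (K * a) - c * (t - a).
have ce : C0 a b e.
  apply: C0B; last first.
    by apply: C0M; [exact: C0_cst|apply: C0B; [|exact: C0_cst];
      apply: (@C0_der a b _ (fun=> 1)) => ? _; exact: der_id].
  apply: C0M; last exact: C0_cst.
  by apply: C0M => //; apply: C0_der => t _; exact: der_exp.
pose e' t := (- K * expR (- K * t) * f t + expR (- K * t) * f' t) * expR (K * a)
     + (expR (- K * t) * f t) * 0 - c * (1 - 0).
have de t : a < t < b -> der e t (e' t).
  move=> tab; apply: derB.
    by apply: derM; [apply: derM; [exact: der_exp|exact: df]|exact: der_cst].
  by apply: derZ; apply: derB; [exact: der_id|exact: der_cst].
have : e x <= e a.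
  rewrite -lerN2; apply: (@ler_der a b (fun t => - e t) (fun t => - e' t) (C0N ce) _ _ a x (lexx a) ax xb).
    by move=> t tab; apply: derN; exact: de.
  move=> t tab /=; rewrite oppr_ge0 /e' mulr0 addr0 subr0 mulr1 subr_le0.
  have -> : (- K * expR (- K * t) * f t + expR (- K * t) * f' t) * expR (K * a) =
    expR (- K * (t - a)) * (f' t - K * f t).
    have -> : - K * (t - a) = - K * t + K * a by ring.
    by rewrite expRD; ring.
  apply: le_trans (_ : expR (- K * (t - a)) * c <= _).
    by rewrite ler_pM2l ?expR_gt0 // lerBlDl f'K.
  rewrite ler_piMl // -[leRHS]expR0 ler_expR mulNr oppr_le0 mulr_ge0 // subr_ge0.
  by case/andP: tab => /ltW.
have -> : e a = f a.
  rewrite /e subrr mulr0 subr0 mulrAC -expRD.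
  have -> : - K * a + K * a = 0 by ring.
  by rewrite expR0 mul1r.
rewrite /e => H.
have -> : f x = expR (K * (x - a)) * (expR (- K * x) * f x * expR (K * a)).
  rewrite [_ * _ * expR (K * a)]mulrAC -expRD mulrA -expRD.
  have -> : K * (x - a) + (- K * x + K * a) = 0 by ring.
  by rewrite expR0 mul1r.
rewrite mulrC; apply: le_trans (_ : (Num.max 0 (f a) + c * (b - a)) * expR (K * (x - a)) <= _).
  rewrite ler_pM2r ?expR_gt0 //.
  have h1 : f a <= Num.max 0 (f a) by rewrite le_max lexx orbT.
  have h2 : c * (x - a) <= c * (b - a) by rewrite ler_wpM2l // lerD2r.
  lra.
rewrite ler_wpM2l //.
  by rewrite addr_ge0 // ?le_max ?lexx // mulr_ge0 // subr_ge0 (le_trans ax).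
by rewrite ler_expR ler_wpM2l // lerD2r.
Qed.

End Calculus.

(** * Primitives and integration against a continuous density *)

Section Primitive.
Context {R : realType}.
Implicit Types (f g h : R -> R) (x y a b c : R).

Definition clamp a b x : R := Num.max a (Num.min x b).

Lemma clamp_id a b x : a <= x <= b -> clamp a b x = x.
Proof. by case/andP=> ax xb; rewrite /clamp (min_idPl xb) (max_idPr ax). Qed.

Lemma clamp_itv a b x : a <= b -> a <= clamp a b x <= b.
Proof. by move=> ab; rewrite /clamp le_max lexx /= ge_max ab ge_min lexx orbT. Qed.

Lemma clamp_continuous a b : continuous (clamp a b).
Proof.
move=> x; have cb : {for x, continuous (cst b)} by exact: cvg_cst.
have ca : {for x, continuous (cst a)} by exact: cvg_cst.
have ci : {for x, continuous (@id R)} by exact: cvg_id.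
exact: (continuous_max ca (continuous_min ci cb)).
Qed.

Lemma clamp_C0 a b h : a <= b -> C0 a b h -> continuous (h \o clamp a b).
Proof.
move=> ab ch x; apply: continuous_comp; first exact: clamp_continuous.
by apply: ch; exact: clamp_itv.
Qed.

Let mu := (@lebesgue_measure R).

(** The integration starts at [a - 1], so that [a] lies inside the domain and the derivative there
    is two-sided; subtracting the integral up to [a] makes the primitive vanish at [a]. *)
Definition prim a b h x : R :=
  (\int[mu]_(t in `[a - 1, x]) h (clamp a b t) - \int[mu]_(t in `[a - 1, a]) h (clamp a b t))%R.

Lemma prim_a a b h : prim a b h a = 0.
Proof. by rewrite /prim subrr. Qed.

Lemma prim_der a b h : a < b -> C0 a b h ->
  forall x, a <= x <= b -> der (prim a b h) x (h x).
Proof.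
move=> ab ch x xab.
have cc := clamp_C0 (ltW ab) ch.
have xlt : x < x + 1 by rewrite ltrDl.
have intf : mu.-integrable `[a - 1, x + 1] (EFin \o (h \o clamp a b)).
  apply: continuous_compact_integrable; first exact: segment_compact.
  by apply: continuous_subspaceT.
have ax : a - 1 < x by case/andP: xab => ? _; lra.
have [d1 d2] := continuous_FTC1_closed xlt intf ax (cc x).
have : der (fun y => (\int[mu]_(t in `[a - 1, y]) (h \o clamp a b) t)%R) x (h x).
  by apply: DeriveDef => //; rewrite -derive1E d2 /= clamp_id.
move=> H; have := derB H (der_cst (\int[mu]_(t in `[a - 1, a]) h (clamp a b t))%R x).
by rewrite subr0.
Qed.

Lemma prim_C0 a b h : a < b -> C0 a b h -> C0 a b (prim a b h).
Proof. by move=> ab ch; apply: C0_der; exact: prim_der. Qed.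

End Primitive.

Section Expect.
Context {R : realType}.
Variables (a b : R) (rho : R -> R) (mu : probability (measurableTypeR R) R).
Hypothesis hab : a < b.
Hypothesis crho : C0 a b rho.
Hypothesis rho0 : forall x, a <= x <= b -> 0 < rho x.
Hypothesis Hmu : forall A : set (measurableTypeR R), measurable A ->
  mu A = (\int[lebesgue_measure]_(x in A `&` `]a, b[) (rho x)%:E)%E.

Let D : set (measurableTypeR R) := `]a, b[%classic.

(** This class is stable under products and continuous maps, and its members are all integrable for
    a probability measure. *)
Definition bdmeas (h : R -> R) :=
  measurable_fun D h /\ exists M, forall x, a < x < b -> `|h x| <= M.

Definition mean (h : R -> R) : R := \int[mu]_(x in D) h x.

Lemma mD : measurable D.
Proof. exact: measurable_itv. Qed.

(** The density formula only sees the trace of a set on the open interval, so the interval and the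
    whole line have the same mass. *)
Lemma density_mass : mu D = 1%E.
Proof.
have H1 := Hmu (@measurableT _ (measurableTypeR R)).
have H2 := Hmu mD.
by rewrite H2 setIid -[RHS](probability_setT mu) H1 setTI.
Qed.

Lemma bdmeas_integrable h : bdmeas h -> mu.-integrable D (EFin \o h).
Proof.
move=> [mh [M HM]]; apply: measurable_bounded_integrable => //.
- exact mD.
- by apply: (le_lt_trans (probability_le1 mu mD)); rewrite ltry.
- exists M; split; first exact: num_real.
  move=> y My x; rewrite /D /= in_itv /= => /HM H; exact: le_trans H (ltW My).
Qed.

Lemma bdmeas_cst c : bdmeas (fun=> c).
Proof. by split; [exact: measurable_cst|exists `|c|]. Qed.

Lemma bdmeasD f g : bdmeas f -> bdmeas g -> bdmeas (fun x => f x + g x).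
Proof.
move=> [mf [M HM]] [mg [N HN]]; split; first exact: measurable_funD.
exists (M + N) => x xab; rewrite (le_trans (ler_normD _ _)) // lerD //; [exact: HM|exact: HN].
Qed.

Lemma bdmeasM f g : bdmeas f -> bdmeas g -> bdmeas (fun x => f x * g x).
Proof.
move=> [mf [M HM]] [mg [N HN]]; split; first exact: measurable_funM.
exists (M * N) => x xab; rewrite normrM ler_pM //; [exact: HM|exact: HN].
Qed.

Lemma bdmeasZ c f : bdmeas f -> bdmeas (fun x => c * f x).
Proof. by move=> bf; apply: bdmeasM => //; exact: bdmeas_cst. Qed.

Lemma bdmeasN f : bdmeas f -> bdmeas (fun x => - f x).
Proof.
move=> bf; have -> : (fun x => - f x) = (fun x => -1 * f x) by apply/funext => x; rewrite mulN1r.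
exact: bdmeasZ.
Qed.

Lemma bdmeasB f g : bdmeas f -> bdmeas g -> bdmeas (fun x => f x - g x).
Proof. by move=> bf bg; apply: bdmeasD => //; exact: bdmeasN. Qed.

Lemma bdmeasX f n : bdmeas f -> bdmeas (fun x => f x ^+ n).
Proof.
move=> bf; elim: n => [|n IH]; first exact: bdmeas_cst.
have -> : (fun x => f x ^+ n.+1) = (fun x => f x * f x ^+ n).
  by apply/funext=> x; rewrite exprS.
exact: bdmeasM.
Qed.

Lemma bdmeas_abs f : bdmeas f -> bdmeas (fun x => `|f x|).
Proof.
move=> [mf [M HM]]; split; first exact: measurableT_comp.
by exists M => x /HM; rewrite normr_id.
Qed.

Lemma bdmeas_C0 f : C0 a b f -> bdmeas f.
Proof.
move=> cf; split; last first.
  have [M [M0 HM]] := C0_bounded (ltW hab) cf.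
  by exists M => x /andP[ax xb]; apply: HM; rewrite !ltW.
apply: open_continuous_measurable_fun; first exact: interval_open.
by move=> x; rewrite inE /D /= in_itv /= => /andP[ax xb]; apply: cf; rewrite !ltW.
Qed.

Lemma bdmeas_comp f t : bdmeas f -> continuous t -> bdmeas (fun x => t (f x)).
Proof.
move=> [mf [M HM]] ct; split.
  by apply: (@measurableT_comp _ _ _ _ _ _ t) => //; exact: continuous_measurable_fun.
have M0 : - (`|M| + 1) <= `|M| + 1 by have := normr_ge0 M; lra.
have [N [N0 HN]] := @C0_bounded R (- (`|M| + 1)) (`|M| + 1) t M0 (fun x _ => ct x).
exists N => x /HM H; apply: HN; rewrite -ler_norml (le_trans H) //.
by have := ler_norm M; lra.
Qed.

Lemma mean_ext f g : (forall x, a < x < b -> f x = g x) -> mean f = mean g.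
Proof. by move=> fg; apply: eq_Rintegral => x; rewrite inE /D /= in_itv /=; exact: fg. Qed.

Lemma meanD f g : bdmeas f -> bdmeas g -> mean (fun x => f x + g x) = mean f + mean g.
Proof. move=> /bdmeas_integrable intf /bdmeas_integrable intg;
  rewrite /mean RintegralD //. exact mD. Qed.

Lemma meanZ c f : bdmeas f -> mean (fun x => c * f x) = c * mean f.
Proof. by move=> /bdmeas_integrable intf; rewrite /mean RintegralZl //; exact mD. Qed.

Lemma meanN f : bdmeas f -> mean (fun x => - f x) = - mean f.
Proof.
by move=> bf; rewrite (mean_ext (g := fun x => -1 * f x)) ?meanZ ?mulN1r // => x _;
  rewrite mulN1r.
Qed.

Lemma meanB f g : bdmeas f -> bdmeas g -> mean (fun x => f x - g x) = mean f - mean g.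
Proof. by move=> bf bg; rewrite meanD ?meanN //; exact: bdmeasN. Qed.

Lemma mean_cst c : mean (fun=> c) = c.
Proof.
rewrite /mean Rintegral_cst; last exact mD.
by rewrite -[RHS]mulr1; congr (c * _); exact (congr1 fine density_mass).
Qed.

Lemma le_mean f g : bdmeas f -> bdmeas g -> (forall x, a < x < b -> f x <= g x) ->
  mean f <= mean g.
Proof.
move=> /bdmeas_integrable intf /bdmeas_integrable intg fg; by apply: le_Rintegral => //; exact mD.
Qed.

Lemma mean_ge0 f : (forall x, a < x < b -> 0 <= f x) -> 0 <= mean f.
Proof.
by move=> f0; apply: Rintegral_ge0 => x; rewrite /D /= in_itv /=; exact: f0.
Qed.

Lemma mean_norm_le f M : bdmeas f -> (forall x, a < x < b -> `|f x| <= M) -> `|mean f| <= M.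
Proof.
move=> bf fM; rewrite ler_norml; apply/andP; split.
  rewrite -(mean_cst (- M)); apply: le_mean => //; first exact: bdmeas_cst.
  by move=> x /fM; rewrite ler_norml => /andP[].
rewrite -(mean_cst M); apply: le_mean => //; first exact: bdmeas_cst.
by move=> x /fM; rewrite ler_norml => /andP[].
Qed.

Lemma mean_dist f g e : bdmeas f -> bdmeas g -> (forall x, a < x < b -> `|f x - g x| <= e) ->
  `|mean f - mean g| <= e.
Proof. by move=> bf bg fg; rewrite -meanB //; apply: mean_norm_le => //; exact: bdmeasB. Qed.

Lemma FTC2_oo h H : C0 a b h -> C0 a b H -> (forall x, a < x < b -> der H x (h x)) ->
  (\int[lebesgue_measure]_(x in `]a, b[) (h x)%:E)%E = (H b - H a)%:E.
Proof.
move=> ch cH dH.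
have mDh : measurable_fun (`]a, b[ : set (measurableTypeR R)) (EFin \o h).
  by apply/measurable_EFinP; have [] := bdmeas_C0 ch.
rewrite -(@integral_itv_bndoo _ _ _ (EFin \o h) true false) //.
rewrite (@continuous_FTC2 _ h H a b) //; first exact: C0_within.
  split.
  - by move=> x; rewrite in_itv /= => /dH[].
  - by apply: cvg_at_right_filter; apply: cH; rewrite lexx ltW.
  - by apply: cvg_at_left_filter; apply: cH; rewrite lexx ltW.
by move=> x; rewrite in_itv /= derive1E => /dH dx; exact: (@derive_val _ _ _ _ _ _ _ dx).
Qed.

(** [mu] is absolutely continuous with respect to Lebesgue measure; its Radon-Nikodym derivative and
    [rho] have the same integral over every measurable part of [D], hence agree almost everywhere
    there. *)
Lemma ge0_integral_density (h : R -> \bar R) : (forall x, 0 <= h x)%E ->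
  measurable_fun D h ->
  (\int[mu]_(x in D) h x = \int[lebesgue_measure]_(x in D) (h x * (rho x)%:E))%E.
Proof.
move=> h0 mh.
have mrho : measurable_fun D (EFin \o rho).
  by apply/measurable_EFinP; have [] := bdmeas_C0 crho.
have rho_ge0 x : D x -> (0 <= (rho x)%:E)%E.
  rewrite /D /= in_itv /= => /andP[ax xb]; rewrite lee_fin ltW //.
  by apply: rho0; rewrite !ltW.
have numu : mu `<< (@lebesgue_measure R).
  apply/null_content_dominatesP => A mA A0; rewrite Hmu //.
  apply: null_set_integral => //.
  - by apply: measurableI => //; exact mD.
  - by apply: measurable_funS mrho; [exact mD|exact: subIsetr].
  - by apply: (subset_measure0 (B := A)) => //; apply: measurableI => //; exact mD.
rewrite -(Radon_Nikodym_SigmaFinite.change_of_variables numu) //; last exact mD.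
apply: ae_eq_integral => //.
- exact mD.
- apply: emeasurable_funM => //; apply: measurable_funTS.
  exact: (measurable_int _ (Radon_Nikodym_SigmaFinite.f_integrable numu)).
- exact: emeasurable_funM.
- suff: ae_eq lebesgue_measure D (Radon_Nikodym_SigmaFinite.f mu lebesgue_measure) (EFin \o rho).
    by apply: filterS => x /= /[apply] ->.
  apply: integral_ae_eq => //.
  + exact mD.
  + apply: (integrableS measurableT) => //; first exact mD.
    exact: Radon_Nikodym_SigmaFinite.f_integrable.
  + move=> A AD mA; transitivity (mu A).
      exact (esym (Radon_Nikodym_SigmaFinite.f_integral numu mA)).
    rewrite Hmu //.
    by congr (integral _ _ _); apply/setIidPl.
Qed.

(** The density formula is available for nonnegative integrands, so [h] is shifted by a bound [M].
    The shift adds [M] times the total mass, which is the increment 1 of the primitive [V] of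
    [rho]. *)
Lemma mean_FTC h H : C0 a b h -> (forall x, a <= x <= b -> der H x (h x * rho x)) ->
  mean h = H b - H a.
Proof.
move=> ch dH.
have [M [M0 HM]] := C0_bounded (ltW hab) ch.
have ch' : C0 a b (fun x => h x + M) by apply: C0D => //; exact: C0_cst.
pose V := prim a b rho.
have dV : forall x, a <= x <= b -> der V x (rho x) := prim_der hab crho.
have pos x : a < x < b -> 0 <= h x + M.
  by move=> /ltW2/HM; rewrite ler_norml => /andP[+ _]; lra.
have Epos g G : C0 a b g -> (forall x, a < x < b -> 0 <= g x) ->
    (forall x, a <= x <= b -> der G x (g x * rho x)) -> mean g = G b - G a.
  move=> cg g0 dG; rewrite /mean /Rintegral.
  transitivity (fine (\int[lebesgue_measure]_(x in D) (`|g x|%:E * (rho x)%:E))%E).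
    congr fine; rewrite -ge0_integral_density.
    - by apply: eq_integral => x; rewrite inE /D /= in_itv /= => /g0/ger0_norm ->.
    - by move=> x; rewrite lee_fin.
    - by apply/measurable_EFinP; have [] := bdmeas_abs (bdmeas_C0 cg).
  rewrite [X in fine X](_ : _ = \int[lebesgue_measure]_(x in D) (g x * rho x)%:E)%E; last first.
    by apply: eq_integral => x; rewrite inE /D /= in_itv /= => /g0/ger0_norm ->.
  rewrite (@FTC2_oo (fun x => g x * rho x) G) //; first exact: C0M.
    exact: C0_der dG.
  by move=> x /andP[ax xb]; apply: dG; rewrite !ltW.
have E1 : mean (fun=> 1) = V b - V a.
  by apply: Epos => //; [exact: C0_cst|move=> x /dV H1; rewrite mul1r].
have := @Epos (fun x => h x + M) (fun x => H x + M * V x) ch' pos _.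
rewrite meanD; [|exact: bdmeas_C0|exact: bdmeas_cst]; rewrite mean_cst.
have -> : V b = 1 + V a by rewrite -(mean_cst 1) E1; ring.
move=> HH; suff : mean h + M = H b + M * (1 + V a) - (H a + M * V a) by lra.
by apply: HH => x xab; apply: derE (derD (dH x xab) (derZ M (dV x xab))) _; ring.
Qed.

End Expect.

(** * The linear initial value problem *)

Section Ode.
Context {R : realType}.
Variables (a b : R) (rho : R -> R).
Hypothesis hab : a < b.
Hypothesis crho : C0 a b rho.
Hypothesis rho0 : forall x, a <= x <= b -> 0 < rho x.

(** Adding or subtracting the tail bound [2 C / 2^k] makes the sequence monotone in one direction or
    the other; this yields the limit together with the rate. *)
Lemma geometric_cauchy_cvg (u : nat -> R) C : (forall k, `|u k.+1 - u k| <= C / 2 ^+ k) ->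
  exists l, forall k, `|u k - l| <= 2 * C / 2 ^+ k.
Proof.
move=> Hu.
have C_ge0 : 0 <= C by have := Hu 0%N; rewrite expr0 divr1; apply: le_trans.
have p2 k : 0 < (2 : R) ^+ k by rewrite exprn_gt0.
pose w k := u k + 2 * C / 2 ^+ k.
pose z k := u k - 2 * C / 2 ^+ k.
have hS k : C / 2 ^+ k = 2 * C / 2 ^+ k.+1.
  by rewrite exprS invfM; field; rewrite lt0r_neq0.
have h2 k : 2 * C / 2 ^+ k = C / 2 ^+ k + C / 2 ^+ k by ring.
have wS k : w k.+1 <= w k.
  by have := Hu k; rewrite ler_norml /w -(hS k) h2 => /andP[_ h]; lra.
have zS k : z k <= z k.+1.
  by have := Hu k; rewrite ler_norml /z -(hS k) h2 => /andP[h _]; lra.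
have wd : nonincreasing_seq w by apply/nonincreasing_seqP.
have zi : nondecreasing_seq z by apply/nondecreasing_seqP.
have zw k j : z k <= w j.
  apply: le_trans (zi _ _ (leq_maxl k j)) _; apply: le_trans (wd _ _ (leq_maxr k j)).
  by rewrite /z /w lerD2l ge0_cp // divr_ge0 ?mulr_ge0 // ltW.
have lw : has_lbound (range w) by exists (z 0%N) => _ [j _ <-]; exact: zw.
have cw := nonincreasing_is_cvgn wd lw.
exists (limn w) => k; rewrite ler_distl; apply/andP; split.
  rewrite lerBlDr; exact: nonincreasing_cvgn_ge.
rewrite -lerBlDr; apply: limr_ge => //; by apply: nearW => j; exact: zw.
Qed.

(** Integrate the bound on [f'] from [a] and drop the constant [- B / N]: each integration gains a
    factor [1 / N]. *)
Lemma der_exp_bound f f' B N : 0 < N -> f a = 0 -> (forall x, a <= x <= b -> der f x (f' x)) ->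
  (forall x, a <= x <= b -> `|f' x| <= B * expR (N * (x - a))) ->
  forall x, a <= x <= b -> `|f x| <= B / N * expR (N * (x - a)).
Proof.
move=> N0 fa df f'B x /andP[ax xb].
have B0 : 0 <= B.
  have := f'B a; rewrite lexx ltW // subrr mulr0 expR0 mulr1 => /(_ isT) h;
    rewrite (le_trans _ h) //.
pose g t := B / N * expR (N * (t - a)).
have dg t : der g t (B * expR (N * (t - a))).
  apply: derE.
    apply: derZ; apply: (der_comp (f := expR)).
      by apply: derZ; apply: derB; [exact: der_id|exact: der_cst].
    exact: is_derive_expR.
  by field; rewrite lt0r_neq0.
have := @normr_der _ a b f g f' (fun t => B * expR (N * (t - a))) (C0_der df) _ _ _ _ a x (lexx a) ax xb.
rewrite fa subr0 => H; apply: le_trans (H _ _ _ _) _.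
- by apply: C0_der => t _; exact: dg.
- by move=> t /ltW2; exact: df.
- by move=> t _; exact: dg.
- by move=> t /ltW2; exact: f'B.
by rewrite /g lerBlDr lerDl mulr_ge0 ?expR_ge0 // divr_ge0 // ltW.
Qed.

(** [V f] is the flux that the second equation attaches to a profile [f], and [T lam f] the profile
    that the first equation returns: a fixed point of [T lam] solves the initial value problem. *)
Let V (f : R -> R) x := - prim a b (fun t => rho t * f t) x.
Let T lam (f : R -> R) x := -1 + lam * prim a b (fun t => V f t / rho t) x.

Let cVf f : C0 a b f -> C0 a b (V f).
Proof. by move=> cf; apply: C0N; apply: prim_C0 => //; exact: C0M. Qed.

Let dVf f x : C0 a b f -> a <= x <= b -> der (V f) x (- (rho x * f x)).
Proof. by move=> cf xab; apply: derN; apply: prim_der => //; exact: C0M. Qed.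

Let cVrho f : C0 a b f -> C0 a b (fun t => V f t / rho t).
Proof.
by move=> cf; apply: C0M; [exact: cVf|apply: C0V => // x /rho0/lt0r_neq0].
Qed.

Let dTf lam f x : C0 a b f -> a <= x <= b -> der (T lam f) x (lam * (V f x / rho x)).
Proof.
move=> cf xab; apply: derE; first apply: derD; first exact: der_cst.
  by apply: derZ; apply: prim_der => //; exact: cVrho.
by rewrite add0r.
Qed.

Let cTf lam f : C0 a b f -> C0 a b (T lam f).
Proof. by move=> cf; apply: C0_der => x; exact: dTf. Qed.

(** Bielecki weights [expR (N (x - a))] make the Picard iteration a contraction. *)
Let T_contr lam : 0 <= lam -> exists N, 0 < N /\ forall f g B, C0 a b f -> C0 a b g ->
  (forall x, a <= x <= b -> `|f x - g x| <= B * expR (N * (x - a))) ->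
  forall x, a <= x <= b -> `|T lam f x - T lam g x| <= B / 2 * expR (N * (x - a)).
Proof.
move=> lam0.
have [M [M0 HM]] := C0_bounded (ltW hab) crho.
have [m [m0 Hm]] := C0_pos_lb (ltW hab) crho rho0.
(* [T] integrates twice, so its Lipschitz constant is [lam M / (m N^2)]; as [N] is at least 1 and at
   least [2 lam M / m], this is at most 1/2. *)
pose N := 1 + 2 * lam * M / m.
have q0 : 0 <= 2 * lam * M / m by rewrite divr_ge0 ?mulr_ge0 ?(ltW M0) ?(ltW m0).
have N1 : 1 <= N by rewrite /N lerDl.
have N0 : 0 < N by rewrite (lt_le_trans ltr01).
exists N; split => // f g B cf cg fgB.
have B0 : 0 <= B.
  have := fgB a; rewrite lexx ltW // subrr mulr0 expR0 mulr1 => /(_ isT) h;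
    rewrite (le_trans _ h) //.
have H1 x : a <= x <= b -> `|V f x - V g x| <= M * B / N * expR (N * (x - a)).
  move: x; apply: (@der_exp_bound (fun x => V f x - V g x) (fun x => - (rho x * f x) - - (rho x * g x))) => //.
  - by rewrite /V !prim_a subrr.
  - by move=> t tab; apply: derB; exact: dVf.
  - move=> t tab; have -> : - (rho t * f t) - - (rho t * g t) = - (rho t * (f t - g t)) by ring.
    by rewrite normrN normrM -mulrA ler_pM //; [exact: HM|exact: fgB].
move=> x xab.
have := @der_exp_bound (fun x => T lam f x - T lam g x)
  (fun x => lam * (V f x / rho x) - lam * (V g x / rho x)) (lam / m * (M * B / N)) N N0 _ _ _ x xab.
move=> H; apply: le_trans (H _ _ _) _.
- by rewrite /T !prim_a subrr.
- by move=> t tab; apply: derB; exact: dTf.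
- move=> t tab; have -> : lam * (V f t / rho t) - lam * (V g t / rho t) =
    (lam / rho t) * (V f t - V g t) by ring.
  rewrite normrM -[leRHS]mulrA ler_pM //; last exact: H1.
  rewrite ger0_norm; last by rewrite divr_ge0 // ltW // rho0.
  by rewrite ler_wpM2l // lef_pV2 ?posrE ?rho0 // Hm.
rewrite ler_pM2r ?expR_gt0 //.
have -> : lam / m * (M * B / N) / N = B / 2 * (2 * lam * M / m / N ^+ 2).
  by field; rewrite !lt0r_neq0.
rewrite ler_piMr //; first by rewrite divr_ge0.
rewrite ler_pdivrMr ?exprn_gt0 // mul1r expr2.
have h : 2 * lam * M / m <= N by rewrite /N lerDr.
by apply: (le_trans h); rewrite ler_peMr // ltW.
Qed.

Lemma ivp_exists lam : 0 <= lam -> exists phi v : R -> R,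
  [/\ phi a = -1, v a = 0,
     forall x, a <= x <= b -> der phi x (lam * v x / rho x) &
     forall x, a <= x <= b -> der v x (- rho x * phi x)].
Proof.
move=> lam0; have [N [N0 TN]] := T_contr lam0.
pose u k := iter k (T lam) (fun=> -1).
have cu k : C0 a b (u k).
  by elim: k => [|k IH]; [exact: C0_cst|exact: cTf].
have [A [A0 HA]] := C0_bounded (ltW hab) (C0B (cu 1%N) (cu 0%N)).
have e1 x : a <= x <= b -> 1 <= expR (N * (x - a)).
  by move=> /andP[ax _]; rewrite -[leLHS]expR0 ler_expR mulr_ge0 ?subr_ge0 // ltW.
have eC x : a <= x <= b -> expR (N * (x - a)) <= expR (N * (b - a)).
  by move=> /andP[ax xb]; rewrite ler_expR ler_wpM2l ?(ltW N0) // lerD2r.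
set C := expR (N * (b - a)) in eC.
have C0' : 0 < C by exact: expR_gt0.
have p2 k : 0 < (2 : R) ^+ k by rewrite exprn_gt0.
have du k x : a <= x <= b -> `|u k.+1 x - u k x| <= A / 2 ^+ k * expR (N * (x - a)).
  elim: k x => [|k IH] x xab.
    rewrite expr0 divr1; apply: le_trans (HA x xab) _.
    by rewrite ler_peMr ?e1 // ltW.
  have -> : A / 2 ^+ k.+1 = A / 2 ^+ k / 2 by rewrite exprSr invfM mulrA.
  exact: (TN (u k.+1) (u k) (A / 2 ^+ k)).
have ex x : exists l, a <= x <= b -> forall k, `|u k x - l| <= 2 * (A * C) / 2 ^+ k.
  have [xab|] := boolP (a <= x <= b); last by exists 0.
  have [|l Hl] := @geometric_cauchy_cvg (u ^~ x) (A * C).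
    move=> k; apply: le_trans (du k x xab) _.
    by rewrite mulrAC ler_wpM2r ?invr_ge0 ?(ltW (p2 k)) // ler_wpM2l ?(ltW A0) // eC.
  by exists l.
have [L HL] := choice ex.
have ab' := ltW hab.
pose w x := L (clamp a b x).
have Hw k x : `|u k (clamp a b x) - w x| <= 2 * (A * C) / 2 ^+ k.
  by apply: HL; exact: clamp_itv.
have small (e K : R) : 0 < e -> exists k, K / 2 ^+ k < e.
  move=> e0; have : (fun k => K / 2 ^+ k) @ \oo --> (0 : R).
    have -> : (fun k => K / 2 ^+ k) = geometric K (2^-1) by apply/funext => k /=; rewrite exprVn.
    by apply: cvg_geometric; rewrite ger0_norm; lra.
  move=> /cvgrPdist_lt/(_ e e0)[k _ /(_ k (leqnn k))] /=.
  by rewrite sub0r normrN => h; exists k; rewrite (le_lt_trans (ler_norm _)).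
have cw : C0 a b w.
  move=> x _; apply/cvgrPdist_lt => e e0.
  have [k Hk] := small (e / 3) (2 * (A * C)) ltac:(lra).
  have := clamp_C0 ab' (cu k) (x := x).
  move=> /cvgrPdist_lt/(_ (e / 3) ltac:(lra)); apply: filterS => y /= Hy.
  have h1 := Hw k x; have h2 := Hw k y; rewrite distrC in h1.
  have -> : w x - w y = (w x - u k (clamp a b x)) + (u k (clamp a b x) - u k (clamp a b y)) +
    (u k (clamp a b y) - w y) by ring.
  apply: le_lt_trans (ler_normD _ _) _.
  have := ler_normD (w x - u k (clamp a b x)) (u k (clamp a b x) - u k (clamp a b y)).
  lra.
(* [T lam w] is differentiable by construction; the fixed point equation [w = T lam w] enters only
   in the equation for the flux. *)
exists (T lam w), (V w); split.
- by rewrite /T prim_a mulr0 addr0.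
- by rewrite /V prim_a oppr0.
- by move=> x xab; apply: derE; [exact: dTf|rewrite mulrA].
have wT x : a <= x <= b -> w x = T lam w x.
  move=> xab; apply/eqP; rewrite -subr_eq0 -normr_le0; apply/ler_addgt0Pl => e e0.
  rewrite addr0.
  have [k Hk] := small (e / 3) (2 * (A * C)) ltac:(lra).
  have [k' Hk'] := small (e / 3) (2 * (A * C) * C) ltac:(lra).
  (* Both sides are compared with the iterate [u j.+1 = T lam (u j)]. *)
  pose j := maxn k k'.
  have le2 (i : nat) : (i <= j)%N -> (2 ^+ j)^-1 <= (2 ^+ i)^-1 :> R.
    by move=> ij; rewrite lef_pV2 ?posrE // ler_weXn2l // ler1n.
  have AC0 : 0 <= 2 * (A * C) by rewrite !mulr_ge0 // ltW.
  have h1 : `|u j.+1 x - w x| <= 2 * (A * C) / 2 ^+ k.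
    have := Hw j.+1 x; rewrite clamp_id // => /le_trans; apply.
    rewrite ler_wpM2l //; apply: le_trans (le2 k (leq_maxl _ _)).
    by rewrite lef_pV2 ?posrE // ler_weXn2l // ler1n.
  have h2 : `|T lam (u j) x - T lam w x| <= 2 * (A * C) * C / 2 ^+ k'.
    have Bw y : a <= y <= b -> `|u j y - w y| <= 2 * (A * C) / 2 ^+ j * expR (N * (y - a)).
      move=> yab; have := Hw j y; rewrite clamp_id // => /le_trans; apply.
      by rewrite ler_peMr ?e1 // divr_ge0 // ltW.
    have := TN (u j) w _ (cu j) cw Bw x xab => /le_trans; apply.
    apply: le_trans (_ : 2 * (A * C) / 2 ^+ j * C <= _).
      rewrite ler_pM ?expR_ge0 ?eC // ?divr_ge0 // ?divr_ge0 ?(ltW (p2 j)) //.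
      by rewrite ler_piMr ?divr_ge0 ?(ltW (p2 j)) //; lra.
    rewrite mulrAC ler_wpM2l ?le2 ?leq_maxr // mulr_ge0 // (ltW C0') //.
  have split3 (p q r : R) : p - q = - (r - p) + (r - q) by ring.
  rewrite (split3 _ _ (T lam (u j) x)).
  by apply: le_trans (ler_normD _ _) _; rewrite normrN; lra.
by move=> x xab; apply: derE; [exact: dVf|rewrite -wT // mulNr].
Qed.

End Ode.

(** * Picone's identity *)

Section Eigen.
Context {R : realType}.
Variables (a b : R) (rho : R -> R).
Hypothesis hab : a < b.
Hypothesis crho : C0 a b rho.
Hypothesis rho0 : forall x, a <= x <= b -> 0 < rho x.

Lemma der_expand (f : R -> R) c l e : 0 < e -> der f c l ->
  \forall x \near c, `|f x - f c - l * (x - c)| <= e * `|x - c|.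
Proof.
move=> e0 df; have [drv dl] := df.
have : (h^-1 *: ((f \o shift c) (h *: 1) - f c)) @[h --> 0^'] --> l by rewrite -dl; exact: drv.
move=> /cvgrPdist_le/(_ e e0); rewrite near_withinE => /nbhs_ballP[d /= d0 Hd].
apply/nbhs_ballP; exists d => //= x; rewrite /ball /= => xd.
have [->|xc] := eqVneq x c; first by rewrite !subrr mulr0 subr0 normr0 mulr0.
have h0 : x - c != 0 by rewrite subr_eq0.
have xd' : ball 0 d (x - c) by rewrite /ball /= sub0r normrN distrC.
have := Hd _ xd' h0.
rewrite /GRing.scale /= mulr1 subrK => H.
have -> : f x - f c - l * (x - c) = - (l - (x - c)^-1 * (f x - f c)) * (x - c) by field.
by rewrite normrM normrN ler_wpM2r.
Qed.

(** Only a zero of [v] is delicate: there [F] is at most of order [|x - c|] and [v] at least of that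
    order, so the quotient is [O(|x - c|)] and tends to 0, the value of [0 / 0]. *)
Lemma sqr_div_continuous (F v : R -> R) c F' v' : F c = 0 -> der F c F' -> der v c v' ->
  v c != 0 \/ v' != 0 -> {for c, continuous (fun x => F x ^+ 2 / v x)}.
Proof.
move=> Fc dF dv H.
have [vc|vc] := eqVneq (v c) 0; last first.
  apply: continuousM; first exact: der_cont (derX2 dF).
  by apply: continuousV => //; exact: der_cont dv.
have v'0 : v' != 0 by case: H => //; rewrite vc eqxx.
have nv' : 0 < `|v'| / 2 by rewrite divr_gt0 ?normr_gt0.
pose K := (`|F'| + 1) ^+ 2 / (`|v'| / 2).
have K0 : 0 <= K by rewrite divr_ge0 ?sqr_ge0 // ltW.
apply/cvgrPdist_lt => e e0.
have hF := der_expand ltr01 dF.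
have hv := der_expand nv' dv.
have hx : \forall x \near c, `|x - c| < e / (K + 1).
  apply/nbhs_ballP; exists (e / (K + 1)) => /=; first by rewrite divr_gt0 //; lra.
  by move=> x; rewrite /ball /= distrC.
near=> x.
have hFx : `|F x - F c - F' * (x - c)| <= 1 * `|x - c| by near: x.
have hvx : `|v x - v c - v' * (x - c)| <= `|v'| / 2 * `|x - c| by near: x.
have hxx : `|x - c| < e / (K + 1) by near: x.
rewrite Fc expr0n /= mul0r sub0r normrN.
move: hFx; rewrite Fc subr0 mul1r => hFx.
move: hvx; rewrite vc subr0 => hvx.
have F1 : `|F x| <= (`|F'| + 1) * `|x - c|.
  have -> : F x = (F x - F' * (x - c)) + F' * (x - c) by ring.
  apply: le_trans (ler_normD _ _) _; rewrite normrM mulrDl mul1r addrC lerD2l //.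
have v1 : `|v'| / 2 * `|x - c| <= `|v x|.
  have h : `|v' * (x - c)| <= `|v x| + `|v x - v' * (x - c)|.
    by rewrite -[X in `|X| <= _](subKr (v x)) ler_normB.
  rewrite normrM in h; lra.
have [xc|xc] := eqVneq x c.
  by rewrite xc Fc expr0n /= mul0r normr0.
have xc0 : 0 < `|x - c| by rewrite normr_gt0 subr_eq0.
have vx0 : 0 < `|v x| by apply: lt_le_trans v1; rewrite mulr_gt0.
rewrite normrM normfV normrX ltr_pdivrMr //.
apply: le_lt_trans (_ : ((`|F'| + 1) * `|x - c|) ^+ 2 < _).
  by rewrite ler_sqr ?nnegrE // mulr_ge0 // addr_ge0.
have -> : ((`|F'| + 1) * `|x - c|) ^+ 2 = K * `|x - c| * (`|v'| / 2 * `|x - c|).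
  by rewrite /K; field; rewrite normr_eq0.
apply: le_lt_trans (_ : K * `|x - c| * `|v x| < _).
  by rewrite ler_wpM2l // mulr_ge0.
rewrite ltr_pM2r //; apply: le_lt_trans (_ : (K + 1) * `|x - c| < _).
  by rewrite ler_wpM2r //; lra.
by rewrite mulrC -ltr_pdivlMr //; lra.
Unshelve. all: by end_near. Qed.

(** The eigenvalue equation [(rho phi')' = - lam rho phi] as a first order system,
    with [lam v] standing for the flux [rho phi']; dividing the flux by [lam] keeps
    the system nondegenerate at [lam = 0]. *)
Definition ivp lam (phi v : R -> R) :=
  [/\ phi a = -1, v a = 0,
     forall x, a <= x <= b -> der phi x (lam * v x / rho x) &
     forall x, a <= x <= b -> der v x (- rho x * phi x)].

(** [H1 + F^2 phi / v] has derivative [rho (f + F phi / v)^2]. At the end points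
    the junk value [0 / 0 = 0] is the limit of [F^2 / v]. *)
Lemma picone lam phi v F f H1 : ivp lam phi v -> (forall x, a < x < b -> 0 < v x) ->
  v b != 0 \/ phi b != 0 ->
  (forall x, a <= x <= b -> der F x (rho x * f x)) -> F a = 0 -> F b = 0 ->
  (forall x, a <= x <= b -> der H1 x (rho x * f x ^+ 2 - lam * F x ^+ 2 / rho x)) ->
  H1 a <= H1 b.
Proof.
move=> [phia va dphi dv] v0 vb dF Fa Fb dH.
pose G x := H1 x + F x ^+ 2 / v x * phi x.
pose g x := rho x * (f x + F x * phi x / v x) ^+ 2.
have aab : a <= a <= b by rewrite lexx ltW.
have bab : a <= b <= b by rewrite lexx ltW.
have r0 x : a <= x <= b -> rho x != 0 by move=> /rho0/lt0r_neq0.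
have cG : C0 a b G.
  move=> x xab; apply: continuousD; first exact: der_cont (dH x xab).
  apply: continuousM; last exact: der_cont (dphi x xab).
  (* At [a] the flux vanishes to first order only, since its derivative there is [rho a]; at [b] the
     assumption on [v b] and [phi b] excludes a double zero. *)
  have [->|xa] := eqVneq x a.
    apply: (sqr_div_continuous Fa (dF _ aab) (dv _ aab)); right.
    by rewrite phia mulrN1 opprK r0.
  have [->|xb] := eqVneq x b.
    apply: (sqr_div_continuous Fb (dF _ bab) (dv _ bab)).
    by case: vb => [?|pb]; [left|right]; rewrite // mulf_neq0 // oppr_eq0 r0.
  apply: continuousM; first exact: der_cont (derX2 (dF x xab)).
  apply: continuousV; last exact: der_cont (dv x xab).
  case/andP: xab => ax xb'; apply: lt0r_neq0; apply: v0.
  by rewrite !lt_neqAle eq_sym xa ax xb xb'.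
have dG x : a < x < b -> der G x (g x).
  move=> xab; have xab' := ltW2 xab; have vx := lt0r_neq0 (v0 x xab).
  apply: derE.
    apply: derD; first exact: dH.
    by apply: derM; [apply: derM; [exact: derX2 (dF x xab')|exact: derV vx (dv x xab')]|exact: dphi].
  by rewrite /g; field; rewrite vx r0.
have : G a <= G b.
  apply: (ler_der cG dG) => //; last exact: ltW.
  by move=> x /ltW2 xab; rewrite mulr_ge0 ?sqr_ge0 // ltW // rho0.
by rewrite /G Fa Fb expr0n /= !mul0r !addr0.
Qed.

End Eigen.

(** * Dependence of the solution on the parameter *)

Section Eigen2.
Context {R : realType}.
Variables (a b : R) (rho : R -> R).
Hypothesis hab : a < b.
Hypothesis crho : C0 a b rho.
Hypothesis rho0 : forall x, a <= x <= b -> 0 < rho x.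

Local Notation ivp := (ivp a b rho).

(** The derivative of [phi^2 + v^2] is at least [- K (phi^2 + v^2)], so the sum decays at most
    exponentially from its value 1 at [a]. *)
Lemma ivp_nondegenerate lam phi v : 0 <= lam -> ivp lam phi v ->
  forall c, a <= c <= b -> 0 < phi c ^+ 2 + v c ^+ 2.
Proof.
move=> lam0 [phia va dphi dv] c /andP[ac cb].
have [M [M0 HM]] := C0_bounded (ltW hab) crho.
have [m [m0 Hm]] := C0_pos_lb (ltW hab) crho rho0.
pose K := lam / m + M.
pose S x := expR (K * x) * (phi x ^+ 2 + v x ^+ 2).
pose S' x := K * expR (K * x) * (phi x ^+ 2 + v x ^+ 2) +
  expR (K * x) * (2 * phi x * (lam * v x / rho x) + 2 * v x * (- rho x * phi x)).
have dS x : a <= x <= b -> der S x (S' x).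
  move=> xab; apply: derM; first exact: der_exp.
  by apply: derD; apply: derX2; [exact: dphi|exact: dv].
have S'0 x : a < x < b -> 0 <= S' x.
  move=> /ltW2 xab.
  have -> : S' x = expR (K * x) * (K * (phi x ^+ 2 + v x ^+ 2) + 2 * (phi x * v x) * (lam / rho x - rho x)).
    by rewrite /S'; field; rewrite lt0r_neq0 // rho0.
  rewrite mulr_ge0 ?expR_ge0 //.
  have h1 : `|lam / rho x - rho x| <= K.
    apply: le_trans (ler_normB _ _) _; rewrite lerD ?HM // ger0_norm.
      by rewrite ler_wpM2l // lef_pV2 ?posrE ?rho0 // Hm.
    by rewrite divr_ge0 // ltW // rho0.
  have h2 : `|2 * (phi x * v x)| <= phi x ^+ 2 + v x ^+ 2.
    have := sqr_ge0 (phi x - v x); have := sqr_ge0 (phi x + v x).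
    by rewrite ler_norml => ? ?; apply/andP; split; lra.
  have h3 : `|2 * (phi x * v x) * (lam / rho x - rho x)| <= (phi x ^+ 2 + v x ^+ 2) * K.
    by rewrite normrM ler_pM.
  move: h3; rewrite ler_norml => /andP[h3 _]; lra.
have := ler_der (C0_der dS) (fun x xab => dS x (ltW2 xab)) S'0 (lexx a) ac cb.
rewrite {1}/S phia va => h.
have : 0 < S c by apply: lt_le_trans h; rewrite mulr_gt0 ?expR_gt0 //; lra.
by rewrite /S pmulr_rgt0 // expR_gt0.
Qed.

(** Gronwall for [phi^2 + v^2] with a rate that depends on the parameter through [L] only. *)
Lemma ivp_bounded L : 0 <= L -> exists B, 0 < B /\ forall lam phi v, 0 <= lam <= L ->
  ivp lam phi v -> forall x, a <= x <= b -> `|phi x| <= B /\ `|v x| <= B.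
Proof.
move=> L0.
have [M [M0 HM]] := C0_bounded (ltW hab) crho.
have [m [m0 Hm]] := C0_pos_lb (ltW hab) crho rho0.
pose K := L / m + M.
have K0 : 0 <= K by rewrite addr_ge0 ?(ltW M0) // divr_ge0 // ltW.
exists (expR (K * (b - a))); split => [|lam phi v /andP[lam0 lamL] [phia va dphi dv] x xab].
  exact: expR_gt0.
have e1 : 1 <= expR (K * (b - a)).
  by rewrite -[leLHS]expR0 ler_expR mulr_ge0 // subr_ge0 ltW.
(* The exponential is at least 1, so it bounds [|phi|] and [|v|] as soon as it bounds the sum of
   their squares. *)
suff H : phi x ^+ 2 + v x ^+ 2 <= expR (K * (b - a)).
  have s0 : 0 <= expR (K * (b - a)) by exact: expR_ge0.
  have s1 : expR (K * (b - a)) <= expR (K * (b - a)) ^+ 2 by rewrite expr2 ler_peMr.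
  have h1 := sqr_ge0 (phi x); have h2 := sqr_ge0 (v x).
  split; rewrite -ler_sqr ?nnegrE ?normr_ge0 // -normrX ger0_norm ?sqr_ge0 //; lra.
pose S x := phi x ^+ 2 + v x ^+ 2.
pose S' x := 2 * phi x * (lam * v x / rho x) + 2 * v x * (- rho x * phi x).
have dS y : a <= y <= b -> der S y (S' y).
  by move=> yab; apply: derD; apply: derX2; [exact: dphi|exact: dv].
have := @gronwall _ a b S S' K 0 (lexx 0) K0 (C0_der dS) (fun y yab => dS y (ltW2 yab)) _ x xab.
rewrite /S phia va mul0r addr0 expr0n /= addr0 sqrrN expr1n (max_idPr ler01) mul1r; apply.
move=> y /ltW2 yab; rewrite addr0.
have -> : S' y = 2 * (phi y * v y) * (lam / rho y - rho y).
  by rewrite /S'; field; rewrite lt0r_neq0 // rho0.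
have h1 : `|lam / rho y - rho y| <= K.
  apply: le_trans (ler_normB _ _) _; rewrite lerD ?HM // ger0_norm.
    by rewrite ler_pM ?invr_ge0 ?(ltW (rho0 yab)) // lef_pV2 ?posrE ?rho0 // Hm.
  by rewrite divr_ge0 // ltW // rho0.
have h2 : `|2 * (phi y * v y)| <= phi y ^+ 2 + v y ^+ 2.
  have := sqr_ge0 (phi y - v y); have := sqr_ge0 (phi y + v y).
  by rewrite ler_norml => ? ?; apply/andP; split; lra.
by apply: (le_trans (ler_norm _)); rewrite normrM mulrC ler_pM.
Qed.

(** Prevents the first zero of the flux from drifting to [a] as the parameter varies: near [a],
    uniformly in the parameter, [phi] stays below [- 1/2] and the flux grows at rate at least
    [m / 2]. *)
Lemma ivp_lower_bound L : 0 <= L -> exists d e, [/\ 0 < d, 0 < e & forall lam phi v, 0 <= lam <= L ->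
  ivp lam phi v -> forall x, a <= x <= b -> x <= a + d -> e * (x - a) <= v x].
Proof.
move=> L0; have [B [B0 HB]] := ivp_bounded L0.
have [m [m0 Hm]] := C0_pos_lb (ltW hab) crho rho0.
pose Q := L * B / m.
have Q0 : 0 <= Q by rewrite divr_ge0 ?mulr_ge0 ?(ltW B0) ?(ltW m0).
(* [Q] bounds [phi'], so over this length [phi] rises from [-1] by at most 1/2. *)
exists (2 * (Q + 1))^-1, (m / 2); split; [by rewrite invr_gt0; lra|by lra|].
move=> lam phi v lamL sv x /andP[ax xb] xd; have [phia va dphi dv] := sv.
have /andP[lam0 lamL'] := lamL.
have Hphi y : a <= y -> y <= x -> phi y <= - 2^-1.
  move=> ay yx.
  have := @ler_der2 _ a b phi (fun t => Q * t) _ (fun=> Q * 1) (C0_der dphi) _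
    (fun t tab => dphi t (ltW2 tab)) _ _ a y (lexx a) ay (le_trans yx xb).
  rewrite phia => H.
  have : phi y - -1 <= Q * y - Q * a.
    apply: H => [|t _|t /ltW2 tab].
    - by apply: (@C0_der _ a b _ (fun=> Q * 1)) => t _; apply: derZ; exact: der_id.
    - by apply: derZ; exact: der_id.
    have [_ vB] := HB _ _ _ lamL sv t tab.
    rewrite mulr1; apply: (le_trans (ler_norm _)).
    rewrite normrM normrM normfV (ger0_norm lam0) (gtr0_norm (rho0 tab)) /Q.
    by rewrite ler_pM ?mulr_ge0 ?invr_ge0 ?(ltW (rho0 tab)) // ?lef_pV2 ?posrE ?rho0 ?Hm // ler_pM.
  have : Q * (y - a) <= Q * (2 * (Q + 1))^-1 by rewrite ler_wpM2l //; lra.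
  have : Q * (2 * (Q + 1))^-1 <= 2^-1.
    by rewrite ler_pdivrMr; lra.
  lra.
have := @ler_der2 _ a x (fun t => m / 2 * t) v (fun=> m / 2 * 1) (fun t => - rho t * phi t) _ _ _ _ _ a x (lexx a) ax (lexx x).
rewrite va => H.
suff : m / 2 * x - m / 2 * a <= v x - 0 by lra.
have sub t : a < t < x -> a <= t <= b by case/andP=> /ltW -> /ltW tx /=; exact: le_trans xb.
apply: H => [||t _|t tx|t tx].
- by apply: (@C0_der _ a x _ (fun=> m / 2 * 1)) => t _; apply: derZ; exact: der_id.
- by apply: (C0_sub (lexx a) xb); exact: C0_der dv.
- by apply: derZ; exact: der_id.
- by apply: dv; exact: sub.
have := Hm t (sub t tx); case/andP: (tx) => /ltW at' /ltW tx'.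
have := Hphi t at' tx' => h1 h2.
rewrite mulr1 mulNr -mulrN; apply: ler_pM; lra.
Qed.

(** Gronwall for the squared distance of the two solutions. The change of parameter acts as a
    forcing term [z], and [2 d z <= d^2 + z^2] accounts for the [+ 1] in [K]. *)
Lemma ivp_lipschitz L : 0 <= L -> exists C, 0 < C /\ forall lam phi v lam2 phi2 v2,
  0 <= lam <= L -> 0 <= lam2 <= L -> ivp lam phi v -> ivp lam2 phi2 v2 ->
  forall x, a <= x <= b -> (v x - v2 x) ^+ 2 <= C * (lam - lam2) ^+ 2.
Proof.
move=> L0; have [B [B0 HB]] := ivp_bounded L0.
have [M [M0 HM]] := C0_bounded (ltW hab) crho.
have [m [m0 Hm]] := C0_pos_lb (ltW hab) crho rho0.
pose K := L / m + M + 1.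
have K0 : 0 <= K by rewrite !addr_ge0 ?(ltW M0) // divr_ge0 // ltW.
pose C1 := (B / m) ^+ 2.
exists (C1 * (b - a) * expR (K * (b - a))); split.
  by rewrite !mulr_gt0 ?expR_gt0 ?subr_gt0 ?invr_gt0.
move=> lam phi v lam2 phi2 v2 lamL lam2L s1 s2 x xab.
have [phia va dphi dv] := s1; have [phi2a v2a dphi2 dv2] := s2.
have /andP[lam0 lamL'] := lamL.
pose S x := (phi x - phi2 x) ^+ 2 + (v x - v2 x) ^+ 2.
pose S' x := 2 * (phi x - phi2 x) * (lam * v x / rho x - lam2 * v2 x / rho x) +
  2 * (v x - v2 x) * (- rho x * phi x - - rho x * phi2 x).
have dS y : a <= y <= b -> der S y (S' y).
  by move=> yab; apply: derD; apply: derX2; apply: derB;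
    [exact: dphi|exact: dphi2|exact: dv|exact: dv2].
have c0 : 0 <= C1 * (lam - lam2) ^+ 2 by rewrite mulr_ge0 ?sqr_ge0.
have := @gronwall _ a b S S' K _ c0 K0 (C0_der dS) (fun y yab => dS y (ltW2 yab)) _ x xab.
have -> : Num.max 0 (S a) = 0 by rewrite /S phia phi2a va v2a !subrr expr0n /= addr0 maxxx.
rewrite add0r => H; apply: le_trans (_ : S x <= _); first by rewrite /S lerDr sqr_ge0.
apply: le_trans (H _) _; last first.
  by rewrite le_eqVlt; apply/orP; left; apply/eqP; ring.
move=> y /ltW2 yab.
have rn : rho y != 0 by rewrite lt0r_neq0 // rho0.
pose d := phi y - phi2 y; pose e := v y - v2 y.
pose z := (lam - lam2) * (v2 y / rho y).
have -> : S' y = 2 * (d * e) * (lam / rho y - rho y) + 2 * (d * z).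
  by rewrite /S' /d /e /z; field.
have -> : S y = d ^+ 2 + e ^+ 2 by [].
have h1 : `|lam / rho y - rho y| <= L / m + M.
  apply: le_trans (ler_normB _ _) _; rewrite lerD ?HM // ger0_norm.
    by rewrite ler_pM ?invr_ge0 ?(ltW (rho0 yab)) // lef_pV2 ?posrE ?rho0 // Hm.
  by rewrite divr_ge0 // ltW // rho0.
have h2 : `|2 * (d * e)| <= d ^+ 2 + e ^+ 2.
  have := sqr_ge0 (d - e); have := sqr_ge0 (d + e).
  by rewrite ler_norml => ? ?; apply/andP; split; lra.
have h3 : 2 * (d * e) * (lam / rho y - rho y) <= (d ^+ 2 + e ^+ 2) * (L / m + M).
  by apply: (le_trans (ler_norm _)); rewrite normrM ler_pM.
have h4 : z ^+ 2 <= C1 * (lam - lam2) ^+ 2.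
  rewrite /z exprMn mulrC ler_wpM2r ?sqr_ge0 // /C1 -ler_sqrt ?sqr_ge0 // !sqrtr_sqr.
  have [_ vB] := HB _ _ _ lam2L s2 y yab.
  rewrite [leRHS]ger0_norm; last by rewrite divr_ge0 // ltW.
  rewrite normrM normfV (gtr0_norm (rho0 yab)).
  by rewrite ler_pM ?invr_ge0 ?(ltW (rho0 yab)) // lef_pV2 ?posrE ?rho0 // Hm.
have h5 : 2 * (d * z) <= d ^+ 2 + z ^+ 2 by have := sqr_ge0 (d - z); lra.
have h6 := sqr_ge0 e.
rewrite /K; lra.
Qed.

End Eigen2.

(** * The first Neumann eigenfunction *)

Section Eigen3.
Context {R : realType}.
Variables (a b : R) (rho : R -> R).
Hypothesis hab : a < b.
Hypothesis crho : C0 a b rho.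
Hypothesis rho0 : forall x, a <= x <= b -> 0 < rho x.

Local Notation ivp := (ivp a b rho).

(** If the flux stayed positive, Picone's inequality would bound the parameter by the quotient of
    [int rho f^2] and [int F^2 / rho] for any [F] vanishing at both ends with [F' = rho f]. The
    parameter exceeds by 1 the quotient of [F = (x - a) (b - x)]. *)
Lemma ivp_nonpos_exists : exists lam, 0 <= lam /\ forall phi v, ivp lam phi v ->
  exists c, a < c <= b /\ v c <= 0.
Proof.
pose F x := (x - a) * (b - x).
pose f x := (1 * (b - x) + (x - a) * (0 - 1)) / rho x.
have dF0 x : der F x (1 * (b - x) + (x - a) * (0 - 1)).
  apply: derM; first by apply: derE (derB (der_id x) (der_cst a x)) _; ring.
  by apply: derB; [exact: der_cst|exact: der_id].
have dF x : a <= x <= b -> der F x (rho x * f x).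
  by move=> /rho0/lt0r_neq0 rn; apply: derE (dF0 x) _; rewrite /f; field.
have cF : C0 a b F by apply: C0_der => x _; exact: dF0.
have cr : C0 a b (fun x => (rho x)^-1) by apply: C0V => // x /rho0/lt0r_neq0.
have cid0 : C0 a b (fun x : R => x) by apply: (@C0_der _ a b _ (fun=> 1)) => x _; exact: der_id.
have cf : C0 a b f.
  apply: C0M => //; apply: C0D; apply: C0M; try exact: C0_cst; apply: C0B => //; exact: C0_cst.
pose A := prim a b (fun x => rho x * f x ^+ 2).
pose B := prim a b (fun x => F x ^+ 2 / rho x).
have dA x : a <= x <= b -> der A x (rho x * f x ^+ 2).
  by apply: prim_der => //; apply: C0M => //; exact: C0X.
have dB x : a <= x <= b -> der B x (F x ^+ 2 / rho x).
  by apply: prim_der => //; apply: C0M => //; exact: C0X.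
have A0 : A a <= A b.
  apply: (ler_der (C0_der dA) (fun x xab => dA x (ltW2 xab))) => //; last exact: ltW.
  by move=> x /ltW2 xab; rewrite mulr_ge0 ?sqr_ge0 // ltW // rho0.
have B0 : B a < B b.
  apply: (ltr_der (C0_der dB) (fun x xab => dB x (ltW2 xab))) => //.
  move=> x xab; rewrite divr_gt0 ?rho0 ?ltW2 // exprn_gt0 //.
  by case/andP: xab => ax xb; rewrite mulr_gt0 ?subr_gt0.
have BB : 0 < B b - B a by rewrite subr_gt0.
pose lam := (A b - A a) / (B b - B a) + 1.
have lam0 : 0 <= lam by rewrite addr_ge0 // divr_ge0 ?subr_ge0 // ltW.
exists lam; split => // phi v s.
apply/not_existsP => H.
have vpos c : a < c <= b -> 0 < v c.
  by move=> cab; rewrite ltNge; apply/negP => vc; apply: (H c).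
have bb : v b != 0 \/ phi b != 0 by left; rewrite lt0r_neq0 // vpos // hab lexx.
have := @picone _ a b rho hab rho0 lam phi v F f (fun x => A x - lam * B x) s _ bb dF.
rewrite /F !subrr mul0r mulr0 => HP.
have : A a - lam * B a <= A b - lam * B b.
  apply: HP => // [x /andP[ax xb]|x xab]; first by apply: vpos; rewrite ax ltW.
  by apply: derE (derB (dA x xab) (derZ lam (dB x xab))) _; rewrite /F; ring.
have : lam * (B b - B a) = A b - A a + (B b - B a) by rewrite /lam; field; rewrite lt0r_neq0.
lra.
Qed.

(** Shooting: the eigenvalue is the infimum [ls] of the parameters whose flux vanishes somewhere in
    [(a, b]]. It is attained, and the zero can only sit at [b]. *)
Lemma eigenpair : exists lam phi v, [/\ 0 < lam, ivp lam phi v,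
  forall x, a < x < b -> 0 < v x, v b = 0 & phi b != 0].
Proof.
pose P lam (q : (R -> R) * (R -> R)) := 0 <= lam -> ivp lam q.1 q.2.
(* One solution is fixed for each parameter; the Lipschitz bound, valid between any two solutions,
   makes the chosen flux continuous in the parameter. *)
have /choice[q Hq] lam : exists q, P lam q.
  have [lam0|lam0] := boolP (0 <= lam).
    by have [phi [v s]] := ivp_exists hab crho rho0 lam0; exists (phi, v) => _; exact: s.
  by exists (id, id) => h; rewrite h in lam0.
pose v lam := (q lam).2.
have sv lam : 0 <= lam -> ivp lam (q lam).1 (v lam) by exact: Hq.
pose Bad : set R := [set lam | 0 <= lam /\ exists c, a < c <= b /\ v lam c <= 0].
have Bad0 : Bad !=set0.
  by have [lam [lam0 H]] := ivp_nonpos_exists; exists lam; split => //; exact: H (sv lam lam0).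
have Badl : has_lbound Bad by exists 0 => lam [lam0 _]; exact: lam0.
have Badi : has_inf Bad by split.
pose ls := inf Bad.
have ls0 : 0 <= ls by apply: lb_le_inf => // lam [lam0 _]; exact: lam0.
pose L := ls + 1.
have L0 : 0 <= L by rewrite addr_ge0.
have lsL : 0 <= ls <= L by rewrite ls0 /L lerDl ler01.
have [C [C0' HC]] := ivp_lipschitz hab crho rho0 L0.
have [d [e [d0 e0 Hde]]] := ivp_lower_bound hab crho rho0 L0.
have close t : 0 < t -> exists r, 0 < r /\ forall lam, 0 <= lam <= L -> `|lam - ls| <= r ->
    forall x, a <= x <= b -> `|v lam x - v ls x| <= t.
  move=> t0; exists (t / (C + 1)); split; first by rewrite divr_gt0 //; lra.
  move=> lam lamL lr x xab.
  have /andP[lam0 _] := lamL.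
  have := HC _ _ _ _ _ _ lamL lsL (sv lam lam0) (sv ls ls0) x xab.
  move=> H; rewrite -ler_sqr ?nnegrE ?normr_ge0 ?(ltW t0) // -normrX ger0_norm ?sqr_ge0 //.
  apply: (le_trans H); rewrite -ler_sqr ?nnegrE // in lr;
    last by rewrite divr_ge0 ?(ltW t0) //; lra.
  rewrite -normrX ger0_norm ?sqr_ge0 // in lr.
  apply: le_trans (_ : C * (t / (C + 1)) ^+ 2 <= _); first by rewrite ler_wpM2l // ltW.
  rewrite expr_div_n mulrCA ler_piMr ?sqr_ge0 // ler_pdivrMr ?exprn_gt0; try lra.
  by have := sqr_ge0 C; lra.
have good lam : 0 <= lam -> lam < ls -> forall x, a < x <= b -> 0 < v lam x.
  move=> lam0 lls x xab; rewrite ltNge; apply/negP => vx.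
  have : ls <= lam by apply: ge_inf => //; split => //; exists x.
  lra.
(* The infimum is attained. Otherwise the flux at [ls] is bounded below on [[a + d', b]] and stays
   positive there for nearby parameters, while [ivp_lower_bound] handles [(a, a + d']]. *)
have Bls : exists c, a < c <= b /\ v ls c <= 0.
  apply/not_existsP => H.
  have vpos c : a < c <= b -> 0 < v ls c.
    by move=> cab; rewrite ltNge; apply/negP => vc; apply: (H c).
  have [phia va dphi dv] := sv ls ls0.
  pose d' := Num.min d (b - a).
  have d'0 : 0 < d' by rewrite lt_min d0 subr_gt0.
  have d'b : a + d' <= b by rewrite /d'; have : Num.min d (b - a) <= b - a by [rewrite ge_min lexx orbT]; lra.
  have d'd : d' <= d by rewrite ge_min lexx.
  have cv : C0 (a + d') b (v ls).
    by apply: (@C0_sub _ a b) => //; [lra|exact: C0_der dv].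
  have [|eta [eta0 Heta]] := C0_pos_lb d'b cv.
    by move=> x /andP[x1 x2]; apply: vpos; rewrite x2 andbT; lra.
  have [r [r0 Hr]] := close (eta / 2) ltac:(lra).
  pose r' := Num.min r 1.
  have r'0 : 0 < r' by rewrite lt_min r0 ltr01.
  have r'r : r' <= r by rewrite ge_min lexx.
  have r'1 : r' <= 1 by rewrite ge_min lexx orbT.
  have [lam [lam0 [c [/andP[ac cb] vc]]] lamr] := inf_adherent r'0 Badi.
  have lsl : ls <= lam by apply: ge_inf => //; split => //; exists c; rewrite ac cb.
  have lamL : 0 <= lam <= L by rewrite lam0 /L /=; rewrite -/ls in lamr; lra.
  have [cd|cd] := lerP c (a + d').
    have := Hde _ _ _ lamL (sv lam lam0) c; rewrite (ltW ac) cb => /(_ isT).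
    have -> : c <= a + d by lra.
    move=> /(_ isT); have : 0 < e * (c - a) by rewrite mulr_gt0 // subr_gt0.
    lra.
  have := Hr lam lamL; have -> : `|lam - ls| <= r by rewrite ger0_norm ?subr_ge0 //;
    rewrite -/ls in lamr; lra.
  move=> /(_ isT c); rewrite (ltW ac) cb ler_norml => /(_ isT) /andP[h1 _].
  have := Heta c; rewrite (ltW cd) cb => /(_ isT); lra.
(* At parameter 0, [phi] is constantly [-1] and the flux increases strictly from 0. *)
have lsp : 0 < ls.
  rewrite lt_neqAle ls0 andbT; apply/eqP => ls00.
  have [c [/andP[ac cb] vc]] := Bls.
  have [phia va dphi dv] := sv ls ls0.
  have phi1 x : a <= x <= b -> (q ls).1 x = -1.
    move=> /andP[ax xb].
    have := @normr_der _ a b (q ls).1 (fun=> 0) _ (fun=> 0) (C0_der dphi) (@C0_cst _ _ _ 0)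
      (fun t tab => dphi t (ltW2 tab)) (fun t _ => der_cst _ t) _ a x (lexx a) ax xb.
    rewrite phia subrr => H; apply/eqP; rewrite -subr_eq0 -normr_le0; apply: H => t _.
    by rewrite -ls00 !mul0r normr0.
  have := @ltr_der _ a b (v ls) _ (C0_der dv) (fun t tab => dv t (ltW2 tab)) _ a c (lexx a) ac cb.
  rewrite va => H; have : 0 < v ls c; last lra.
  by apply: H => t /ltW2 tab; rewrite phi1 // mulrN1 opprK rho0.
(* Below [ls] the flux is positive on [(a, b]], and it is continuous in the parameter. *)
have vge x : a <= x <= b -> 0 <= v ls x.
  move=> xab; rewrite leNgt; apply/negP => vx.
  have [|r [r0 Hr]] := close (- v ls x / 2); first lra.
  pose lam := Num.max 0 (ls - r).
  have lam0 : 0 <= lam by rewrite le_max lexx.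
  have lamls : lam < ls by rewrite gt_max lsp; lra.
  have lamr : ls - r <= lam by rewrite le_max lexx orbT.
  have [xa|xa] := eqVneq x a.
    by have [_ va _ _] := sv ls ls0; rewrite xa va ltxx in vx.
  have xab' : a < x <= b by case/andP: xab => ax ->; rewrite lt_neqAle eq_sym xa ax.
  have vl := good _ lam0 lamls x xab'.
  have : `|v lam x - v ls x| <= - v ls x / 2.
    apply: Hr => //; first by rewrite lam0 /L; lra.
    by rewrite distrC ger0_norm; lra.
  by rewrite ler_norml => /andP[]; lra.
have [phia va dphi dv] := sv ls ls0.
(* An interior zero would be a minimum of the nonnegative flux, so [v' = - rho phi] would vanish
   with [v], against [ivp_nondegenerate]. *)
have nz c : a < c < b -> v ls c != 0.
  move=> cab; apply/negP => /eqP vc.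
  have dvc : is_derive c 1 (v ls) 0.
    apply: (@derive1_at_min _ (v ls) a b c (ltW hab)) => //.
    - by move=> t; rewrite in_itv /= => /ltW2 /dv [].
    - by move=> t; rewrite in_itv /= => /ltW2 /vge; rewrite vc.
  have := dv c (ltW2 cab); move=> [_ D1]; move: dvc => [_ D2].
  rewrite D2 in D1.
  have := ivp_nondegenerate hab crho rho0 ls0 (sv ls ls0) (ltW2 cab).
  have rn := lt0r_neq0 (rho0 (ltW2 cab)).
  have : (q ls).1 c = 0.
    by apply/eqP; move/eqP: D1; rewrite eq_sym mulf_eq0 oppr_eq0 (negbTE rn).
  by move=> ->; rewrite vc expr0n /= addr0 ltxx.
have vb : v ls b = 0.
  have [c [/andP[ac cb] vc]] := Bls.
  have [<-|cneb] := eqVneq c b.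
    by apply/eqP; rewrite eq_le vc vge // (ltW ac) cb.
  have cab : a < c < b by rewrite ac lt_neqAle cneb.
  have := nz c cab; have := vge c (ltW2 cab) => h1 /eqP[].
  by apply/eqP; rewrite eq_le vc h1.
exists ls, (q ls).1, (v ls); split; [exact: lsp|exact: sv ls ls0| |exact: vb|].

- by move=> x xab; rewrite lt_neqAle eq_sym nz // vge // ltW2.
- apply/negP => /eqP pb.
have := ivp_nondegenerate hab crho rho0 ls0 (sv ls ls0) (c := b).
by rewrite pb vb expr0n /= addr0 ltxx lexx (ltW hab) => /(_ isT).
Qed.

End Eigen3.

(** * Spectral gap and third moment *)

Local Ltac ilra := apply/andP; split; lra.

Section Spectral.
Context {R : realType}.
Variables (a b : R) (rho : R -> R) (mu : probability (measurableTypeR R) R).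
Hypothesis hab : a < b.
Hypothesis crho : C0 a b rho.
Hypothesis rho0 : forall x, a <= x <= b -> 0 < rho x.
Hypothesis Hmu : forall A : set (measurableTypeR R), measurable A ->
  mu A = (\int[lebesgue_measure]_(x in A `&` `]a, b[) (rho x)%:E)%E.

Local Notation E := (mean a b mu).
Local Notation ivp := (ivp a b rho).

Definition C1pair (f f' : R -> R) := C0 a b f' /\ forall x, a <= x <= b -> der f x (f' x).

Lemma C1pair_C0 f f' : C1pair f f' -> C0 a b f.
Proof. by case=> _; exact: C0_der. Qed.

Variables (lam : R) (phi v : R -> R).
Hypothesis lam0 : 0 < lam.
Hypothesis Hsol : ivp lam phi v.
Hypothesis v0 : forall x, a < x < b -> 0 < v x.
Hypothesis vb : v b = 0.
Hypothesis phib : phi b != 0.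

Let rn x : a <= x <= b -> rho x != 0. Proof. by move=> /rho0/lt0r_neq0. Qed.
Let crV : C0 a b (fun x => (rho x)^-1). Proof. exact: C0V. Qed.

(** With [F] the primitive of [rho f], Picone's identity gives
    [lam int F^2 / rho <= int rho f^2], and [rho (f' + lam F / rho)^2] is
    [rho f'^2 - 2 lam rho f^2 + lam^2 F^2 / rho] up to an exact derivative. *)
Lemma poincare0 f f' : C1pair f f' -> E f = 0 ->
  lam * E (fun x => f x ^+ 2) <= E (fun x => f' x ^+ 2).
Proof.
move=> [cf' df] Ef; have cf : C0 a b f by exact: C0_der df.
pose F := prim a b (fun x => rho x * f x).
have dF x : a <= x <= b -> der F x (rho x * f x) by apply: prim_der => //; exact: C0M.
have cF : C0 a b F by exact: C0_der dF.
have Fa : F a = 0 by exact: prim_a.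
have Fb : F b = 0.
  have := @mean_FTC _ a b rho mu hab crho rho0 Hmu f F cf.
  by rewrite Fa subr0 Ef => <- // x xab; rewrite mulrC; exact: dF.
pose H1 := prim a b (fun x => rho x * f x ^+ 2 - lam * F x ^+ 2 / rho x).
have dH1 x : a <= x <= b -> der H1 x (rho x * f x ^+ 2 - lam * F x ^+ 2 / rho x).
  apply: prim_der => //; apply: C0B; first by apply: C0M => //; exact: C0X.
  by apply: C0M => //; apply: C0M; [exact: C0_cst|exact: C0X].
have := picone hab rho0 Hsol v0 (or_intror phib) dF Fa Fb dH1.
rewrite /H1 prim_a -/H1 => H1b.
have ch : C0 a b (fun x => f' x ^+ 2 - lam * f x ^+ 2).
  by apply: C0B; [exact: C0X|apply: C0M; [exact: C0_cst|exact: C0X]].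
pose H2 := prim a b (fun x => (f' x ^+ 2 - lam * f x ^+ 2) * rho x).
have dH2 x : a <= x <= b -> der H2 x ((f' x ^+ 2 - lam * f x ^+ 2) * rho x).
  by apply: prim_der => //; exact: C0M.
have EH := @mean_FTC _ a b rho mu hab crho rho0 Hmu _ H2 ch dH2.
rewrite /H2 prim_a -/H2 subr0 in EH.
pose W x := H2 x + 2 * lam * (f x * F x) - lam * H1 x.
pose W' x := rho x * (f' x + lam * F x / rho x) ^+ 2.
have dW x : a <= x <= b -> der W x (W' x).
  move=> xab; apply: derE.
    apply: derB; [apply: derD; [exact: dH2|]|exact: derZ (dH1 x xab)].
    by apply: derZ; apply: derM; [exact: df|exact: dF].
  by rewrite /W'; field; exact: rn.
have := ler_der (C0_der dW) (fun x xab => dW x (ltW2 xab)) _ (lexx a) (ltW hab) (lexx b).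
rewrite /W Fa Fb /H1 /H2 !prim_a -/H1 -/H2 !mulr0 !addr0 subr0 => HW.
have {}HW : 0 <= H2 b - lam * H1 b.
  by apply: HW => x /ltW2 xab; rewrite mulr_ge0 ?sqr_ge0 // ltW // rho0.
have BMf g : C0 a b g -> bdmeas a b g by exact: bdmeas_C0.
have b1 : bdmeas a b (fun x => f x ^+ 2) by apply: BMf; exact: C0X.
have b2 : bdmeas a b (fun x => f' x ^+ 2) by apply: BMf; exact: C0X.
rewrite meanB ?meanZ // in EH; try exact: bdmeasZ.
have : 0 <= lam * H1 b by rewrite mulr_ge0 // ltW.
lra.
Qed.

Lemma poincare f f' : C1pair f f' ->
  lam * (E (fun x => f x ^+ 2) - E f ^+ 2) <= E (fun x => f' x ^+ 2).
Proof.
move=> ff'; have cf := C1pair_C0 ff'; have [cf' df] := ff'.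
have BMf g : C0 a b g -> bdmeas a b g by exact: bdmeas_C0.
have := @poincare0 (fun x => f x - E f) f'.
have -> : E (fun x => f x - E f) = 0.
  by rewrite meanB ?(mean_cst Hmu) ?subrr //; [exact: BMf|exact: bdmeas_cst].
have -> : E (fun x => (f x - E f) ^+ 2) = E (fun x => f x ^+ 2) - E f ^+ 2.
  rewrite (@mean_ext _ a b mu _ (fun x => f x ^+ 2 - 2 * E f * f x + E f ^+ 2));
    last by move=> x _; ring.
  have b1 : bdmeas a b (fun x => f x ^+ 2) by apply: BMf; exact: C0X.
  have b2 : bdmeas a b (fun x => 2 * E f * f x) by apply: BMf; apply: C0M => //; exact: C0_cst.
  have b3 := BMf _ cf; have b4 := bdmeasB b1 b2; have b5 := @bdmeas_cst _ a b (E f ^+ 2).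
  by rewrite meanD // meanB // meanZ // (mean_cst Hmu); ring.
apply => //; split => // x xab.
by apply: derE (derB (df x xab) (der_cst (E f) x)) _; rewrite subr0.
Qed.

Lemma eigenfunction_C1 : C1pair phi (fun x => lam * v x / rho x).
Proof.
have [_ _ dphi dv] := Hsol; split => //.
by apply: C0M => //; apply: C0M; [exact: C0_cst|exact: C0_der dv].
Qed.

Lemma mean_eigenfunction : E phi = 0.
Proof.
have [phia va dphi dv] := Hsol.
rewrite (@mean_FTC _ a b rho mu hab crho rho0 Hmu _ (fun x => - v x));
  first by rewrite vb va subrr.
  exact: C0_der dphi.
by move=> x xab; apply: derE (derN (dv x xab)) _; ring.
Qed.

(** [phi v] vanishes at both ends and has derivative [rho (lam (v / rho)^2 - phi^2)]; this gives the
    equality and, with [v > 0] inside, the positivity. *)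
Lemma mean_sqr_eigenfunction : 0 < E (fun x => phi x ^+ 2) /\
  E (fun x => (lam * v x / rho x) ^+ 2) = lam * E (fun x => phi x ^+ 2).
Proof.
have [phia va dphi dv] := Hsol; have cphi := C0_der dphi; have cv := C0_der dv.
have cv2 : C0 a b (fun x => (v x / rho x) ^+ 2) by apply: C0X; exact: C0M.
have e1 : lam * E (fun x => (v x / rho x) ^+ 2) = E (fun x => phi x ^+ 2).
  have := @mean_FTC _ a b rho mu hab crho rho0 Hmu (fun x => lam * (v x / rho x) ^+ 2 - phi x ^+ 2) (fun x => phi x * v x).
  rewrite vb va !mulr0 subrr meanB ?meanZ; try by apply: bdmeas_C0 => //; do ?apply: C0M => //;
    do ?exact: C0X; exact: C0_cst.
  move=> H; apply/eqP; rewrite -subr_eq0; apply/eqP; apply: H.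
    by apply: C0B; [apply: C0M => //; exact: C0_cst|exact: C0X].
  by move=> x xab; apply: derE (derM (dphi x xab) (dv x xab)) _; field; exact: rn.
split; last first.
  rewrite (@mean_ext _ a b mu _ (fun x => lam ^+ 2 * (v x / rho x) ^+ 2)); last by move=> x _;
    ring.
  by rewrite meanZ -?e1; [ring|exact: bdmeas_C0].
rewrite -e1 pmulr_rgt0 //.
have dP : forall x, a <= x <= b -> der (prim a b (fun x => (v x / rho x) ^+ 2 * rho x)) x ((v x / rho x) ^+ 2 * rho x).
  by apply: prim_der => //; exact: C0M.
rewrite (@mean_FTC _ a b rho mu hab crho rho0 Hmu _ _ cv2 dP) subr_gt0.
apply: (ltr_der (C0_der dP) (fun x xab => dP x (ltW2 xab))) => //.
move=> x xab; have r0 := rho0 (ltW2 xab).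
by rewrite mulr_gt0 // exprn_gt0 // divr_gt0 ?v0.
Qed.

Section Third.
Variables (rho' : R -> R) (s : R).
Hypothesis drho : forall x, a < x < b -> der rho x (rho' x).

(** Since [phi' = lam v / rho] and [v' = - rho phi],
    [(phi^2 v + 2 lam / 3 v^3 / rho^2)' = - rho phi^3 - 4 lam / 3 v^3 rho' / rho^3]
    and the bracket vanishes at both ends: the third moment has the sign of
    [- int v^3 rho' / rho^3]. *)
Let Q x := prim a b (fun t => phi t ^+ 3 * rho t) x + (phi x ^+ 2 * v x + 2 * lam / 3 * v x ^+ 3 / rho x ^+ 2).
Let K x := - s * Q x.
Let K' x := 4 * lam / 3 * v x ^+ 3 * (s * rho' x) / rho x ^+ 3.

Let cK : C0 a b K.
Proof.
have [phia va dphi dv] := Hsol; have cphi := C0_der dphi; have cv := C0_der dv.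
have c3 := @C0_cst R a b.
have cr2 : C0 a b (fun x => (rho x ^+ 2)^-1).
  by apply: C0V; [move=> x /rn; rewrite sqrf_eq0|exact: C0X].
apply: C0M => //; apply: C0D; first by apply: prim_C0 => //; apply: C0M => //; exact: C0X.
apply: C0D; first by apply: C0M => //; exact: C0X.
by do 2 (apply: C0M => //); exact: C0X.
Qed.

Let dK x : a < x < b -> der K x (K' x).
Proof.
have [phia va dphi dv] := Hsol; have cphi := C0_der dphi; have cv := C0_der dv.
move=> xab; have xab' := ltW2 xab; have r := rn xab'.
apply: derE.
  apply: derZ; apply: derD.
    by apply: prim_der => //; apply: C0M => //; exact: C0X.
  apply: derD; first by apply: derM; [apply: derX2; exact: dphi|exact: dv].
  apply: derM; first by apply: derZ; apply: derX3; exact: dv.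
  by apply: derV; [rewrite sqrf_eq0|apply: derX2; exact: drho].
by rewrite /K'; field.
Qed.

Let EK : E (fun x => phi x ^+ 3) * s = K a - K b.
Proof.
have [phia va dphi dv] := Hsol; have cphi := C0_der dphi.
rewrite (@mean_FTC _ a b rho mu hab crho rho0 Hmu _ (prim a b (fun t => phi t ^+ 3 * rho t)));
  last 2 first.
- exact: C0X.
- by apply: prim_der => //; apply: C0M => //; exact: C0X.
by rewrite /K /Q va vb !prim_a; ring.
Qed.

(** [s] carries the unknown sign of [rho'], so that [K] increases whichever that sign is. *)
Lemma third_moment_mono : (forall x, a < x < b -> 0 < s * rho' x) -> E (fun x => phi x ^+ 3) != 0.
Proof.
move=> sr; have : K a < K b.
  apply: (ltr_der cK dK) => // x xab; have r0 := rho0 (ltW2 xab).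
  by rewrite /K' divr_gt0 ?exprn_gt0 // mulr_gt0 ?sr // mulr_gt0 ?exprn_gt0 ?v0 // divr_gt0 // mulr_gt0.
move=> KK; apply/negP => /eqP E3; have := EK; rewrite E3 mul0r; lra.
Qed.

(** The interval is split at [- a], which lies inside because [- a < b]; hence [v (- a) > 0] and the
    comparison of [v (- x)] with [v x] is strict. Up to [- a] the contributions of [x] and [- x] are
    paired, beyond it [K] is increasing. *)
Lemma third_moment_even : a < 0 -> - a < b ->
  (forall x, 0 < x < - a -> rho (- x) = rho x /\ rho' (- x) = - rho' x) ->
  (forall x, 0 < x < b -> 0 < s * rho' x) -> E (fun x => phi x ^+ 3) != 0.
Proof.
move=> a0 nab ev sr.
have [phia va dphi dv] := Hsol.
have b0 : 0 < b by lra.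
have na : a < - a < b by ilra.
pose u x := v (- x); pose psi x := - phi (- x).
have du x : 0 <= x <= - a -> der u x (- rho (- x) * phi (- x) * -1).
  by case/andP=> ? ?; apply: der_comp; [apply: derN; exact: der_id|apply: dv; ilra].
have dpsi x : 0 <= x <= - a -> der psi x (- (lam * v (- x) / rho (- x) * -1)).
  case/andP=> ? ?; apply: derN; apply: der_comp; [apply: derN; exact: der_id|apply: dphi; ilra].
have sub x : 0 <= x <= - a -> a <= x <= b by case/andP=> *; ilra.
have dphi' x : 0 <= x <= - a -> der phi x (lam * v x / rho x) by move=> /sub/dphi.
have dv' x : 0 <= x <= - a -> der v x (- rho x * phi x) by move=> /sub/dv.
(* [(u, psi)], the reflection of [(v, - phi)], solves the same system, so the
   Wronskian [W] is constant and [v / u] is increasing. *)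
pose W x := v x * psi x - u x * phi x.
have W1 x : 0 <= x <= - a -> W x = v (- a).
  move=> /andP[x0 xa].
  have Wa : W (- a) = v (- a) by rewrite /W /u /psi opprK va phia; ring.
  pose W' x := - rho x * phi x * psi x + v x * (- (lam * v (- x) / rho (- x) * -1))
     - (- rho (- x) * phi (- x) * -1 * phi x + u x * (lam * v x / rho x)).
  have dW t : 0 <= t <= - a -> der W t (W' t).
    by move=> ta; apply: derB; apply: derM; [exact: dv'|exact: dpsi|exact: du|exact: dphi'].
  have := @normr_der _ 0 (- a) W (fun=> 0) W' (fun=> 0) (C0_der dW) (@C0_cst _ _ _ 0)
      (fun t tab => dW t (ltW2 tab)) (fun t _ => der_cst _ t) _ x (- a) x0 xa (lexx _).
  rewrite Wa subrr => H; apply/eqP; rewrite eq_sym -subr_eq0 -normr_le0; apply: H => t ta.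
  have [e1 _] := ev t ta; rewrite normr_le0 /W' /psi /u e1; apply/eqP; field.
  by rewrite rn // sub // ltW2.
have vu x : 0 < x < - a -> v (- x) < v x.
  move=> /andP[x0 xa].
  have u0 t : 0 <= t <= x -> 0 < u t by case/andP=> *; apply: v0; ilra.
  pose q t := v t / u t.
  pose q' t := - rho t * phi t * (u t)^-1 + v t * (- (- rho (- t) * phi (- t) * -1) / u t ^+ 2).
  have dq t : 0 <= t <= x -> der q t (q' t).
    move=> /[dup] tx /andP[t0 tx']; have ta : 0 <= t <= - a by ilra.
    by apply: derM; [exact: dv'|apply: derV; [rewrite lt0r_neq0 // u0|exact: du]].
  have : q 0 < q x.
    apply: (ltr_der (C0_der dq) (fun t tab => dq t (ltW2 tab))) => //.
    move=> t /[dup] tx /andP[t0 tx']; have ta : 0 < t < - a by ilra.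
    have [e1 _] := ev t ta; have ut := u0 t (ltW2 tx).
    have -> : q' t = rho t * W t / u t ^+ 2.
      by rewrite /q' e1 /W /psi; field; rewrite lt0r_neq0.
    rewrite W1 ?ltW2 // divr_gt0 ?exprn_gt0 // mulr_gt0 ?v0 // rho0 //.
    exact/sub/ltW2.
  rewrite /q /u oppr0 divff; last by rewrite lt0r_neq0 // v0 // a0.
  rewrite ltr_pdivlMr ?mul1r //.
  by have := u0 x; rewrite /u; apply; rewrite lexx ltW.
have Kna : K a < K (- a).
  (* Folding about 0: as [rho'] is odd, the derivative of [Rr] is a positive multiple of
     [(v x^3 - v (- x)^3) (s rho' x)], and [Rr (- a) - Rr 0] is the increase of [K] over
     [(a, - a)]. *)
  pose Rr x := K x - K (- x).
  have cR : C0 0 (- a) Rr.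
    apply: C0B; first by apply: (@C0_sub _ a b) cK; lra.
    move=> x /andP[x0 xa]; apply: (continuous_comp (f := -%R)); first exact: opp_continuous.
    by apply: cK; ilra.
  have dR x : 0 < x < - a -> der Rr x (K' x - K' (- x) * -1).
    move=> /andP[? ?]; apply: derB; first by apply: dK; ilra.
    by apply: der_comp; [apply: derN; exact: der_id|apply: dK; ilra].
  have : Rr 0 < Rr (- a).
    apply: (ltr_der cR dR) => //; last lra.
    move=> x /[dup] xa /andP[x0 xa']; have [e1 e2] := ev x xa.
    have rx : 0 < rho x by apply: rho0; ilra.
    have -> : K' x - K' (- x) * -1 = 4 * lam / 3 * (v x ^+ 3 - v (- x) ^+ 3) * (s * rho' x) / rho x ^+ 3.
      by rewrite /K' e1 e2; field; rewrite lt0r_neq0.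
    have v3 : 0 < v x ^+ 3 - v (- x) ^+ 3.
      have v1 := vu x xa; have v2 : 0 < v (- x) by apply: v0; ilra.
      by rewrite subr_gt0 ltrXn2r // ltW // (lt_trans v2).
    have sx : 0 < s * rho' x by apply: sr; ilra.
    by rewrite divr_gt0 ?exprn_gt0 // mulr_gt0 // mulr_gt0 // divr_gt0 // mulr_gt0.
  rewrite /Rr oppr0 opprK; lra.
have Kb : K (- a) < K b.
  have cK' : C0 (- a) b K by apply: (@C0_sub _ a b) cK; lra.
  have dK'' x : - a < x < b -> der K x (K' x) by move=> /andP[? ?]; apply: dK; ilra.
  apply: (ltr_der cK' dK'') => // x xab.
  have /andP[xa1 xa2] := xab; have xab' : a < x < b by ilra.
  have r0 := rho0 (ltW2 xab').
  have sx : 0 < s * rho' x by apply: sr; ilra.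
  by rewrite /K' divr_gt0 ?exprn_gt0 // mulr_gt0 // mulr_gt0 ?exprn_gt0 ?v0 // divr_gt0 // mulr_gt0.
apply/negP => /eqP E3; have := EK; rewrite E3 mul0r; lra.
Qed.

End Third.
End Spectral.

(** * Logarithmic inequalities *)

Section Theta.
Context {R : realType}.
Implicit Types x y e M : R.

Definition sqr_ln_sqr x := x ^+ 2 * ln (x ^+ 2).
Definition mul_ln x : R := x * ln x.

(** From [- ln |x| <= 1 / |x| - 1]. It yields the continuity of [sqr_ln_sqr] at 0. *)
Lemma sqr_ln_sqr_small x : `|x| <= 1 -> `|sqr_ln_sqr x| <= 2 * `|x|.
Proof.
move=> x1; have [->|x0] := eqVneq x 0; first by rewrite /sqr_ln_sqr expr0n /= mul0r normr0 mulr0.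
have ax : 0 < `|x| by rewrite normr_gt0.
rewrite /sqr_ln_sqr -real_normK ?num_real // lnXn // -[ln _ *+ 2]mulr_natl.
have lx : ln `|x| <= 0 by exact: ln_le0.
have h : - ln `|x| <= `|x|^-1 - 1.
  rewrite -lnV ?posrE //.
  have e1 : 1 + (`|x|^-1 - 1) = `|x|^-1 by ring.
  have := @le_ln1Dx _ (`|x|^-1 - 1); rewrite e1; apply.
  by rewrite ltrBrDr addNr invr_gt0.
have -> : `| `|x| ^+ 2 * (2%:R * ln `|x|) | = `|x| ^+ 2 * (2 * - ln `|x|).
  by rewrite normrM normrX normr_id (normrM 2%:R) (ler0_norm lx) (@ger0_norm _ 2%:R).
apply: le_trans (_ : `|x| ^+ 2 * (2 * (`|x|^-1 - 1)) <= _).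
  by rewrite ler_wpM2l ?sqr_ge0 // ler_wpM2l.
have -> : `|x| ^+ 2 * (2 * (`|x|^-1 - 1)) = 2 * `|x| - 2 * `|x| ^+ 2 by field; rewrite lt0r_neq0.
by have := sqr_ge0 `|x|; lra.
Qed.

Lemma sqr_ln_sqr_continuous : continuous sqr_ln_sqr.
Proof.
move=> x; have [->|x0] := eqVneq x 0; last first.
  have c1 : {for x, continuous (fun y : R => y ^+ 2)} by exact: exprn_continuous.
  have c2 : {for x ^+ 2, continuous (@ln R)} by apply: continuous_ln; rewrite exprn_even_gt0.
  exact: (continuousM c1 (continuous_comp c1 c2)).
apply/cvgrPdist_lt => e e0; apply/nbhs_ballP.
exists (Num.min 1 (e / 3)) => /=; first by rewrite lt_min ltr01 divr_gt0.
move=> y; rewrite /ball /= sub0r normrN lt_min => /andP[y1 ye].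
rewrite {1}/sqr_ln_sqr expr0n /= mul0r sub0r normrN.
have := sqr_ln_sqr_small (ltW y1); have := normr_ge0 y; lra.
Qed.

(** Only [x] is confined to [[- M, M]]; [y] may leave it, which suits perturbations of a bounded
    function. Compactness enters as a near-covering property whose filter variable is the modulus
    [d]. *)
Lemma unif_cont (t : R -> R) M e : continuous t -> 0 < e ->
  exists d, 0 < d /\ forall x y, `|x| <= M -> `|x - y| <= d -> `|t x - t y| <= e.
Proof.
move=> ct e0.
pose P (d x : R) := forall y, `|x - y| <= d -> `|t x - t y| <= e.
have /compact_near_coveringP := @segment_compact R (- M) M.
move=> /(_ R (0 : R)^'+ P _) H.
have : \forall d \near 0^'+, `[- M, M]%classic `<=` P d.
  apply: H => x _.
  have := ct x => /cvgrPdist_lt/(_ (e / 2)).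
  have -> : 0 < e / 2 by rewrite divr_gt0.
  move=> /(_ isT)/nbhs_ballP[r /= r0 Hr].
  exists (ball x (r / 2), [set d : R | d < r / 2]) => /=.
    split; first by apply: nbhsx_ballx; rewrite divr_gt0.
    by apply: nbhs_right_lt; rewrite divr_gt0.
  move=> [z d] [/= xz dr] y zy.
  have h1 : `|t x - t z| < e / 2 by apply: Hr; rewrite /ball /= in xz *; lra.
  have h2 : `|t x - t y| < e / 2.
    apply: Hr; rewrite /ball /= in xz *.
    have -> : x - y = (x - z) + (z - y) by ring.
    by apply: le_lt_trans (ler_normD _ _) _; lra.
  have -> : t z - t y = - (t x - t z) + (t x - t y) by ring.
  by apply: le_trans (ler_normD _ _) _; rewrite normrN; lra.
move=> H1.
have H2 : \forall d \near 0^'+, 0 < d :> R by exact: nbhs_right_gt.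
have [d [d0 Hd]] := @filter_ex _ _ (at_right_proper_filter (0 : R)) _ (filterI H2 H1).
exists d; split => // x y xM; apply: Hd.
by rewrite /= in_itv /= -ler_norml.
Qed.

(** The quartic coefficient is 1 instead of Taylor's 1/4, with which the inequality fails for
    negative [x]. The difference of the two sides has derivative [y^3 (3 + 4 y) / (1 + y)], of the
    sign of [y] above [- 3/4], so its minimum is at 0. *)
Lemma ln1D_ge x : - (3 / 4) < x -> x - x ^+ 2 / 2 + x ^+ 3 / 3 - x ^+ 2 * x ^+ 2 <= ln (1 + x).
Proof.
move=> x34.
pose g y := ln (1 + y) - (y - 2^-1 * y ^+ 2 + 3^-1 * y ^+ 3 - y ^+ 2 * y ^+ 2).
pose g' y : R := y ^+ 3 * (3 + 4 * y) / (1 + y).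
have dg y : - (3 / 4) < y -> der g y (g' y).
  move=> y34; have y1 : 0 < 1 + y by lra.
  have did := der_id y.
  apply: derE.
    apply: derB; first apply: (@der_comp R (@ln R) (fun y => 1 + y)).
        by apply: derD; [exact: der_cst|exact: did].
      exact: is_derive1_ln.
    apply: derB; [apply: derD; [apply: derB|]|apply: derM].
    - exact: did.
    - by apply: derZ; exact: derX2 did.
    - by apply: derZ; exact: derX3 did.
    - exact: derX2 did.
    - exact: derX2 did.
  by rewrite /g'; field; rewrite lt0r_neq0.
have g0 : g 0 = 0 by rewrite /g addr0 ln1; ring.
suff gx : 0 <= g x by move: gx; rewrite /g => gx; lra.
rewrite -g0; have [x0|x0] := lerP 0 x.
  have dg1 y : 0 <= y <= x -> der g y (g' y) by case/andP=> ? ?; apply: dg; lra.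
  apply: (ler_der (C0_der dg1) (fun y yab => dg1 y (ltW2 yab))) => // y /andP[y0 yx].
  by rewrite divr_ge0 ?mulr_ge0 ?exprn_ge0 //; lra.
have dg1 y : x <= y <= 0 -> der g y (g' y) by case/andP=> ? ?; apply: dg; lra.
rewrite -lerN2.
apply: (ler_der (C0N (C0_der dg1)) (fun y yab => derN (dg1 y (ltW2 yab)))) => //; last exact: ltW.
move=> y /andP[y0 yx]; rewrite -mulNr divr_ge0 //; last lra.
rewrite -mulNr mulr_ge0 //; last lra.
by rewrite exprS -mulNr mulr_ge0 ?sqr_ge0 //; lra.
Qed.

Lemma ln1D_le x : -1 < x -> ln (1 + x) <= x - x ^+ 2 / 2 + x ^+ 3 / 3.
Proof.
move=> x34.
pose g y := (y - 2^-1 * y ^+ 2 + 3^-1 * y ^+ 3) - ln (1 + y).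
pose g' y : R := y ^+ 3 / (1 + y).
have dg y : - 1 < y -> der g y (g' y).
  move=> y34; have y1 : 0 < 1 + y by lra.
  have did := der_id y.
  apply: derE.
    apply: derB; last apply: (@der_comp R (@ln R) (fun y => 1 + y)).
    - apply: derD; [apply: derB|].
      + exact: did.
      + by apply: derZ; exact: derX2 did.
      + by apply: derZ; exact: derX3 did.
    - by apply: derD; [exact: der_cst|exact: did].
    - exact: is_derive1_ln.
  by rewrite /g'; field; rewrite lt0r_neq0.
have g0 : g 0 = 0 by rewrite /g addr0 ln1; ring.
suff gx : 0 <= g x by move: gx; rewrite /g => gx; lra.
rewrite -g0; have [x0|x0] := lerP 0 x.
  have dg1 y : 0 <= y <= x -> der g y (g' y) by case/andP=> ? ?; apply: dg; lra.
  apply: (ler_der (C0_der dg1) (fun y yab => dg1 y (ltW2 yab))) => // y /andP[y0 yx].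
  by rewrite divr_ge0 ?exprn_ge0 //; lra.
have dg1 y : x <= y <= 0 -> der g y (g' y) by case/andP=> ? ?; apply: dg; lra.
rewrite -lerN2.
apply: (ler_der (C0N (C0_der dg1)) (fun y yab => derN (dg1 y (ltW2 yab)))) => //; last exact: ltW.
move=> y /andP[y0 yx]; rewrite -mulNr divr_ge0 //; last lra.
by rewrite exprS -mulNr mulr_ge0 ?sqr_ge0 //; lra.
Qed.

Lemma sqr_ln_sqr1D x : -1 < x -> sqr_ln_sqr (1 + x) = 2 * ((1 + x) ^+ 2 * ln (1 + x)).
Proof. by move=> x1; rewrite /sqr_ln_sqr lnXn; [rewrite -[ln _ *+ 2]mulr_natl; ring|lra]. Qed.

(** The cubic term has to be exact, since it decides the comparison with the spectral gap. The
    constant 4 leaves a slack [x^4 (7/3 - 10/3 x - 2 x^2)], nonnegative for [|x| <= 1/2]. *)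
Lemma sqr_ln_sqr1D_ge x : `|x| <= 1 / 2 ->
  2 * x + 3 * x ^+ 2 + 2 / 3 * x ^+ 3 - 4 * (x ^+ 2 * x ^+ 2) <= sqr_ln_sqr (1 + x).
Proof.
rewrite ler_norml => /andP[x1 x2]; rewrite sqr_ln_sqr1D; last lra.
have h := @ln1D_ge x ltac:(lra).
apply: le_trans (_ : 2 * ((1 + x) ^+ 2 * (x - x ^+ 2 / 2 + x ^+ 3 / 3 - x ^+ 2 * x ^+ 2)) <= _); last first.
  by rewrite ler_wpM2l // ler_wpM2l ?sqr_ge0.
rewrite -subr_ge0.
have -> : 2 * ((1 + x) ^+ 2 * (x - x ^+ 2 / 2 + x ^+ 3 / 3 - x ^+ 2 * x ^+ 2)) -
  (2 * x + 3 * x ^+ 2 + 2 / 3 * x ^+ 3 - 4 * (x ^+ 2 * x ^+ 2)) =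
  x ^+ 2 * x ^+ 2 * (7 / 3 - 10 / 3 * x - 2 * x ^+ 2) by field.
have h4 : 0 <= (1 / 2 - x) * (1 / 2 + x) by rewrite mulr_ge0 //; lra.
have h5 : (1 / 2 - x) * (1 / 2 + x) = 1 / 4 - x ^+ 2 by field.
have h6 : 0 <= 7 / 3 - 10 / 3 * x - 2 * x ^+ 2 by lra.
by rewrite mulr_ge0 // mulr_ge0 // sqr_ge0.
Qed.

Lemma sqr_ln_sqr1D_le x : `|x| <= 1 / 2 -> sqr_ln_sqr (1 + x) <= 2 * x + (3 + 2 * `|x|) * x ^+ 2.
Proof.
move=> xh; have := xh; rewrite ler_norml => /andP[x1 x2]; rewrite sqr_ln_sqr1D; last lra.
have h := @ln1D_le x ltac:(lra).
apply: le_trans (_ : 2 * ((1 + x) ^+ 2 * (x - x ^+ 2 / 2 + x ^+ 3 / 3)) <= _).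
  by rewrite ler_wpM2l // ler_wpM2l ?sqr_ge0.
rewrite -subr_ge0.
have -> : 2 * x + (3 + 2 * `|x|) * x ^+ 2 - 2 * ((1 + x) ^+ 2 * (x - x ^+ 2 / 2 + x ^+ 3 / 3)) =
  x ^+ 2 * (2 * `|x| - 2 / 3 * x - 1 / 3 * x ^+ 2 - 2 / 3 * (x * x ^+ 2)) by field.
rewrite mulr_ge0 ?sqr_ge0 //.
have h1 := ler_norm x; have h2 : - x <= `|x| by rewrite -normrN ler_norm.
have h3 : x ^+ 2 <= `|x| / 2 
  by rewrite -real_normK ?num_real // expr2 ler_wpM2l //; lra.
have h4 := sqr_ge0 x.
have h5 : x * x ^+ 2 <= 1 / 2 * x ^+ 2 by rewrite ler_wpM2r.
lra.
Qed.

Lemma mul_ln1D_le s : 0 <= s -> mul_ln (1 + s) <= s + s ^+ 2.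
Proof.
move=> s0; rewrite /mul_ln; have := @le_ln1Dx _ s ltac:(lra) => h.
have -> : s + s ^+ 2 = (1 + s) * s by ring.
by rewrite ler_wpM2l //; lra.
Qed.

Lemma mul_ln1D_ge s : 0 <= s -> s <= mul_ln (1 + s).
Proof.
move=> s0; rewrite /mul_ln; have s1 : 0 < 1 + s by lra.
have e1 : 1 + ((1 + s)^-1 - 1) = (1 + s)^-1 by ring.
have h : - ln (1 + s) <= (1 + s)^-1 - 1.
  have := @le_ln1Dx _ ((1 + s)^-1 - 1); rewrite e1 lnV ?posrE //; apply.
  by rewrite ltrBrDr addNr invr_gt0.
have e2 : (1 + s) * - ((1 + s)^-1 - 1) = s by field; rewrite lt0r_neq0.
rewrite -{1}e2 ler_wpM2l //; lra.
Qed.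

End Theta.

(** * The entropy functional *)

Section Entropy.
Context {R : realType}.
Variables (a b : R) (rho : R -> R) (mu : probability (measurableTypeR R) R).
Hypothesis hab : a < b.
Hypothesis crho : C0 a b rho.
Hypothesis rho0 : forall x, a <= x <= b -> 0 < rho x.
Hypothesis Hmu : forall A : set (measurableTypeR R), measurable A ->
  mu A = (\int[lebesgue_measure]_(x in A `&` `]a, b[) (rho x)%:E)%E.

Local Notation E := (mean a b mu).
Local Notation Ent := (Ent_sq mu a b).

Lemma EntE f : Ent f = E (fun x => sqr_ln_sqr (f x)) - mul_ln (E (fun x => f x ^+ 2)).
Proof. by []. Qed.

Lemma Ent_ext f g : (forall x, a < x < b -> f x = g x) -> Ent f = Ent g.
Proof.
move=> fg; rewrite !EntE; congr (_ - mul_ln _); apply: mean_ext => x xab; by rewrite fg.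
Qed.

Lemma mean_sqr_ge0 f : 0 <= E (fun x => f x ^+ 2).
Proof. by apply: mean_ge0 => x _; exact: sqr_ge0. Qed.

(** [ln (c^2)] enters both terms of the entropy with the weight [c^2 E f^2] and cancels. Zeros of
    [f] are separated because the logarithm of a product does not split there. *)
Lemma Ent_scale c f : bdmeas a b f -> Ent (fun x => c * f x) = c ^+ 2 * Ent f.
Proof.
move=> bf; have b2 := bdmeasX 2 bf; have bt := bdmeas_comp bf (@sqr_ln_sqr_continuous R).
have [->|c0] := eqVneq c 0.
  rewrite EntE (@mean_ext _ a b mu _ (fun=> 0)); last by move=> x _;
    rewrite mul0r /sqr_ln_sqr expr0n /= mul0r.
  rewrite (@mean_ext _ a b mu (fun x => (0 * f x) ^+ 2) (fun=> 0)); last by move=> x _;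
    rewrite mul0r expr0n.
  by rewrite (mean_cst Hmu) /mul_ln mul0r subrr expr0n /= mul0r.
have c2 : 0 < c ^+ 2 by rewrite exprn_even_gt0.
rewrite !EntE (@mean_ext _ a b mu _ (fun x => c ^+ 2 * sqr_ln_sqr (f x) + c ^+ 2 * ln (c ^+ 2) * f x ^+ 2)); last first.
  move=> x _; rewrite /sqr_ln_sqr exprMn; have [->|fx0] := eqVneq (f x) 0.
    by rewrite expr0n /=; ring.
  by rewrite lnM ?posrE // ?exprn_even_gt0 //; ring.
rewrite (@mean_ext _ a b mu (fun x => (c * f x) ^+ 2) (fun x => c ^+ 2 * f x ^+ 2));
  last by move=> x _; rewrite exprMn.
rewrite meanD ?meanZ //; try exact: bdmeasZ.
have [E0|E0] := eqVneq (E (fun x => f x ^+ 2)) 0; first by rewrite E0 /mul_ln; ring.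
have Ep : 0 < E (fun x => f x ^+ 2) by rewrite lt_neqAle eq_sym E0 mean_sqr_ge0.
by rewrite /mul_ln lnM ?posrE //; ring.
Qed.

Lemma Ent_continuous M e : 0 < M -> 0 < e -> exists d, 0 < d /\ forall f g, bdmeas a b f ->
  bdmeas a b g ->
  (forall x, a < x < b -> `|f x| <= M) -> (forall x, a < x < b -> `|f x - g x| <= d) ->
  `|Ent f - Ent g| <= e.
Proof.
move=> M0 e0; have e2 : 0 < e / 2 by rewrite divr_gt0.
have [d1 [d10 Hd1]] := unif_cont M (@sqr_ln_sqr_continuous R) e2.
(* For [y >= 0], [y ln y] is [sqr_ln_sqr] at the square root of [y]; this gives continuity down to a
   vanishing mean square. *)
have ck : continuous (fun y : R => sqr_ln_sqr (Num.sqrt y)).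
  by move=> y; apply: continuous_comp; [exact: sqrt_continuous|exact: sqr_ln_sqr_continuous].
have [d2 [d20 Hd2]] := unif_cont (M ^+ 2) ck e2.
have kE y : 0 <= y -> mul_ln y = sqr_ln_sqr (Num.sqrt y).
  by move=> y0; rewrite /sqr_ln_sqr sqr_sqrtr.
have csq : continuous (fun y : R => y ^+ 2) by move=> y; exact: exprn_continuous.
have [d3 [d30 Hd3]] := unif_cont M csq d20.
exists (Num.min d1 d3); split; first by rewrite lt_min d10.
move=> f g bf bg fM fg.
have b2 := bdmeasX 2 bf; have bt := bdmeas_comp bf (@sqr_ln_sqr_continuous R).
have c2 := bdmeasX 2 bg; have ct := bdmeas_comp bg (@sqr_ln_sqr_continuous R).
have h1 : `|E (fun x => sqr_ln_sqr (f x)) - E (fun x => sqr_ln_sqr (g x))| <= e / 2.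
  apply: (mean_dist Hmu) => // x xab; apply: Hd1; first exact: fM.
  by apply: (le_trans (fg x xab)); rewrite ge_min lexx.
have h2 : `|E (fun x => f x ^+ 2) - E (fun x => g x ^+ 2)| <= d2.
  apply: (mean_dist Hmu) => // x xab; apply: Hd3; first exact: fM.
  by apply: (le_trans (fg x xab)); rewrite ge_min lexx orbT.
have h3 : `|E (fun x => f x ^+ 2)| <= M ^+ 2.
  apply: (mean_norm_le Hmu) => // x xab; rewrite normrX ler_sqr ?nnegrE ?(ltW M0) //; exact: fM.
have h4 := Hd2 _ _ h3 h2; rewrite -!kE ?mean_sqr_ge0 // in h4.
rewrite !EntE; move: h1 h4; rewrite !ler_norml => /andP[? ?] /andP[? ?]; apply/andP; split; lra.
Qed.

(** The first order disappears since [E phi = 0]. In second order the integrand contributes 3 and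
    [mul_ln (1 + eps^2 s) <= eps^2 s + eps^4 s^2] takes away 1. *)
Lemma Ent_near1_ge phi B eps : bdmeas a b phi -> 0 < B -> (forall x, a < x < b ->
  `|phi x| <= B) -> E phi = 0 ->
  `|eps| * B <= 1 / 2 ->
  2 * eps ^+ 2 * E (fun x => phi x ^+ 2) + 2 / 3 * eps ^+ 3 * E (fun x => phi x ^+ 3)
   - (4 * (B ^+ 2 * B ^+ 2) + E (fun x => phi x ^+ 2) ^+ 2) * (eps ^+ 2 * eps ^+ 2) <= Ent (fun x => 1 + eps * phi x).
Proof.
move=> bphi B0 phiB Ephi epsB.
have b2 := bdmeasX 2 bphi; have b3 := bdmeasX 3 bphi.
have b1 := @bdmeas_cst R a b 1.
have bf : bdmeas a b (fun x => 1 + eps * phi x) by apply: bdmeasD => //; exact: bdmeasZ.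
have bt := bdmeas_comp bf (@sqr_ln_sqr_continuous R).
set s := E (fun x => phi x ^+ 2); set m := E (fun x => phi x ^+ 3).
have s0 : 0 <= s by exact: mean_sqr_ge0.
have small x : a < x < b -> `|eps * phi x| <= 1 / 2.
  move=> xab; rewrite normrM; apply: le_trans epsB.
  by rewrite ler_wpM2l // phiB.
have h1 : E (fun x => (2 * eps) * phi x + (3 * eps ^+ 2) * phi x ^+ 2 + (2 / 3 * eps ^+ 3) * phi x ^+ 3
     - 4 * (eps ^+ 2 * eps ^+ 2) * (B ^+ 2 * B ^+ 2)) <= E (fun x => sqr_ln_sqr (1 + eps * phi x)).
  apply: le_mean => //.
    by apply: bdmeasB; [apply: bdmeasD; [apply: bdmeasD|]; exact: bdmeasZ|exact: bdmeas_cst].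
  move=> x xab; have := sqr_ln_sqr1D_ge (small x xab); apply: le_trans.
  rewrite -subr_ge0.
  have -> : 2 * (eps * phi x) + 3 * (eps * phi x) ^+ 2 + 2 / 3 * (eps * phi x) ^+ 3 -
     4 * ((eps * phi x) ^+ 2 * (eps * phi x) ^+ 2) -
    (2 * eps * phi x + 3 * eps ^+ 2 * phi x ^+ 2 + 2 / 3 * eps ^+ 3 * phi x ^+ 3 -
      4 * (eps ^+ 2 * eps ^+ 2) * (B ^+ 2 * B ^+ 2)) =
    4 * (eps ^+ 2 * eps ^+ 2) * (B ^+ 2 * B ^+ 2 - phi x ^+ 2 * phi x ^+ 2) by field.
  have p2 : phi x ^+ 2 <= B ^+ 2 by rewrite -real_normK ?num_real // ler_sqr ?nnegrE ?(ltW B0) // phiB.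
  have p4 : phi x ^+ 2 * phi x ^+ 2 <= B ^+ 2 * B ^+ 2 by rewrite ler_pM ?sqr_ge0.
  rewrite -subr_ge0 in p4.
  by apply: mulr_ge0 => //; apply: mulr_ge0 => //; apply: mulr_ge0; exact: sqr_ge0.
have z1 := bdmeasZ (2 * eps) bphi; have z2 := bdmeasZ (3 * eps ^+ 2) b2; have z3 :=
  bdmeasZ (2 / 3 * eps ^+ 3) b3.
rewrite (meanB mu (bdmeasD (bdmeasD z1 z2) z3) (bdmeas_cst a b _)) (meanD mu (bdmeasD z1 z2) z3) (meanD mu z1 z2) (mean_cst Hmu) !meanZ // in h1.
have h2 : E (fun x => (1 + eps * phi x) ^+ 2) = 1 + eps ^+ 2 * s.
  rewrite (@mean_ext _ a b mu _ (fun x => 1 + 2 * eps * phi x + eps ^+ 2 * phi x ^+ 2));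
    last by move=> x _; ring.
  rewrite (meanD mu (bdmeasD b1 (bdmeasZ (2 * eps) bphi)) (bdmeasZ (eps ^+ 2) b2)) (meanD mu b1 (bdmeasZ (2 * eps) bphi)).
  by rewrite (mean_cst Hmu) !meanZ // Ephi -/s; ring.
rewrite EntE h2.
have h3 := @mul_ln1D_le _ (eps ^+ 2 * s) (mulr_ge0 (sqr_ge0 _) s0).
rewrite Ephi -/s -/m in h1; rewrite exprMn in h3.
lra.
Qed.

End Entropy.

(** * Entropy near the constants, compared with the spectral gap *)

Section Entropy2.
Context {R : realType}.
Variables (a b : R) (rho : R -> R) (mu : probability (measurableTypeR R) R).
Hypothesis hab : a < b.
Hypothesis crho : C0 a b rho.
Hypothesis rho0 : forall x, a <= x <= b -> 0 < rho x.
Hypothesis Hmu : forall A : set (measurableTypeR R), measurable A ->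
  mu A = (\int[lebesgue_measure]_(x in A `&` `]a, b[) (rho x)%:E)%E.

Local Notation E := (mean a b mu).
Local Notation Ent := (Ent_sq mu a b).
Local Notation ivp := (ivp a b rho).

(** Recentre at the mean: [f = m (1 + h)] with [E h = 0], so no first-order term remains. From
    [m >= 1/2] and [|f - m| <= 2 d] follows [|h| <= 4 d]; the factor is [3 + 8 d] from the integrand
    minus 1 from [mul_ln]. *)
Lemma Ent_near1_le f d : bdmeas a b f -> d <= 1 / 8 -> (forall x, a < x < b -> `|f x - 1| <= d) ->
  Ent f <= (2 + 8 * d) * (E (fun x => f x ^+ 2) - E f ^+ 2).
Proof.
move=> bf d8 fd.
have d0 : 0 <= d.
  have h := hab; apply: (le_trans (normr_ge0 _) (fd ((a + b) / 2) _)).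
  by apply/andP; split; lra.
have bc := @bdmeas_cst R a b.
set m := E f.
have md : `|m - 1| <= d.
  by rewrite /m -(mean_cst Hmu 1); apply: (mean_dist Hmu) => // x xab; rewrite (mean_cst Hmu);
    exact: fd.
have m0 : 1 / 2 <= m by move: md; rewrite ler_norml => /andP[]; lra.
have mp : 0 < m by lra.
pose h x := m^-1 * (f x - m).
have bh : bdmeas a b h by apply: bdmeasZ; exact: bdmeasB.
have hd x : a < x < b -> `|h x| <= 4 * d.
  move=> xab; rewrite /h normrM normfV (gtr0_norm mp).
  have h1 : `|f x - m| <= 2 * d.
    have := fd x xab; move: md; rewrite !ler_norml => /andP[? ?] /andP[? ?]; apply/andP; split;
      lra.
  have h2 : m^-1 <= 2 by rewrite -[leRHS]invrK lef_pV2 ?posrE ?invr_gt0 //; lra.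
  have -> : 4 * d = 2 * (2 * d) by ring.
  by rewrite ler_pM // invr_ge0 ltW.
have hh x : a < x < b -> `|h x| <= 1 / 2 by move=> /hd; lra.
have Eh : E h = 0 by rewrite meanZ ?meanB ?(mean_cst Hmu) ?subrr ?mulr0 //; exact: bdmeasB.
have bh2 := bdmeasX 2 bh.
set s := E (fun x => h x ^+ 2).
have s0 : 0 <= s by exact: mean_sqr_ge0.
have -> : Ent f = m ^+ 2 * Ent (fun x => 1 + h x).
  rewrite -(Ent_scale Hmu) //; last by apply: bdmeasD.
  by apply: Ent_ext => // x _; rewrite /h; field; rewrite lt0r_neq0.
have vs : E (fun x => f x ^+ 2) - m ^+ 2 = m ^+ 2 * s.
  rewrite -meanZ // (@mean_ext _ a b mu (fun x => m ^+ 2 * h x ^+ 2) (fun x => f x ^+ 2 - 2 * m * f x + m ^+ 2)); last first.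
    by move=> x _; rewrite /h; field; rewrite lt0r_neq0.
  have b2 := bdmeasX 2 bf; have b3 := bdmeasZ (2 * m) bf.
  by rewrite (meanD mu (bdmeasB b2 b3) (bc _)) (meanB mu b2 b3) meanZ // (mean_cst Hmu) -/m; ring.
rewrite vs mulrCA ler_wpM2l ?sqr_ge0 //.
have e2 : E (fun x => (1 + h x) ^+ 2) = 1 + s.
  rewrite (@mean_ext _ a b mu _ (fun x => 1 + 2 * h x + h x ^+ 2)); last by move=> x _; ring.
  by rewrite (meanD mu (bdmeasD (bc 1) (bdmeasZ 2 bh)) bh2) (meanD mu (bc 1) (bdmeasZ 2 bh)) meanZ // (mean_cst Hmu) Eh -/s; ring.
rewrite EntE e2; have := mul_ln1D_ge s0.
have : E (fun x => sqr_ln_sqr (1 + h x)) <= E (fun x => 2 * h x + (3 + 8 * d) * h x ^+ 2).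
  apply: le_mean.
  - by apply: (@bdmeas_comp _ _ _ _ (@sqr_ln_sqr R));
      [apply: bdmeasD|exact: sqr_ln_sqr_continuous].
  - by apply: bdmeasD; exact: bdmeasZ.
  - move=> x xab; apply: (le_trans (sqr_ln_sqr1D_le (hh x xab)));
      rewrite lerD2l ler_wpM2r ?sqr_ge0 //.
    have := hd x xab; lra.
rewrite (meanD mu (bdmeasZ 2 bh) (bdmeasZ (3 + 8 * d) bh2)) (meanZ mu 2 bh) (meanZ mu (3 + 8 * d) bh2) Eh -/s; lra.
Qed.

Variables (lam : R) (phi v : R -> R).
Hypothesis lam0 : 0 < lam.
Hypothesis Hsol : ivp lam phi v.
Hypothesis v0 : forall x, a < x < b -> 0 < v x.
Hypothesis vb : v b = 0.
Hypothesis phib : phi b != 0.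

Lemma ratio_lt_gap : E (fun x => phi x ^+ 3) != 0 -> exists f f', [/\ C1pair a b f f', 0 < Ent f &
  E (fun x => f' x ^+ 2) < lam / 2 * Ent f].
Proof.
move=> m0; set m := E _ in m0.
have cp := eigenfunction_C1 crho rho0 Hsol; have cphi := C1pair_C0 cp.
have Ephi := mean_eigenfunction hab crho rho0 Hmu Hsol vb.
have [s0 Edphi] := mean_sqr_eigenfunction hab crho rho0 Hmu lam0 Hsol v0 vb.
have [B [B0 HB]] := C0_bounded (ltW hab) cphi.
have bphi := bdmeas_C0 hab cphi.
set s := E _ in s0 Edphi.
pose K := 4 * (B ^+ 2 * B ^+ 2) + s ^+ 2.
have K0 : 0 <= K by rewrite addr_ge0 ?sqr_ge0 // mulr_ge0 // mulr_ge0 ?sqr_ge0.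
have am : 0 < `|m| by rewrite normr_gt0.
(* The first bound keeps [|eps phi|] within 1/2, where the expansion holds; the second makes the
   quartic error smaller than the cubic gain. *)
pose t := Num.min ((2 * B)^-1) (`|m| / (3 * (K + 1))).
have t0 : 0 < t by rewrite lt_min invr_gt0 mulr_gt0 // divr_gt0 // mulr_gt0 //; lra.
have tB : t * B <= 1 / 2.
  by rewrite -ler_pdivlMr // /t ge_min invfM div1r lexx.
have tK : K * t <= `|m| / 3.
  have h : t <= `|m| / (3 * (K + 1)) by rewrite ge_min lexx orbT.
  apply: le_trans (_ : K * (`|m| / (3 * (K + 1))) <= _); first by rewrite ler_wpM2l.
  have -> : K * (`|m| / (3 * (K + 1))) = `|m| / 3 * (K / (K + 1)) by field;
    rewrite !lt0r_neq0 //; lra.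
  by rewrite ler_piMr ?divr_ge0 // ler_pdivrMr; lra.
(* With the sign of the third moment, the cubic term becomes [t^3 |m|]. *)
pose eps := Num.sg m * t.
have e2 : eps ^+ 2 = t ^+ 2 by rewrite /eps exprMn sqr_sg m0 mul1r.
have em : eps ^+ 3 * m = t ^+ 3 * `|m|.
  have -> : eps ^+ 3 * m = eps ^+ 2 * (eps * m) by ring.
  rewrite e2 /eps (normrEsg m); ring.
have ae : `|eps| * B <= 1 / 2.
  by rewrite /eps normrM normr_sg m0 (gtr0_norm t0) /= (mul1r t).
have H := Ent_near1_ge Hmu bphi B0 (fun x xab => HB x (ltW2 xab)) Ephi ae.
rewrite -/s -/m -/K -[X in _ + X - _ <= _]mulrA em e2 in H.
have dE : E (fun x => (eps * (lam * v x / rho x)) ^+ 2) = t ^+ 2 * (lam * s).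
  rewrite -Edphi -e2 -meanZ.
    by apply: mean_ext => x _; rewrite exprMn.
  by apply: bdmeasX; apply: bdmeas_C0 => //; case: cp.
have key : t ^+ 2 * s < t ^+ 2 * s + t ^+ 2 * (1 / 3 * (t * `|m|) - 1 / 2 * (K * t * t)).
  rewrite ltrDl mulr_gt0 ?exprn_gt0 //.
  have : K * t * t <= `|m| / 3 * t by rewrite ler_wpM2r // ltW.
  have : 0 < t * `|m| by rewrite mulr_gt0.
  lra.
have EE : 2 * (t ^+ 2 * s + t ^+ 2 * (1 / 3 * (t * `|m|) - 1 / 2 * (K * t * t))) <= Ent (fun x => 1 + eps * phi x).
  apply: le_trans H; rewrite le_eqVlt; apply/orP; left; apply/eqP; by field.
exists (fun x => 1 + eps * phi x), (fun x => eps * (lam * v x / rho x)); split.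
- split; first by apply: C0M; [exact: C0_cst|case: cp].
  move=> x xab; case: cp => _ /(_ x xab) dphi.
  by apply: derE (derD (der_cst 1 x) (derZ eps dphi)) _; rewrite add0r.
- apply: lt_le_trans EE; rewrite mulr_gt0 //; apply: lt_trans key; rewrite mulr_gt0 ?exprn_gt0 //.
rewrite dE; apply: lt_le_trans (_ : lam / 2 * (2 * (t ^+ 2 * s + t ^+ 2 * (1 / 3 * (t * `|m|) - 1 / 2 * (K * t * t)))) <= _).
  have -> : t ^+ 2 * (lam * s) = lam * (t ^+ 2 * s) by ring.
  have -> : forall z, lam / 2 * (2 * z) = lam * z by move=> z; field.
  by rewrite ltr_pM2l.
by rewrite ler_wpM2l // divr_ge0 // ltW.
Qed.

(** Near a constant the entropy is at most [2 + 8 d] times the variance, which is at most [1 / lam]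
    times the energy; [d] is chosen so that [lam' (1 + 4 d) <= lam]. Multiplying [f] by [c] reduces
    [c = -1] to [c = 1]. *)
Lemma near_constant_ratio lam' : 0 <= lam' -> lam' < lam ->
  exists d, 0 < d /\ forall c f f', c ^+ 2 = 1 -> C1pair a b f f' ->
  (forall x, a < x < b -> `|f x - c| <= d) -> lam' / 2 * Ent f <= E (fun x => f' x ^+ 2).
Proof.
move=> l0 ll.
pose d := Num.min (1 / 8) ((lam - lam') / (4 * (lam' + 1))).
have d0 : 0 < d by rewrite lt_min !divr_gt0 //; lra.
exists d; split => // c f f' c2 ff' fc.
have d8 : d <= 1 / 8 by rewrite ge_min lexx.
have cf := C1pair_C0 ff'.
have bf := bdmeas_C0 hab cf.
have bcf := bdmeasZ c bf.
have fc1 x : a < x < b -> `|c * f x - 1| <= d.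
  move=> xab; have -> : c * f x - 1 = c * (f x - c) by rewrite mulrBr -expr2 c2.
  rewrite normrM; have -> : `|c| = 1.
    by apply/eqP; rewrite -(@eqrXn2 _ 2) // -normrX c2 normr1 expr1n.
  by rewrite mul1r fc.
have := Ent_near1_le bcf d8 fc1.
rewrite (Ent_scale Hmu) // c2 mul1r meanZ //.
rewrite (@mean_ext _ a b mu (fun x => (c * f x) ^+ 2) (fun x => f x ^+ 2)); last by move=> x _;
  rewrite exprMn c2 mul1r.
rewrite exprMn c2 mul1r => H.
have P := poincare hab crho rho0 Hmu lam0 Hsol v0 phib ff'.
set V := _ - _ in H P.
have V0 : 0 <= V.
  have b2 := bdmeasX 2 bf; have b3 := bdmeasZ (2 * E f) bf; have bc :=
    @bdmeas_cst R a b (E f ^+ 2).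
  have : 0 <= E (fun x => (f x - E f) ^+ 2) by exact: mean_sqr_ge0.
  rewrite (@mean_ext _ a b mu _ (fun x => f x ^+ 2 - 2 * E f * f x + E f ^+ 2));
    last by move=> x _; ring.
  rewrite (meanD mu (bdmeasB b2 b3) bc) (meanB mu b2 b3) (mean_cst Hmu) meanZ // /V; lra.
apply: le_trans P; apply: le_trans (_ : lam' / 2 * ((2 + 8 * d) * V) <= _).
  by rewrite ler_wpM2l // divr_ge0.
rewrite mulrA ler_wpM2r //.
have h : d <= (lam - lam') / (4 * (lam' + 1)) by rewrite ge_min lexx orbT.
rewrite ler_pdivlMr in h; last lra.
have : 0 <= d by exact: ltW.
lra.
Qed.

End Entropy2.

(** * Polynomial approximation *)

Section Bernstein.
Context {R : realType}.
Implicit Types (g h : nat -> R) (x y : R).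

(** The Bernstein polynomial of the values [g 0, ..., g n], by conditioning on the
    first of the [n] Bernoulli trials. *)
Fixpoint bern n g : {poly R} :=
  if n is n'.+1 then (1 - 'X) * bern n' g + 'X * bern n' (g \o S) else (g 0%N)%:P.

Lemma bernS n g x : (bern n.+1 g).[x] = (1 - x) * (bern n g).[x] + x * (bern n (g \o S)).[x].
Proof. by rewrite /= !hornerE. Qed.

Lemma bern_le n g h x : 0 <= x <= 1 -> (forall k, (k <= n)%N -> g k <= h k) ->
  (bern n g).[x] <= (bern n h).[x].
Proof.
move=> /andP[x0 x1]; elim: n g h => [|n IH] g h gh; first by rewrite !hornerC gh.
rewrite !bernS lerD // ler_wpM2l ?subr_ge0 //; apply: IH => k kn; apply: gh => //.
exact: leqW.
Qed.

Lemma bern_lin n g h c x : (bern n (fun k => g k + c * h k)).[x] =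
  (bern n g).[x] + c * (bern n h).[x].
Proof.
elim: n g h => [|n IH] g h; first by rewrite !hornerC.
have e : (fun k => g k + c * h k) \o S = (fun k => (g \o S) k + c * (h \o S) k) by [].
by rewrite !bernS e !IH; ring.
Qed.

Lemma bern_cst n c x : (bern n (fun=> c)).[x] = c.
Proof. elim: n => [|n IH]; [by rewrite hornerC|by rewrite bernS /comp IH; ring]. Qed.

(** The centre [y] is free for the sake of the induction: removing a successful first trial moves it
    to [y - 1]. *)
Lemma bern_var n x y : (bern n (fun k => (k%:R - y) ^+ 2)).[x] =
  n%:R * (x * (1 - x)) + (n%:R * x - y) ^+ 2.
Proof.
elim: n y => [|n IH] y; first by rewrite hornerC; ring.
rewrite bernS IH.
have -> : (fun k => (k%:R - y) ^+ 2) \o S = fun k => (k%:R - (y - 1)) ^+ 2.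
  by apply/funext => k /=; rewrite -natr1; ring.
by rewrite IH -natr1; ring.
Qed.

(** Chebyshev's argument: [|f (k/n) - f x|] is at most [e / 2 + K (k/n - x)^2], where [K d^2 = 2 M]
    covers the points farther than [d] from [x], and the quadratic term averages to
    [K x (1 - x) / n]. *)
Lemma bernstein (f : R -> R) e : continuous f -> 0 < e ->
  exists q : {poly R}, forall x, 0 <= x <= 1 -> `|q.[x] - f x| <= e.
Proof.
move=> cf e0.
have cf1 : C0 0 1 f by move=> x _; exact: cf.
have [M [M0 HM]] := C0_bounded ler01 cf1.
have [d [d0 Hd]] := unif_cont 1 cf (ltac:(lra) : 0 < e / 2).
pose K := 2 * M / d ^+ 2.
have d2 : 0 < d ^+ 2 by rewrite exprn_gt0.
have K0 : 0 <= K by rewrite divr_ge0 ?(ltW d2) // mulr_ge0 // ltW.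
pose n := (Num.truncn (2 * K / e)).+1.
have n0 : 0 < (n%:R : R) by rewrite ltr0n.
have nK : K / n%:R <= e / 2.
  rewrite ler_pdivrMr // mulrC -ler_pdivrMr ?divr_gt0 //.
  have -> : K / (e / 2) = 2 * K / e by field; rewrite lt0r_neq0.
  by rewrite ltW // truncnS_gt.
exists (bern n (fun k => f (k%:R / n%:R))) => x x01.
pose w k := (k%:R - n%:R * x) ^+ 2.
have est k : (k <= n)%N -> `|f (k%:R / n%:R) - f x| <= e / 2 + K / n%:R ^+ 2 * w k.
  move=> kn; have k01 : 0 <= (k%:R / n%:R : R) <= 1.
    by rewrite divr_ge0 //= ler_pdivrMr // mul1r ler_nat.
  have wE : K / n%:R ^+ 2 * w k = K * (k%:R / n%:R - x) ^+ 2.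
    by rewrite /w; field; rewrite lt0r_neq0.
  rewrite wE; have [kd|kd] := lerP `|x - k%:R / n%:R| d.
    rewrite distrC; apply: le_trans (_ : e / 2 <= _).
      by apply: Hd => //; case/andP: x01 => *; rewrite ger0_norm.
    by rewrite lerDl mulr_ge0 ?sqr_ge0.
  apply: le_trans (_ : 2 * M <= _).
    apply: le_trans (ler_normB _ _) _; have := HM _ k01; have := HM _ x01; lra.
  have : d ^+ 2 <= (k%:R / n%:R - x) ^+ 2.
    by rewrite -[leRHS]real_normK ?num_real // distrC ler_sqr ?nnegrE ?normr_ge0 ?(ltW d0) ?(ltW kd).
  move=> h; have : K * d ^+ 2 <= K * (k%:R / n%:R - x) ^+ 2 by rewrite ler_wpM2l.
  have -> : K * d ^+ 2 = 2 * M by rewrite /K; field; rewrite lt0r_neq0.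
  lra.
have wn : (bern n w).[x] = n%:R * (x * (1 - x)) by rewrite bern_var subrr expr0n /= addr0.
have up : K / n%:R ^+ 2 * (bern n w).[x] <= e / 2.
  rewrite wn; apply: le_trans nK.
  have -> : K / n%:R ^+ 2 * (n%:R * (x * (1 - x))) = K / n%:R * (x * (1 - x)).
    by field; rewrite lt0r_neq0.
  rewrite ler_piMr ?divr_ge0 ?(ltW n0) //; case/andP: x01 => *; nra.
have est1 k : (k <= n)%N -> f (k%:R / n%:R) <= (f x + e / 2) + K / n%:R ^+ 2 * w k.
  by move=> /est; rewrite ler_norml => /andP[_]; lra.
have est2 k : (k <= n)%N -> (f x - e / 2) + - (K / n%:R ^+ 2) * w k <= f (k%:R / n%:R).
  by move=> /est; rewrite ler_norml => /andP[]; lra.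
have := bern_le x01 est1; have := bern_le x01 est2.
rewrite !(bern_lin n (fun=> _)) !bern_cst => h1 h2.
rewrite ler_norml; apply/andP; split; lra.
Qed.

Lemma weierstrass a b (f : R -> R) e : a < b -> C0 a b f -> 0 < e ->
  exists q : {poly R}, forall x, a <= x <= b -> `|q.[x] - f x| <= e.
Proof.
move=> ab cf e0; have cc := clamp_C0 (ltW ab) cf.
pose g t := (f \o clamp a b) (a + (b - a) * t).
have cg : continuous g.
  move=> t; apply: (@continuous_comp _ _ _ (fun t => a + (b - a) * t)); last exact: cc.
  by apply: der_cont; apply: derD; [exact: der_cst|apply: derZ; exact: der_id].
have [q Hq] := bernstein cg e0.
have ba : b - a != 0 by rewrite subr_eq0 gt_eqF.
exists (q \Po (((b - a)^-1)%:P * ('X - a%:P))) => x /[dup] xab /andP[ax xb].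
rewrite horner_comp !hornerE.
have := Hq ((b - a)^-1 * (x - a)).
have ex : a + (b - a) * ((b - a)^-1 * (x - a)) = x by field.
rewrite /g ex /= clamp_id //; apply.
rewrite mulr_ge0 ?invr_ge0 ?subr_ge0 ?(ltW ab) //= mulrC ler_pdivrMr ?subr_gt0 // mul1r; lra.
Qed.

Lemma antideriv (q : {poly R}) : exists Q : {poly R}, deriv Q = q.
Proof.
(* The constant coefficient is a division by zero, hence 0; [deriv] discards it. *)
exists (\poly_(i < (size q).+1) (q`_i.-1 / i%:R)); apply/polyP => i.
rewrite coef_deriv coef_poly ltnS; case: ltnP => [_|sq] /=.
  by rewrite -[LHS]mulr_natr divfK // pnatr_eq0.
by rewrite nth_default // mul0rn.
Qed.

Lemma der_horner (Q : {poly R}) x : der (horner Q) x (deriv Q).[x].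
Proof. by apply: DeriveDef; [exact: derivable_horner|rewrite -derive1E -derivE]. Qed.

Lemma Cinfty_horner a b (Q : {poly R}) : Cinfty a b (horner Q).
Proof.
have cont (P : {poly R}) : continuous (horner P).
  by move=> x; exact: der_cont (der_horner P x).
have dn n : (horner Q)^`(n)%classic = horner (derivn n Q).
  elim: n => [|n IH]; first by rewrite derivn0.
  by rewrite derive1nS IH derivnS derivE.
move=> k; split; first by apply: continuous_subspaceT; exact: cont.
move=> n _; rewrite !dn; split; first by move=> x _; exact: derivable_horner.
by exists (horner (derivn n.+1 Q)) => //; apply: continuous_subspaceT; exact: cont.
Qed.

Lemma within_clamp a b (h : R -> R) : a <= b -> {within `[a, b], continuous h} ->
  continuous (h \o clamp a b).
Proof.
move=> ab /subspace_continuousP ch x.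
have cA : `[a, b]%classic (clamp a b x) by rewrite /= in_itv /=; exact: clamp_itv.
apply: cvg_trans (ch _ cA); move=> V /= HV.
have H := @clamp_continuous R a b x _ HV.
suff : nbhs x (fun y => V (h (clamp a b y))) by [].
apply: (@filterS _ (nbhs x) _ _ _ _ H) => y Hy; apply: Hy.
by rewrite /= in_itv /=; exact: clamp_itv.
Qed.

(** [Ck] leaves the values outside the segment free, so [f] may fail to be differentiable from both
    sides at the end points. [F] is [f a] plus the primitive of the clamped derivative; the mean
    value theorem for [f] minus that primitive gives the equality on the segment. *)
Lemma Ck1_C1pair a b f : a < b -> Ck a b 1 f ->
  exists F G : R -> R, [/\ C1pair a b F G, forall x, a <= x <= b -> f x = F x &
    forall x, a < x < b -> derive1 f x = G x].
Proof.
move=> ab [cf /(_ 0%N isT)[df [g cg fg]]].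
pose G := g \o clamp a b.
have cG : C0 a b G by move=> x _; exact: within_clamp (ltW ab) cg x.
have dP := prim_der ab cG.
have gG x : a < x < b -> derive1 f x = G x.
  move=> xab; have -> : derive1 f x = g x by apply: fg; rewrite inE /= in_itv.
  by rewrite /G /= clamp_id // ltW2.
exists (fun x => f a + prim a b G x), G; split => //.
  by split => // x xab; apply: derE (derD (der_cst (f a) x) (dP x xab)) _; rewrite add0r.
move=> x /andP[ax xb].
have cP := C0_within (prim_C0 ab cG).
have sub : `[a, x] `<=` `[a, b] by apply: subset_itvl; rewrite bnd_simp.
have := @MVT_segment R (fun y => f y - prim a b G y) (fun=> 0) a x ax _ _.
rewrite prim_a subr0 mul0r => H.
suff : f x - prim a b G x - f a = 0 by move/eqP; rewrite subr_eq0 subr_eq => /eqP.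
have [||c _ //] := H.
  move=> y; rewrite in_itv /= => /andP[ay yx].
  have yab : a < y < b by rewrite ay (lt_le_trans yx).
  apply: derE; first (apply: derB; last exact: dP (ltW2 yab)).
    by apply: DeriveDef; [apply: df; rewrite inE /= in_itv|reflexivity].
  by rewrite -derive1E gG // subrr.
move=> y; apply: cvgB; [apply: (continuous_subspaceW sub cf)|apply: (continuous_subspaceW sub cP)].
Qed.

End Bernstein.

(** * Log-Sobolev constants *)

Section LS.
Context {R : realType}.
Variables (a b : R) (rho : R -> R) (mu : probability (measurableTypeR R) R).
Hypothesis hab : a < b.
Hypothesis crho : C0 a b rho.
Hypothesis rho0 : forall x, a <= x <= b -> 0 < rho x.
Hypothesis Hmu : forall A : set (measurableTypeR R), measurable A ->
  mu A = (\int[lebesgue_measure]_(x in A `&` `]a, b[) (rho x)%:E)%E.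

Local Notation E := (mean a b mu).
Local Notation Ent := (Ent_sq mu a b).

(** Written so as to be convertible to the set whose supremum is [LambdaLS]. *)
Definition LS_constants : set R := [set C : R | forall f : R -> R, Cinfty a b f ->
  C / 2 * Ent f <= E (fun x => derive1 f x ^+ 2)].

Lemma C1pair_horner (Q : {poly R}) : C1pair a b (horner Q) (horner (deriv Q)).
Proof.
split => [x _|x _]; last exact: der_horner.
exact: der_cont (der_horner _ _).
Qed.

Lemma C0_horner (Q : {poly R}) : C0 a b (horner Q).
Proof. exact: C1pair_C0 (C1pair_horner Q). Qed.

(** Approximate the derivative and integrate from [a]; the bound [e / (b - a)] on [d] pays for the
    integration. *)
Lemma approx_poly F G e : C1pair a b F G -> 0 < e -> exists Q : {poly R},
  forall x, a <= x <= b -> `|F x - Q.[x]| <= e /\ `|G x - (deriv Q).[x]| <= e.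
Proof.
move=> [cG dF] e0; have ba : 0 < b - a by rewrite subr_gt0.
pose d := Num.min e (e / (b - a)).
have d0 : 0 < d by rewrite lt_min e0 divr_gt0.
have [q Hq] := weierstrass hab cG d0.
have [Q0 HQ0] := antideriv q.
pose Q := Q0 + (F a - Q0.[a])%:P.
have dQ : deriv Q = q by rewrite /Q derivD derivC addr0.
have Qa : Q.[a] = F a by rewrite /Q hornerD hornerC; ring.
exists Q => x xab; rewrite dQ; split; last first.
  by rewrite distrC; apply: le_trans (Hq x xab) _; rewrite ge_min lexx.
have /andP[ax xb] := xab.
have cd : C0 a b (fun x => d * x).
  by apply: (@C0_der _ a b _ (fun=> d * 1)) => t _; apply: derZ; exact: der_id.
have := @normr_der _ a b (fun x => F x - Q.[x]) (fun x => d * x) (fun x => G x - q.[x]) (fun=> d * 1)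
  (C0B (C0_der dF) (@C0_horner Q)) cd _ _ _ a x (lexx a) ax xb.
rewrite Qa subrr subr0 -mulrBr => H; apply: le_trans (H _ _ _) _.
- move=> t /ltW2 tab; apply: derB; first exact: dF.
  by have := der_horner Q t; rewrite dQ.
- by move=> t _; apply: derZ; exact: der_id.
- by move=> t /ltW2 tab; rewrite mulr1 distrC; exact: Hq.
apply: le_trans (_ : d * (b - a) <= _); first by rewrite ler_wpM2l ?(ltW d0) // lerD2r.
by rewrite -ler_pdivlMr // ge_min lexx orbT.
Qed.

Lemma approx_functionals F G e : C1pair a b F G -> 0 < e -> exists Q : {poly R},
  `|E (fun x => G x ^+ 2) - E (fun x => (deriv Q).[x] ^+ 2)| <= e /\
  `|Ent F - Ent (horner Q)| <= e.
Proof.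
move=> FG e0; have [cG dF] := FG; have cF := C1pair_C0 FG.
have [M [M0 HM]] := C0_bounded (ltW hab) cF.
have [N [N0 HN]] := C0_bounded (ltW hab) cG.
have csq : continuous (fun y : R => y ^+ 2) by move=> y; exact: exprn_continuous.
have [d1 [d10 Hd1]] := unif_cont N csq e0.
have [d2 [d20 Hd2]] := Ent_continuous Hmu M0 e0.
have d0 : 0 < Num.min d1 d2 by rewrite lt_min d10.
have [Q HQ] := approx_poly FG d0; exists Q; split.
  apply: (mean_dist Hmu).
  - by apply: bdmeasX; exact: bdmeas_C0.
  - by apply: bdmeasX; apply: bdmeas_C0 => //; exact: C0_horner.
  - move=> x /ltW2 xab; apply: Hd1; first exact: HN.
    by have [_ h] := HQ x xab; apply: (le_trans h); rewrite ge_min lexx.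
apply: Hd2; [exact: bdmeas_C0|by apply: bdmeas_C0 => //; exact: C0_horner|by move=> x /ltW2/HM|].
move=> x /ltW2 xab; have [h _] := HQ x xab; apply: (le_trans h).
by rewrite ge_min lexx orbT.
Qed.

Lemma LS_poly C (Q : {poly R}) : LS_constants C ->
  C / 2 * Ent (horner Q) <= E (fun x => (deriv Q).[x] ^+ 2).
Proof.
move=> /(_ _ (@Cinfty_horner _ a b Q)) /le_trans; apply.
by rewrite le_eqVlt; apply/orP; left; apply/eqP; apply: mean_ext => x _; rewrite -derivE.
Qed.

(** Lets the inequality be applied to the test function of [ratio_lt_gap], which need not be
    smooth. *)
Lemma LS_C1 C F G : LS_constants C -> C1pair a b F G -> C / 2 * Ent F <= E (fun x => G x ^+ 2).
Proof.
move=> SC FG; apply/ler_addgt0Pl => e e0.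
pose K := `|C / 2| + 1.
have K0 : 0 < K by rewrite /K; have := normr_ge0 (C / 2); lra.
have eK : 0 < e / (K + 1) by rewrite divr_gt0 //; lra.
have [Q [h1 h2]] := approx_functionals FG eK.
have h3 := LS_poly Q SC.
have h4 : `|C / 2 * (Ent F - Ent (horner Q))| <= K * (e / (K + 1)).
  by rewrite normrM ler_pM // /K lerDl.
have h5 : K * (e / (K + 1)) + e / (K + 1) = e by field; rewrite lt0r_neq0 //; lra.
move: h1 h4; rewrite !ler_norml => /andP[h11 h12] /andP[h41 h42]; lra.
Qed.

Lemma LS_constants0 : LS_constants 0.
Proof. by move=> f _; rewrite !mul0r mean_sqr_ge0. Qed.

(** * The supremum of the admissible constants *)

Section Strict.
Variables (lam : R) (F G : R -> R).
Hypothesis FG : C1pair a b F G.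
Hypothesis EntF : 0 < Ent F.
Hypothesis strictF : E (fun x => G x ^+ 2) < lam / 2 * Ent F.

Lemma LS_constants_has_sup : has_sup LS_constants.
Proof.
split; first by exists 0; exact: LS_constants0.
exists (2 * E (fun x => G x ^+ 2) / Ent F) => C SC.
have := LS_C1 SC FG; rewrite ler_pdivlMr //; lra.
Qed.

Lemma sup_LS_constants_lt : sup LS_constants < lam.
Proof.
apply: le_lt_trans (_ : 2 * E (fun x => G x ^+ 2) / Ent F < lam).
  apply: ge_sup; first by exists 0; exact: LS_constants0.
  by move=> C SC; have := LS_C1 SC FG; rewrite ler_pdivlMr //; lra.
rewrite ltr_pdivrMr //; move: strictF; lra.
Qed.

Lemma sup_LS_constants_ge0 : 0 <= sup LS_constants.
Proof. by apply: ub_le_sup; [exact: (proj2 LS_constants_has_sup)|exact: LS_constants0]. Qed.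

(** For positive entropy every admissible constant is at most twice the energy over the entropy of
    [f], hence so is the supremum; otherwise the left-hand side is not positive. *)
Lemma sup_LS_constants_mem : LS_constants (sup LS_constants).
Proof.
move=> f cf; have [h|h] := lerP (Ent f) 0.
  apply: le_trans (_ : 0 <= _); last exact: mean_sqr_ge0.
  by rewrite mulr_ge0_le0 // divr_ge0 // sup_LS_constants_ge0.
have : sup LS_constants <= 2 * E (fun x => derive1 f x ^+ 2) / Ent f.
  apply: ge_sup; first by exists 0; exact: LS_constants0.
  by move=> C /(_ f cf) HC; rewrite ler_pdivlMr //; lra.
rewrite ler_pdivlMr //; lra.
Qed.

End Strict.

Lemma sqr_ln_sqr_le (y M : R) : 1 <= M -> `|y| <= M -> sqr_ln_sqr y <= 2 * (M - 1) * y ^+ 2.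
Proof.
move=> M1 yM; rewrite /sqr_ln_sqr mulrC; have [->|y0] := eqVneq y 0.
  by rewrite expr0n /= !mulr0.
rewrite ler_wpM2r ?sqr_ge0 //.
have M0 : 0 < M by lra.
apply: le_trans (_ : ln (M ^+ 2) <= _).
  have y2 : 0 < y ^+ 2 by rewrite exprn_even_gt0.
  have M2 : 0 < M ^+ 2 by rewrite exprn_gt0.
  rewrite ler_ln ?posrE //.
  by rewrite -real_normK ?num_real // ler_sqr ?nnegrE // ltW.
rewrite lnXn // -[ln _ *+ 2]mulr_natl ler_wpM2l //.
have := @le_ln1Dx _ (M - 1) ltac:(lra).
by have -> : 1 + (M - 1) = M by ring.
Qed.

(** The bound grows only linearly with [M]; this lets the energy be absorbed in
    [minimizing_bound]. *)
Lemma Ent_le (f : R -> R) M : bdmeas a b f -> 1 <= M -> (forall x, a < x < b -> `|f x| <= M) ->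
  Ent f <= 2 * (M - 1) * E (fun x => f x ^+ 2) - mul_ln (E (fun x => f x ^+ 2)).
Proof.
move=> bf M1 fM; rewrite EntE lerD2r -meanZ; last exact: bdmeasX.
apply: le_mean; first by apply: bdmeas_comp bf _; exact: sqr_ln_sqr_continuous.
  by apply: bdmeasZ; exact: bdmeasX.
by move=> x /fM; exact: sqr_ln_sqr_le.
Qed.

Lemma minimizing_poly L e : 0 <= L -> 0 < e -> ~ LS_constants (L + e) -> exists Q : {poly R},
  E (fun x => Q.[x] ^+ 2) = 1 /\ E (fun x => (deriv Q).[x] ^+ 2) < (L + e) / 2 * Ent (horner Q).
Proof.
move=> L0 e0 NS.
have [f [cf Hf]] : exists f : R -> R, Cinfty a b f /\ E (fun x => derive1 f x ^+ 2) < (L + e) / 2 * Ent f.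
  apply: contrapT => H; apply: NS => f cf; rewrite leNgt; apply/negP => h; apply: H.
  by exists f.
have [F [G [FG fF fG]]] := Ck1_C1pair hab (cf 1%N).
have {Hf} : E (fun x => G x ^+ 2) < (L + e) / 2 * Ent F.
  rewrite -(@mean_ext _ a b mu (fun x => derive1 f x ^+ 2)); last by move=> x xab; rewrite fG.
  by rewrite -(@Ent_ext _ a b mu f) // => x /ltW2; exact: fF.
set A := E _; set B := (L + e) / 2 * Ent F => AB.
(* With [d = (B - A) / K], the approximation costs [(L + e) / 2 * d + d], which is less than
   [B - A]. *)
pose K := (L + e) / 2 + 2.
have K0 : 0 < K by rewrite /K; lra.
have gK : 0 < (B - A) / K by rewrite divr_gt0 // subr_gt0.
have [Q [h1 h2]] := approx_functionals FG gK.
set d := (B - A) / K in gK h1 h2.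
have dK : (L + e) / 2 * d + 2 * d = B - A by rewrite /d /K; field; rewrite lt0r_neq0 //; lra.
have {}h2 : Ent F - Ent (horner Q) <= d by exact: le_trans (ler_norm _) h2.
have h3 : (L + e) / 2 * (Ent F - Ent (horner Q)) <= (L + e) / 2 * d.
  by rewrite ler_wpM2l //; lra.
rewrite mulrBr -/B in h3.
have {}h1 : - d <= A - E (fun x => (deriv Q).[x] ^+ 2) by move: h1; rewrite ler_norml => /andP[].
have {h1 h2 h3 dK gK} HQ : E (fun x => (deriv Q).[x] ^+ 2) < (L + e) / 2 * Ent (horner Q).
  by move: h1 h3 dK gK; set X := E _; set Y := _ * Ent (horner Q); set Z := _ * d; lra.
have bQ := bdmeas_C0 hab (@C0_horner Q).
have bQ' := bdmeas_C0 hab (@C0_horner (deriv Q)).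
have Le : 0 < (L + e) / 2 by lra.
have EntQ : 0 < Ent (horner Q).
  by rewrite -(pmulr_rgt0 _ Le); apply: le_lt_trans HQ; exact: mean_sqr_ge0.
(* If the mean square vanished, [Ent_le] would make the entropy nonpositive. *)
have s0 : 0 < E (fun x => Q.[x] ^+ 2).
  rewrite lt_neqAle mean_sqr_ge0 andbT eq_sym; apply/eqP => s0.
  have [M [M0 HM]] := C0_bounded (ltW hab) (@C0_horner Q).
  have M1 : 1 <= M + 1 by lra.
  have := Ent_le bQ M1 (fun x xab => le_trans (HM x (ltW2 xab)) (ltac:(lra) : M <= M + 1)).
  by rewrite s0 /mul_ln mulr0 mul0r subrr; lra.
set s := E _ in s0.
pose c := (Num.sqrt s)^-1.
have c2 : c ^+ 2 = s^-1 by rewrite /c exprVn sqr_sqrtr // ltW.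
have cQ x : (c *: Q).[x] = c * Q.[x] by rewrite hornerZ.
exists (c *: Q); split.
  rewrite (@mean_ext _ a b mu _ (fun x => c ^+ 2 * Q.[x] ^+ 2)); last by move=> x _;
    rewrite cQ exprMn.
  by rewrite meanZ ?c2 ?mulVf ?lt0r_neq0 //; exact: bdmeasX.
rewrite (@mean_ext _ a b mu _ (fun x => c ^+ 2 * (deriv Q).[x] ^+ 2)); last first.
  by move=> x _; rewrite derivZ hornerZ exprMn.
rewrite (@Ent_ext _ a b mu _ (fun x => c * Q.[x])); last by move=> x _; exact: cQ.
rewrite (Ent_scale Hmu) // meanZ; last exact: bdmeasX.
by rewrite mulrCA ltr_pM2l // c2 invr_gt0.
Qed.

End LS.

(** * Compactness of minimizing sequences *)

Section Compactness.
Context {R : realType}.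

(** One ultrafilter serves all bounded sequences at once, so the values at all points of the segment
    converge together; it stands in for a diagonal extraction. *)
Lemma ultra_lim (U : set_system nat) (u : nat -> R) M : UltraFilter U ->
  (forall n, `|u n| <= M) -> exists l, forall e, 0 < e -> U [set n | `|u n - l| <= e].
Proof.
move=> UU uM.
have PF : ProperFilter (u @ U) by exact: fmap_proper_filter.
have UM : (u @ U) `[- M, M]%classic.
  rewrite /= /nbhs /=; apply: filterS (filterT : U setT) => n _ /=.
  by rewrite in_itv /= -ler_norml uM.
have [l [_ cl]] := @segment_compact R (- M) M (u @ U) PF UM.
exists l => e e0; have [//|UC] := in_ultra_setVsetC [set n | `|u n - l| <= e] UU.
have Bl : nbhs l [set y | `|y - l| <= e].
  apply/nbhs_ballP; exists e => //= y; rewrite /ball /= distrC; exact: ltW.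
have := cl [set y | ~ (`|y - l| <= e)] [set y | `|y - l| <= e] UC Bl.
by move=> [y [/= h1 h2]].
Qed.

Variables (a b : R) (rho : R -> R) (mu : probability (measurableTypeR R) R).
Hypothesis hab : a < b.
Hypothesis crho : C0 a b rho.
Hypothesis rho0 : forall x, a <= x <= b -> 0 < rho x.
Hypothesis Hmu : forall A : set (measurableTypeR R), measurable A ->
  mu A = (\int[lebesgue_measure]_(x in A `&` `]a, b[) (rho x)%:E)%E.

Local Notation E := (mean a b mu).
Local Notation Ent := (Ent_sq mu a b).

(** Integrate [|G| <= t / 2 + G^2 rho / (2 t m)]. The free [t] stands for the optimization in
    Cauchy-Schwarz: one choice bounds minimizing sequences, another makes them equicontinuous. *)
Lemma oscillation_bound F G m t : C1pair a b F G -> 0 < m -> (forall x, a <= x <= b ->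
  m <= rho x) -> 0 < t ->
  forall x y, a <= x -> x <= y -> y <= b ->
  `|F y - F x| <= t / 2 * (y - x) + E (fun x => G x ^+ 2) / (2 * t * m).
Proof.
move=> [cG dF] m0 Hm t0 x y ax xy yb.
pose H := prim a b (fun x => G x ^+ 2 * rho x).
have cG2 : C0 a b (fun x => G x ^+ 2) by exact: C0X.
have dH x1 : a <= x1 <= b -> der H x1 (G x1 ^+ 2 * rho x1) by apply: prim_der => //; exact: C0M.
have EH := @mean_FTC _ a b rho mu hab crho rho0 Hmu _ H cG2 dH.
have H_le x1 y1 : a <= x1 -> x1 <= y1 -> y1 <= b -> H x1 <= H y1.
  apply: (ler_der (C0_der dH) (fun x xab => dH x (ltW2 xab))).
  by move=> z /ltW2 zab; rewrite mulr_ge0 ?sqr_ge0 // ltW // rho0.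
have k0 : 0 < 2 * t * m by rewrite !mulr_gt0.
pose g z := t / 2 * z + (2 * t * m)^-1 * H z.
pose g' z := t / 2 * 1 + (2 * t * m)^-1 * (G z ^+ 2 * rho z).
have dg z : a <= z <= b -> der g z (g' z).
  by move=> zab; apply: derD; apply: derZ; [exact: der_id|exact: dH].
apply: le_trans (_ : g y - g x <= _).
  apply: (normr_der (C0_der dF) (C0_der dg) (fun x xab => dF x (ltW2 xab)) (fun x xab => dg x (ltW2 xab))) => //.
  move=> z /ltW2 zab; rewrite /g' mulr1.
  apply: le_trans (_ : t / 2 + (2 * t * m)^-1 * (G z ^+ 2 * m) <= _); last first.
    by rewrite lerD2l ler_wpM2l ?invr_ge0 ?(ltW k0) // ler_wpM2l ?sqr_ge0 // Hm.
  rewrite -subr_ge0 -[G z ^+ 2]real_normK ?num_real //.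
  have -> : t / 2 + (2 * t * m)^-1 * (`|G z| ^+ 2 * m) - `|G z| = (2 * t)^-1 * (t - `|G z|) ^+ 2.
    by field; rewrite !lt0r_neq0.
  by rewrite mulr_ge0 ?sqr_ge0 // invr_ge0 mulr_ge0 // ltW.
have -> : g y - g x = t / 2 * (y - x) + (2 * t * m)^-1 * (H y - H x) by rewrite /g; ring.
rewrite lerD2l mulrC ler_wpM2r ?invr_ge0 ?(ltW k0) // EH.
have := H_le a x (lexx a) ax (le_trans xy yb); have := H_le y b (le_trans ax xy) yb (lexx b); lra.
Qed.

(** Otherwise [(F^2 - 1) rho] would be positive throughout and its primitive strictly increasing,
    against [E (F^2 - 1) = 0]. *)
Lemma exists_le1 F : C0 a b F -> E (fun x => F x ^+ 2) = 1 ->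
  exists y, a <= y <= b /\ `|F y| <= 1.
Proof.
move=> cF E1; apply: contrapT => H.
have big y : a <= y <= b -> 1 < F y ^+ 2.
  move=> yab; rewrite -real_normK ?num_real // -[ltLHS](expr1n _ 2) ltr_sqr ?nnegrE // ltNge.
  by apply/negP => h; apply: H; exists y.
have c2 : C0 a b (fun x => F x ^+ 2 - 1) by apply: C0B; [exact: C0X|exact: C0_cst].
have dP := prim_der hab (C0M c2 crho).
have := @mean_FTC _ a b rho mu hab crho rho0 Hmu _ _ c2 dP.
rewrite meanB; [|by apply: bdmeas_C0 => //; exact: C0X|exact: bdmeas_cst].
rewrite E1 (mean_cst Hmu) subrr.
move=> e.
have : prim a b (fun x => (F x ^+ 2 - 1) * rho x) a < prim a b (fun x => (F x ^+ 2 - 1) * rho x) b.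
  apply: (ltr_der (C0_der dP) (fun x xab => dP x (ltW2 xab))) => //.
  by move=> x /ltW2 xab; rewrite mulr_gt0 ?rho0 // subr_gt0 big.
by rewrite -subr_gt0 -e ltxx.
Qed.

(** Let [D] be the energy and [l = L + 1]. The oscillation bound with [t = l / m] bounds [|F|] by
    [M], where [M - 1 = l (b - a) / (2 m) + D / (2 l)]; the entropy bound gives [D <= l (M - 1)], so
    half of [D] is absorbed. *)
Lemma minimizing_bound F G L e m : C1pair a b F G -> 0 < m -> (forall x, a <= x <= b ->
  m <= rho x) ->
  0 <= L -> 0 < e <= 1 -> E (fun x => F x ^+ 2) = 1 ->
  E (fun x => G x ^+ 2) < (L + e) / 2 * Ent F ->
  E (fun x => G x ^+ 2) <= (L + 1) ^+ 2 * (b - a) / m /\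
  forall x, a <= x <= b -> `|F x| <= 1 + (L + 1) * (b - a) / m.
Proof.
move=> FG m0 Hm L0 /andP[e0 e1] E1 HE.
have cF := C1pair_C0 FG.
have bF := bdmeas_C0 hab cF.
set D := E _ in HE *.
have D0 : 0 <= D by exact: mean_sqr_ge0.
pose l := L + 1; have l0 : 0 < l by rewrite /l; lra.
have t0 : 0 < l / m by rewrite divr_gt0.
have [y0 [/andP[ay yb] Fy]] := exists_le1 cF E1.
pose M := 1 + (l / m / 2 * (b - a) + D / (2 * (l / m) * m)).
have k0 : 0 <= l / m / 2 by rewrite divr_ge0 // ltW.
have FM x : a <= x <= b -> `|F x| <= M.
  move=> /andP[ax xb].
  have [xy|yx] := lerP x y0.
    have := oscillation_bound FG m0 Hm t0 ax xy yb; rewrite distrC => h.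
    have -> : F x = F y0 + (F x - F y0) by ring.
    apply: le_trans (ler_normD _ _) _; rewrite lerD //; apply: (le_trans h).
    by rewrite lerD2r ler_wpM2l //; lra.
  have h := oscillation_bound FG m0 Hm t0 ay (ltW yx) xb.
  have -> : F x = F y0 + (F x - F y0) by ring.
  apply: le_trans (ler_normD _ _) _; rewrite lerD //; apply: (le_trans h).
  by rewrite lerD2r ler_wpM2l //; lra.
have ME : M - 1 = l * (b - a) / (2 * m) + D / (2 * l).
  by rewrite /M; field; rewrite !lt0r_neq0.
have M1 : 1 <= M.
  rewrite -subr_ge0 ME addr_ge0 ?divr_ge0 ?mulr_ge0 ?(ltW l0) ?(ltW m0) // subr_ge0; exact: ltW.
have := Ent_le mu bF M1 (fun x xab => FM x (ltW2 xab)).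
rewrite E1 /mul_ln ln1 mulr0 subr0 mulr1 => hE.
have hD : D <= l * (M - 1).
  apply: le_trans (ltW HE) _.
  have Ep : 0 < Ent F.
    have Le : 0 < (L + e) / 2 by lra.
    by rewrite -(pmulr_rgt0 _ Le); apply: le_lt_trans HE.
  apply: le_trans (_ : l / 2 * Ent F <= _); first by rewrite ler_wpM2r ?(ltW Ep) // /l; lra.
  have -> : l * (M - 1) = l / 2 * (2 * (M - 1)) by field.
  by rewrite ler_wpM2l // divr_ge0 // ltW.
have hD2 : D <= l ^+ 2 * (b - a) / m.
  have : l * (M - 1) = l ^+ 2 * (b - a) / m / 2 + D / 2.
    by rewrite ME; field; rewrite !lt0r_neq0.
  lra.
split => // x xab; apply: le_trans (FM x xab) _.
have -> : M = 1 + (l * (b - a) / (2 * m) + D / (2 * l)) by rewrite -ME; ring.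
rewrite lerD2l.
have -> : l * (b - a) / m = l * (b - a) / (2 * m) + (l ^+ 2 * (b - a) / m) / (2 * l).
  by field; rewrite !lt0r_neq0.
by rewrite lerD2l ler_wpM2r // invr_ge0 mulr_ge0 // ltW.
Qed.

Lemma minimizing_limit L : 0 <= L -> (forall e, 0 < e -> ~ LS_constants a b mu (L + e)) ->
  exists f, [/\ C0 a b f, E (fun x => f x ^+ 2) = 1 &
    forall e, 0 < e -> exists Q : {poly R}, (forall x, a <= x <= b -> `|Q.[x] - f x| <= e) /\
      E (fun x => (deriv Q).[x] ^+ 2) < (L + e) / 2 * Ent (horner Q)].
Proof.
move=> L0 HL.
have [m [m0 Hm]] := C0_pos_lb (ltW hab) crho rho0.
have e0 n : 0 < (n.+1%:R^-1 : R) by rewrite invr_gt0.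
have e1 n : (n.+1%:R^-1 : R) <= 1 by rewrite invf_le1 // ler1n.
have /choice[Q HQ] n := minimizing_poly hab Hmu L0 (e0 n) (HL _ (e0 n)).
have ap n : E (fun x => (deriv (Q n)).[x] ^+ 2) <= (L + 1) ^+ 2 * (b - a) / m /\
  forall x, a <= x <= b -> `|(Q n).[x]| <= 1 + (L + 1) * (b - a) / m.
  have [h1 h2] := HQ n.
  by apply: (minimizing_bound (C1pair_horner a b (Q n)) m0 Hm L0 _ h1 h2); rewrite e0 e1.
set D := (L + 1) ^+ 2 * (b - a) / m in ap; set M := 1 + _ in ap.
have D0 : 0 <= D by rewrite divr_ge0 ?(ltW m0) // mulr_ge0 ?sqr_ge0 // subr_ge0 ltW.
have ba : 0 < b - a by rewrite subr_gt0.
have M0 : 0 < M by rewrite /M ltr_pwDl // divr_ge0 ?(ltW m0) // mulr_ge0 ?(ltW ba) //; lra.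
have equi e : 0 < e -> exists d, 0 < d /\ forall n x y, a <= x <= b -> a <= y <= b ->
  `|x - y| <= d ->
    `|(Q n).[x] - (Q n).[y]| <= e.
  (* This [t] makes the energy term of the oscillation bound at most [e / 2]; a distance of at most
     [e / t] does the same for the linear term. *)
  move=> ee; pose t := D / (m * e) + 1.
  have q0 : 0 <= D / (m * e) by rewrite divr_ge0 // mulr_ge0 // ltW.
  have t0 : 0 < t by rewrite /t; lra.
  have tk : D / (2 * t * m) <= e / 2.
    rewrite ler_pdivrMr ?mulr_gt0 //.
    have -> : e / 2 * (2 * t * m) = D + m * e by rewrite /t; field; rewrite !lt0r_neq0.
    by rewrite lerDl mulr_ge0 // ltW.
  exists (e / t); split; first by rewrite divr_gt0.
  have wl n x y : a <= x -> x <= y -> y <= b -> y - x <= e / t -> `|(Q n).[y] - (Q n).[x]| <= e.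
    move=> ax xy yb yx; apply: le_trans (oscillation_bound (C1pair_horner a b (Q n)) m0 Hm t0 ax xy yb) _.
    have h1 : t / 2 * (y - x) <= t / 2 * (e / t) by rewrite ler_wpM2l // divr_ge0 // ltW.
    have h2 : t / 2 * (e / t) = e / 2 by field; rewrite lt0r_neq0.
    have h3 : E (fun x => (deriv (Q n)).[x] ^+ 2) / (2 * t * m) <= D / (2 * t * m).
      by rewrite ler_wpM2r ?(proj1 (ap n)) // invr_ge0 !mulr_ge0 // ltW.
    lra.
  move=> n x y /andP[ax xb] /andP[ay yb] xy.
  have [h|h] := lerP x y.
    by rewrite distrC; apply: wl => //; apply: le_trans xy; rewrite distrC ger0_norm // subr_ge0.
  by apply: wl => //; [exact: ltW|apply: le_trans xy; rewrite ger0_norm // subr_ge0 ltW].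
(* [U] refines the filter of tails, so an index chosen in it can also be taken large. *)
have [U [UU UF]] := ultraFilterLemma (eventually_filter : ProperFilter (\oo : set_system nat)).
have clab x := clamp_itv x (ltW hab).
have /choice[f Hf] x := @ultra_lim U (fun n => (Q n).[clamp a b x]) M UU (fun n => (ap n).2 _ (clab x)).
have fe e : 0 < e -> exists d, 0 < d /\ forall x y, `|clamp a b x - clamp a b y| <= d ->
  `|f x - f y| <= e.
  move=> ee; have e3 : 0 < e / 3 by rewrite divr_gt0.
  have [d [d0 Hd]] := equi _ e3; exists d; split => // x y xy.
  have [n [h1 h2]] := @filter_ex _ U _ _ (filterI (Hf x _ e3) (Hf y _ e3)).
  have h3 := Hd n _ _ (clab x) (clab y) xy.
  have -> : f x - f y = - ((Q n).[clamp a b x] - f x) + ((Q n).[clamp a b x] - (Q n).[clamp a b y])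
     + ((Q n).[clamp a b y] - f y) by ring.
  move: h1 h2 => /= h1 h2.
  apply: le_trans (ler_normD _ _) _.
  have := ler_normD (- ((Q n).[clamp a b x] - f x)) ((Q n).[clamp a b x] - (Q n).[clamp a b y]).
  rewrite normrN; lra.
have cf : C0 a b f.
  move=> x _; apply/cvgrPdist_le => e ee.
  have [d [d0 Hd]] := fe e ee.
  have := @clamp_continuous R a b x => /cvgrPdist_lt/(_ d d0).
  by apply: filterS => y /ltW; exact: Hd.
(* Equicontinuity lets closeness at [x] persist near [x]; compactness of the segment then provides
   one member of [U] for all points. *)
have unif e : 0 < e -> U [set n | forall x, a <= x <= b -> `|(Q n).[x] - f x| <= e].
  move=> ee; have e3 : 0 < e / 3 by rewrite divr_gt0.
  have [d1 [d10 Hd1]] := equi _ e3; have [d2 [d20 Hd2]] := fe _ e3.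
  pose P (n : nat) x := a <= x <= b -> `|(Q n).[x] - f x| <= e.
  have /compact_near_coveringP := @segment_compact R a b.
  move=> /(_ nat U P _) H.
  have : \forall n \near U, `[a, b]%classic `<=` P n.
    apply: H => x; rewrite /= in_itv /= => xab.
    have d0 : 0 < Num.min d1 d2 by rewrite lt_min d10.
    exists (ball x (Num.min d1 d2), [set n | `|(Q n).[x] - f x| <= e / 3]) => /=.
      split; first exact: nbhsx_ballx.
      by have := Hf x _ e3; rewrite clamp_id.
    move=> [y n] [/= xy h1] yab.
    have xyd : `|x - y| < Num.min d1 d2 by exact: xy.
    rewrite lt_min in xyd; move/andP: xyd => [xy1 xy2].
    have h2 := Hd1 n x y xab yab (ltW xy1).
    have h3 : `|f x - f y| <= e / 3 by apply: Hd2; rewrite !clamp_id // ltW.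
    have -> : (Q n).[y] - f y = - ((Q n).[x] - (Q n).[y]) + ((Q n).[x] - f x) + (f x - f y) by ring.
    apply: le_trans (ler_normD _ _) _.
    have := ler_normD (- ((Q n).[x] - (Q n).[y])) ((Q n).[x] - f x).
    rewrite normrN; lra.
  by apply: filterS => n h x xab; apply: h => //=; rewrite in_itv.
have good e : 0 < e -> exists n, (forall x, a <= x <= b ->
  `|(Q n).[x] - f x| <= e) /\ n.+1%:R^-1 <= e.
  move=> ee; have he : U [set n | n.+1%:R^-1 <= e].
    apply: UF; exists (Num.truncn e^-1) => // n /= hn.
    have : e^-1 < n.+1%:R by apply: lt_le_trans (truncnS_gt _) _; rewrite ler_nat ltnS.
    by move=> h; rewrite -[leRHS]invrK lef_pV2 ?posrE ?invr_gt0 // ltW.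
  by have [n [h1 h2]] := @filter_ex _ U _ _ (filterI (unif e ee) he); exists n.
have csq : continuous (fun y : R => y ^+ 2) by move=> y; exact: exprn_continuous.
exists f; split => //.
  apply/eqP; rewrite -subr_eq0 -normr_le0; apply/ler_addgt0Pl => e ee; rewrite addr0.
  have [d [d0 Hd]] := unif_cont M csq ee.
  have [n [h1 _]] := good d d0.
  rewrite -(proj1 (HQ n)) distrC; apply: (mean_dist Hmu).
  - by apply: bdmeasX; apply: bdmeas_C0 => //; exact: C0_horner.
  - by apply: bdmeasX; exact: bdmeas_C0.
  - by move=> x /ltW2 xab; apply: Hd; [exact: (ap n).2|exact: h1].
move=> e ee; have [n [h1 h2]] := good e ee; exists (Q n); split => //.
have [_ h3] := HQ n; apply: lt_le_trans h3 _.
have Le : 0 < (L + n.+1%:R^-1) / 2 by rewrite divr_gt0 // ltr_wpDl.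
have {}h2 : (L + n.+1%:R^-1) / 2 <= (L + e) / 2 by rewrite ler_wpM2r // lerD2l.
have Ep : 0 < Ent (horner (Q n)).
  have [_ h3] := HQ n.
  by rewrite -(pmulr_rgt0 _ Le); apply: le_lt_trans h3; exact: mean_sqr_ge0.
by rewrite ler_wpM2r ?(ltW Ep).
Qed.

End Compactness.

(** * Completeness of the space of square integrable functions *)

Section L2Complete.
Context d (T : measurableType d) {R : realType}.
Variables (mu : {measure set T -> \bar R}) (D : set T) (G : nat -> T -> R).
Hypothesis mD : measurable D.
Hypothesis muD : (mu D < +oo)%E.
Hypothesis mG : forall k, measurable_fun D (G k).
Hypothesis HG : forall k m, (k <= m)%N ->
  (\int[mu]_(x in D) ((G k x - G m x) ^+ 2)%:E <= (8^-1 ^+ k)%:E)%E.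

Let dd k x : R := `|G k.+1 x - G k x|.
Let total_variation x : \bar R := (\sum_(k <oo) (dd k x)%:E)%E.

Let dd0 k x : (0 <= (dd k x)%:E)%E.
Proof. by rewrite lee_fin normr_ge0. Qed.

Let mdd k : measurable_fun D (fun x => (dd k x)%:E).
Proof.
apply/measurable_EFinP; apply: measurableT_comp => //; exact: measurable_funB.
Qed.

Let mT : measurable_fun D total_variation.
Proof.
apply: (@ge0_emeasurable_sum _ _ _ D (fun k x => (dd k x)%:E) xpredT) => //.
Qed.

Let half_amgm (h x : R) : 0 < h -> x <= 2^-1 * (h + h^-1 * x ^+ 2).
Proof.
move=> h0; rewrite -subr_ge0.
have -> : 2^-1 * (h + h^-1 * x ^+ 2) - x = (2 * h)^-1 * (h - x) ^+ 2.
  by field; rewrite lt0r_neq0.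
by rewrite mulr_ge0 ?sqr_ge0 // invr_ge0 mulr_ge0 // ltW.
Qed.

(** The rate [8^-k] is made for this: [|x| <= (2^-k + 2^k x^2) / 2] integrates to a summable bound,
    as [2^k 8^-k <= 2^-k]. *)
Let int_dd k : (\int[mu]_(x in D) (dd k x)%:E <= ((fine (mu D) + 1) / 2 ^+ k.+1)%:E)%E.
Proof.
have p2 : 0 < (2 : R) ^+ k by rewrite exprn_gt0.
have mun : mu D \is a fin_num by rewrite ge0_fin_numE.
have mG2 : measurable_fun D (fun x => ((G k x - G k.+1 x) ^+ 2)%:E).
  by apply/measurable_EFinP; apply: measurable_funX; exact: measurable_funB.
apply: le_trans (_ : \int[mu]_(x in D) ((2^-1 * (2 ^+ k)^-1)%:E + (2^-1 * 2 ^+ k)%:E * ((G k x - G k.+1 x) ^+ 2)%:E) <= _)%E.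
  apply: ge0_le_integral => //.
  - by apply: emeasurable_funD; [exact: measurable_cst|apply: emeasurable_funM => //;
      exact: measurable_cst].
  move=> x _; rewrite -EFinM -EFinD lee_fin /dd distrC -[X in _ + _ * X]real_normK ?num_real //.
  have := @half_amgm (2 ^+ k)^-1 `|G k x - G k.+1 x|; rewrite invr_gt0 invrK => /(_ p2); lra.
rewrite ge0_integralD //; last 2 first.
- by move=> x _; rewrite -EFinM lee_fin mulr_ge0 ?sqr_ge0 // mulr_ge0 // ltW.
- by apply: emeasurable_funM => //; exact: measurable_cst.
rewrite integral_cst // ge0_integralZl //; last by move=> x _; rewrite lee_fin sqr_ge0.
apply: le_trans (_ : (2^-1 * (2 ^+ k)^-1)%:E * mu D + (2^-1 * 2 ^+ k)%:E * (8^-1 ^+ k)%:E <= _)%E.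
  by rewrite leeD2l // lee_wpmul2l ?HG // lee_fin mulr_ge0 // ltW.
have key : (2 : R) ^+ k * 8^-1 ^+ k <= (2 ^+ k)^-1.
  have -> : (8 : R) = 2 * 4 by ring.
  rewrite invfM exprMn !exprVn mulrA divff ?lt0r_neq0 // mul1r lef_pV2 ?posrE ?exprn_gt0 //.
  by apply: lerXn2r; rewrite ?nnegrE // ler_nat.
rewrite -{1}(fineK mun) -!EFinM -EFinD lee_fin exprS invfM; lra.
Qed.

Let int_T : (\int[mu]_(x in D) total_variation x < +oo)%E.
Proof.
rewrite integral_nneseries //.
have C0 : 0 <= fine (mu D) + 1 by rewrite addr_ge0 // fine_ge0.
apply: le_lt_trans (_ : ((fine (mu D) + 1)%:E < +oo)%E); last by rewrite ltry.
apply: lime_le.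
  by apply: is_cvg_nneseries => k _ _; apply: integral_ge0 => x _; exact: dd0.
apply: nearW => n.
apply: le_trans (_ : ((fine (mu D) + 1) * (1 - (2 ^+ n)^-1))%:E <= _)%E; last first.
  by rewrite lee_fin ler_piMr // lerBlDr lerDl invr_ge0 exprn_ge0.
elim: n => [|n IH].
  by rewrite big_geq // expr0 invr1 subrr mulr0.
rewrite big_nat_recr //=.
apply: le_trans (leeD IH (int_dd n)) _.
rewrite -EFinD lee_fin le_eqVlt; apply/orP; left; apply/eqP.
rewrite exprS; field; rewrite lt0r_neq0 // exprn_gt0 //.
Qed.

(** Absolute convergence through monotone sequences: [S n] and [G n x + S n] are both nondecreasing
    and bounded. *)
Let G_cvg x : total_variation x \is a fin_num -> cvgn (G ^~ x).
Proof.
move=> Tx.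
pose S n := \sum_(0 <= k < n) dd k x.
have S_le n : S n <= fine (total_variation x).
  rewrite -lee_fin fineK // /S -sumEFin; apply: nneseries_lim_ge => k _ _; exact: dd0.
have S_S n : S n.+1 = S n + dd n x by rewrite /S big_nat_recr.
have ndS : nondecreasing_seq S by apply/nondecreasing_seqP => n; rewrite S_S lerDl normr_ge0.
have cS : cvgn S.
  by apply: nondecreasing_is_cvgn => //; exists (fine (total_variation x)) => _ [n _ <-].
pose w n := G n x + S n.
have ndw : nondecreasing_seq w.
  apply/nondecreasing_seqP => n; rewrite /w S_S.
  have : - (G n.+1 x - G n x) <= dd n x by rewrite /dd -normrN ler_norm.
  lra.
have GS n : G n x <= G 0%N x + S n.
  elim: n => [|n IH]; first by rewrite /S big_geq // addr0.
  rewrite S_S; have : G n.+1 x - G n x <= dd n x by exact: ler_norm.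
  lra.
have cw : cvgn w.
  apply: nondecreasing_is_cvgn => //; exists (G 0%N x + 2 * fine (total_variation x)) => _ [n _ <-].
  by rewrite /w; have := GS n; have := S_le n; lra.
have -> : G ^~ x = w - S by apply/funext => n; rewrite /w /= !fctE addrK.
exact: is_cvgB.
Qed.

Lemma L2_complete : exists g : T -> R, measurable_fun D g /\
  forall k, (\int[mu]_(x in D) ((G k x - g x) ^+ 2)%:E <= (8^-1 ^+ k)%:E)%E.
Proof.
(* An upper limit is measurable on all of [D], and it is the limit wherever the total variation is
   finite, that is, almost everywhere. *)
pose g x := fine (limn_esup (fun k => (G k x)%:E)).
have mg : measurable_fun D g.
  apply: measurableT_comp => //; apply: measurable_fun_limn_esup => k.
  exact/measurable_EFinP.
exists g; split => // k.
have Tae : {ae mu, forall x, D x -> total_variation x \is a fin_num}.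
  apply: integrable_ae => //; apply/integrableP; split => //.
  rewrite (eq_integral total_variation) ?int_T // => x _; rewrite gee0_abs //.
  by apply: nneseries_ge0 => n _ _; exact: dd0.
have gl x : total_variation x \is a fin_num -> G ^~ x @ \oo --> g x.
  move=> /G_cvg cG; have c1 : (EFin \o (G ^~ x)) @ \oo -->
    (limn (G ^~ x))%:E by apply/fine_cvgP; split; [exact: nearW|exact: cG].
  by rewrite /g is_cvg_limn_esupE ?(cvg_lim _ c1) //; apply/cvg_ex; exists (limn (G ^~ x))%:E.
pose h m x : \bar R := ((G k x - G m x) ^+ 2)%:E.
have mh m : measurable_fun D (h m).
  by apply/measurable_EFinP; apply: measurable_funX; exact: measurable_funB.
have h0 m x : D x -> (0 <= h m x)%E by rewrite lee_fin sqr_ge0.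
have mle : measurable_fun D (fun x => limn_einf (h ^~ x)).
  have -> : (fun x => limn_einf (h ^~ x)) = (fun x => - limn_esup (-%E \o (h ^~ x)))%E.
    apply/funext => x; rewrite -limn_einfN; congr limn_einf.
    by apply/funext => m; rewrite /comp oppeK.
  apply: measurableT_comp => //; apply: measurable_fun_limn_esup => m.
  by apply: measurableT_comp.
rewrite (ae_eq_integral (fun x => limn_einf (h ^~ x))) //; last 2 first.
- by apply/measurable_EFinP; apply: measurable_funX; exact: measurable_funB.
- apply: filterS Tae => x /[apply] /gl cg.
  have ch : (h ^~ x) @ \oo --> ((G k x - g x) ^+ 2)%:E.
    apply: cvg_EFin; first exact: nearW.
    rewrite /comp /= expr2.
    by apply: cvgM; apply: cvgB => //; exact: cvg_cst.
  by rewrite is_cvg_limn_einfE ?(cvg_lim _ ch) //; apply/cvg_ex; exists ((G k x - g x) ^+ 2)%:E.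
apply: le_trans (fatou mu mD mh h0) _.
rewrite limn_einf_lim; apply: lime_le; first exact: is_cvg_einfs.
(* The index [maxn k n] belongs to the tail from [n] and is at least [k], as [HG] requires. *)
apply: nearW => n; apply: le_trans (_ : \int[mu]_(x in D) h (maxn k n) x <= _)%E.
  by apply: ereal_inf_lbound; exists (maxn k n) => //=; exact: leq_maxr.
by apply: HG; exact: leq_maxl.
Qed.

End L2Complete.

(** * Strong convergence of the derivatives *)

Section Selection.
Context {R : realType}.
Variables (a b : R) (rho : R -> R) (mu : probability (measurableTypeR R) R).
Hypothesis hab : a < b.
Hypothesis crho : C0 a b rho.
Hypothesis rho0 : forall x, a <= x <= b -> 0 < rho x.
Hypothesis Hmu : forall A : set (measurableTypeR R), measurable A ->
  mu A = (\int[lebesgue_measure]_(x in A `&` `]a, b[) (rho x)%:E)%E.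

Local Notation E := (mean a b mu).
Local Notation Ent := (Ent_sq mu a b).

(** The primitive of [h rho] is nondecreasing with equal end values, hence constant, and its
    derivative vanishes inside. *)
Lemma mean_eq0 h : C0 a b h -> (forall x, a <= x <= b -> 0 <= h x) -> E h = 0 ->
  forall x, a < x < b -> h x = 0.
Proof.
move=> ch h0 Eh x xab; have xab' := ltW2 xab; have /andP[ax xb] := xab.
have dP := prim_der hab (C0M ch crho).
have EP := @mean_FTC _ a b rho mu hab crho rho0 Hmu _ _ ch dP.
set P := prim _ _ _ in dP EP.
have mono := ler_der (C0_der dP) (fun x xab => dP x (ltW2 xab)) (fun x xab => mulr_ge0 (h0 x (ltW2 xab)) (ltW (rho0 (ltW2 xab)))).
have Pc y : a < y < b -> P y = P a.
  move=> /andP[ay yb]; have := mono a y (lexx a) (ltW ay) (ltW yb).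
  have := mono y b (ltW ay) (ltW yb) (lexx b); rewrite Eh in EP => ? ?.
  by apply/eqP; rewrite eq_le; apply/andP; split; lra.
have near_c : \forall y \near x, P y = P a.
  have : \forall y \near x, y \in `]a, b[%R by apply: near_in_itvoo; rewrite in_itv.
  by apply: filterS => y; rewrite in_itv; exact: Pc.
have [_ D1] := der_near near_c (dP x xab').
have [_ D2] := der_cst (P a) x.
have : h x * rho x = 0 by rewrite -D1 D2.
by move/eqP; rewrite mulf_eq0 [rho x == 0]gt_eqF ?rho0 // orbF => /eqP.
Qed.

Variables (L : R) (f : R -> R).
Hypothesis L0 : 0 <= L.
Hypothesis LS : LS_constants a b mu L.
Hypothesis cf : C0 a b f.

Definition near_minimizer e (Q : {poly R}) := (forall x, a <= x <= b -> `|Q.[x] - f x| <= e) /\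
  E (fun x => (deriv Q).[x] ^+ 2) < (L + e) / 2 * Ent (horner Q).

Lemma near_minimizer_Ent_gt0 e Q : 0 < e -> near_minimizer e Q -> 0 < Ent (horner Q).
Proof.
move=> e0 [_ h]; have Le : 0 < (L + e) / 2 by rewrite divr_gt0 // ltr_wpDl.
by rewrite -(pmulr_rgt0 _ Le); apply: le_lt_trans h; exact: mean_sqr_ge0.
Qed.

Lemma near_minimizer_le e e' Q : 0 < e -> e <= e' -> near_minimizer e Q -> near_minimizer e' Q.
Proof.
move=> e0 ee' gQ; have Ep := near_minimizer_Ent_gt0 e0 gQ; have [h1 h2] := gQ; split.
  by move=> x xab; apply: le_trans (h1 x xab) ee'.
apply: lt_le_trans h2 _; rewrite ler_wpM2r ?(ltW Ep) // ler_wpM2r // lerD2l //.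
Qed.

Lemma near_minimizer_Ent e1 : 0 < e1 -> exists d, 0 < d /\ forall e Q, e <= d ->
  near_minimizer e Q ->
  `|Ent f - Ent (horner Q)| <= e1.
Proof.
move=> e10.
have [M [M0 HM]] := C0_bounded (ltW hab) cf.
have [d [d0 Hd]] := Ent_continuous Hmu M0 e10.
exists d; split => // e Q ed [h1 _]; apply: Hd.
- exact: bdmeas_C0.
- by apply: bdmeas_C0 => //; exact: C0_horner.
- by move=> x /ltW2/HM.
- by move=> x /ltW2 xab; rewrite distrC; apply: le_trans (h1 x xab) ed.
Qed.

(** By the parallelogram law it suffices to bound the energy of the midpoint from
    below, and the log-Sobolev inequality does so because the entropy is
    continuous for the uniform norm. *)
Lemma near_minimizer_cauchy eta : 0 < eta ->
  exists e, [/\ 0 < e, e <= eta & forall Q P, near_minimizer e Q -> near_minimizer e P ->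
  E (fun x => ((deriv Q).[x] - (deriv P).[x]) ^+ 2) <= eta].
Proof.
move=> eta0.
set S := Ent f; have S0 := normr_ge0 S; have SS := ler_norm S.
(* The upper bounds for [Q] and [P] and the lower bound for their midpoint combine to
   [4 L e1 + 2 e (S + e1)]; [e1] and then [k4] make each part at most [eta / 2]. *)
pose e1 := Num.min 1 (eta / (8 * (L + 1))).
have k8 : 0 < 8 * (L + 1) by rewrite mulr_gt0 // ltr_wpDl.
have e10 : 0 < e1 by rewrite lt_min ltr01 divr_gt0.
have e11 : e1 <= 1 by rewrite ge_min lexx.
have e1L : 8 * (L * e1) <= eta.
  have : e1 * (8 * (L + 1)) <= eta by rewrite -ler_pdivlMr // ge_min lexx orbT.
  lra.
have [d [d0 Hd]] := near_minimizer_Ent e10.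
have [M [M0 HM]] := C0_bounded (ltW hab) cf.
have [d' [d'0 Hd']] := Ent_continuous Hmu M0 e10.
pose k4 := 4 * (`|S| + 2).
have k40 : 0 < k4 by rewrite mulr_gt0 //; lra.
pose e := Num.min (Num.min d d') (Num.min eta (eta / k4)).
have e0 : 0 < e by rewrite !lt_min d0 d'0 eta0 divr_gt0.
have ed : e <= d by rewrite !ge_min lexx.
have ed' : e <= d' by rewrite !ge_min lexx orbT.
have ee : e <= eta by rewrite !ge_min lexx !orbT.
have ek : e * k4 <= eta by rewrite -ler_pdivlMr // !ge_min lexx !orbT.
exists e; split => // Q P gQ gP.
have bQ := bdmeas_C0 hab (@C0_horner _ a b (deriv Q)); have bP :=
  bdmeas_C0 hab (@C0_horner _ a b (deriv P)).
have up W : near_minimizer e W -> E (fun x => (deriv W).[x] ^+ 2) <= (L + e) / 2 * (S + e1).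
  move=> gW; have := Hd e W ed gW; rewrite -/S ler_norml => /andP[h _].
  have [_ h2] := gW; apply: le_trans (ltW h2) _; rewrite ler_wpM2l //; last lra.
  by rewrite divr_ge0 // addr_ge0 // ltW.
pose A := 2^-1 *: (Q + P).
have AE x : A.[x] = 2^-1 * (Q.[x] + P.[x]) by rewrite /A hornerZ hornerD.
have A'E x : (deriv A).[x] = 2^-1 * ((deriv Q).[x] + (deriv P).[x]).
  by rewrite /A derivZ derivD hornerZ hornerD.
have lo : L / 2 * (S - e1) <= E (fun x => (deriv A).[x] ^+ 2).
  apply: le_trans (LS_poly A LS); rewrite ler_wpM2l ?divr_ge0 //.
  have : `|Ent f - Ent (horner A)| <= e1.
    apply: Hd'.
    - exact: bdmeas_C0.
    - by apply: bdmeas_C0 => //; exact: C0_horner.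
    - by move=> x /ltW2/HM.
    move=> x /ltW2 xab; rewrite AE; apply: le_trans ed'.
    have h1 := (proj1 gQ) x xab; have h2 := (proj1 gP) x xab.
    move: h1 h2; rewrite !ler_norml => /andP[? ?] /andP[? ?]; apply/andP; split; lra.
  by rewrite -/S ler_norml => /andP[_]; lra.
have par : E (fun x => ((deriv Q).[x] - (deriv P).[x]) ^+ 2) =
    2 * E (fun x => (deriv Q).[x] ^+ 2) + 2 * E (fun x => (deriv P).[x] ^+ 2)
    - 4 * E (fun x => (deriv A).[x] ^+ 2).
  have bA := bdmeas_C0 hab (@C0_horner _ a b (deriv A)).
  have z1 := bdmeasZ 2 (bdmeasX 2 bQ); have z2 := bdmeasZ 2 (bdmeasX 2 bP); have z3 :=
    bdmeasZ 4 (bdmeasX 2 bA).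
  rewrite -(meanZ mu 2 (bdmeasX 2 bQ)) -(meanZ mu 2 (bdmeasX 2 bP)) -(meanZ mu 4 (bdmeasX 2 bA)) -(meanD mu z1 z2) -(meanB mu (bdmeasD z1 z2) z3).
  by apply: mean_ext => x _; rewrite A'E; field.
rewrite par; have uQ := up Q gQ; have uP := up P gP.
have h1 : 2 * (e * (S + e1)) <= eta / 2.
  have : e * (S + e1) <= e * (`|S| + 2) by rewrite ler_wpM2l ?(ltW e0) //; lra.
  by rewrite /k4 in ek; lra.
lra.
Qed.

Lemma near_minimizer_sequence : (forall e, 0 < e -> exists Q, near_minimizer e Q) ->
  exists Q : nat -> {poly R}, (forall k, near_minimizer (8^-1 ^+ k) (Q k)) /\
    forall k m, (k <= m)%N -> E (fun x => ((deriv (Q k)).[x] - (deriv (Q m)).[x]) ^+ 2) <= 8^-1 ^+ k.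
Proof.
move=> HG.
have p8 k : 0 < (8^-1 : R) ^+ k by rewrite exprn_gt0 // invr_gt0.
have /choice[e He] k := near_minimizer_cauchy (p8 k).
(* Running minima: a later term also meets the tolerance [e k] of every earlier index [k]. *)
pose e' := fix e' k := if k is k'.+1 then Num.min (e' k') (e k) else e 0%N.
have e'0 k : 0 < e' k.
  elim: k => [|k IH]; first by have [] := He 0%N.
  by rewrite /= lt_min IH; have [-> ] := He k.+1.
have e'e k : e' k <= e k by case: k => [|k] //=; rewrite ge_min lexx orbT.
have e'm k m : (k <= m)%N -> e' m <= e' k.
  elim: m => [|m IH]; first by rewrite leqn0 => /eqP ->.
  rewrite leq_eqVlt => /predU1P[-> //|]; rewrite ltnS => /IH h.
  by rewrite /= ge_min h.
have /choice[Q HQ] k := HG _ (e'0 k).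
exists Q; split => [k|k m km].
  apply: near_minimizer_le (HQ k) => //; apply: le_trans (e'e k) _; by have [] := He k.
have [_ _ H] := He k; apply: H; first exact: near_minimizer_le (HQ k).
by apply: near_minimizer_le (HQ m) => //; apply: le_trans (e'm k m km) (e'e k).
Qed.

End Selection.

(** * Existence of a minimizer *)

Section SquareIntegral.
Context d (T : measurableType d) {R : realType}.
Variables (mu : {measure set T -> \bar R}) (D : set T).
Hypothesis mD : measurable D.

(** The right integrand minus the left one is [t^-1 (t v + (v - u))^2]. This is the triangle
    inequality of [L^2] in a form that also makes sense for infinite integrals. *)
Lemma sqr_perturb (u v : T -> R) t : 0 < t -> measurable_fun D u -> measurable_fun D v ->
  (\int[mu]_(x in D) (u x ^+ 2)%:E <=
   (1 + t)%:E * \int[mu]_(x in D) (v x ^+ 2)%:E + (1 + t^-1)%:E * \int[mu]_(x in D) ((v x - u x) ^+ 2)%:E)%E.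
Proof.
move=> t0 mu_ mv.
have m1 : measurable_fun D (fun x => (v x ^+ 2)%:E).
  by apply/measurable_EFinP; exact: measurable_funX.
have m2 : measurable_fun D (fun x => ((v x - u x) ^+ 2)%:E).
  by apply/measurable_EFinP; apply: measurable_funX; exact: measurable_funB.
have p1 : 0 <= 1 + t by rewrite addr_ge0 // ltW.
have p2 : 0 <= 1 + t^-1 by rewrite addr_ge0 // invr_ge0 ltW.
have m1' : measurable_fun D (fun x => (1 + t)%:E * (v x ^+ 2)%:E)%E.
  by apply: emeasurable_funM => //; exact: measurable_cst.
have m2' : measurable_fun D (fun x => (1 + t^-1)%:E * ((v x - u x) ^+ 2)%:E)%E.
  by apply: emeasurable_funM => //; exact: measurable_cst.
have q1 x : D x -> (0 <= (v x ^+ 2)%:E)%E by rewrite lee_fin sqr_ge0.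
have q2 x : D x -> (0 <= ((v x - u x) ^+ 2)%:E)%E by rewrite lee_fin sqr_ge0.
rewrite -ge0_integralZl // -ge0_integralZl // -ge0_integralD //; last 2 first.
- by move=> x /q1 h; rewrite mule_ge0.
- by move=> x /q2 h; rewrite mule_ge0.
apply: ge0_le_integral => //.
- by move=> x _; rewrite lee_fin sqr_ge0.
- by apply/measurable_EFinP; exact: measurable_funX.
- exact: emeasurable_funD.
move=> x _; rewrite -!EFinM -EFinD lee_fin -subr_ge0.
have -> : (1 + t) * v x ^+ 2 + (1 + t^-1) * (v x - u x) ^+ 2 - u x ^+ 2 =
   t^-1 * (v x * t + (v x - u x)) ^+ 2 by field; rewrite lt0r_neq0.
by rewrite mulr_ge0 ?sqr_ge0 // invr_ge0 ltW.
Qed.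

End SquareIntegral.

(** * From the measure [xi] to its normalization *)

Section Transfer.
Context {R : realType}.
Variables (a b : R) (p F G : R -> R) (xi : {measure set (measurableTypeR R) -> \bar R}).
Hypothesis hab : a < b.
Hypothesis hp0 : {in `[a, b], forall x, 0 < p x}.
Hypothesis hxi : has_density xi a b p.
Hypothesis FG : C1pair a b F G.
Hypothesis pF : forall x, a <= x <= b -> p x = F x.

Let D : set (measurableTypeR R) := `]a, b[%classic.
Let mu : probability (measurableTypeR R) R := normalized xi.
Let Z : R := fine (xi setT).

Lemma pdf_gt0 x : a <= x <= b -> 0 < F x.
Proof. by move=> xab; rewrite -pF // hp0 // ?inE /= in_itv. Qed.

Lemma xi_mass : xi setT = Z%:E /\ 0 < Z.
Proof.
have [cG dF] := FG; have cF := C1pair_C0 FG.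
have dP := prim_der hab cF.
have h : xi setT = (prim a b F b - prim a b F a)%:E.
  rewrite hxi // setTI -(FTC2_oo hab cF (C0_der dP)); last by move=> x /ltW2/dP.
  by apply: eq_integral => x; rewrite inE /= in_itv /= => /ltW2/pF ->.
rewrite /Z h; split => //=; rewrite subr_gt0.
by apply: (ltr_der (C0_der dP) (fun x xab => dP x (ltW2 xab))) => // x /ltW2/pdf_gt0.
Qed.

Let Zgt0 : 0 < Z. Proof. by case: xi_mass. Qed.

Definition normalized_pdf (x : R) := F x / fine (xi setT).

(** The mass is finite and positive, so the fallback of [mnormalize] does not occur. *)
Lemma normalizedE A : mu A = (xi A * (Z^-1)%:E)%E.
Proof.
have [h h0] := xi_mass.
rewrite /mu /normalized /= /mnormalize h /= ifF //.
by apply/negP => /orP[/eqP[e]|//]; move: h0; rewrite e ltxx.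
Qed.

Lemma normalized_pdf_C0 : C0 a b normalized_pdf.
Proof. by apply: C0M; [exact: C1pair_C0 FG|exact: C0_cst]. Qed.

Lemma normalized_pdf_gt0 x : a <= x <= b -> 0 < normalized_pdf x.
Proof. by move=> xab; rewrite divr_gt0 ?pdf_gt0. Qed.

Lemma normalized_density A : measurable A ->
  mu A = (\int[lebesgue_measure]_(x in A `&` `]a, b[) (normalized_pdf x)%:E)%E.
Proof.
move=> mA; rewrite normalizedE hxi //.
have mAD : measurable (A `&` `]a, b[) by apply: measurableI => //; exact: measurable_itv.
have mF : measurable_fun (A `&` `]a, b[) (fun x => (F x)%:E).
  have mDF : measurable_fun D (fun x => (F x)%:E).
    by apply/measurable_EFinP; have [] := bdmeas_C0 hab (C1pair_C0 FG).
  apply: measurable_funS mDF; [exact: measurable_itv|exact: subIsetr].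
transitivity ((\int[lebesgue_measure]_(x in A `&` `]a, b[) (F x)%:E) * (Z^-1)%:E)%E.
  congr (_ * _)%E; apply: eq_integral.
  by move=> x; rewrite inE /= in_itv /= => -[_ /ltW2/pF ->].
rewrite -ge0_integralZr //; last 2 first.
- by move=> x /= [_]; rewrite in_itv /= => /ltW2/pdf_gt0 h; rewrite lee_fin ltW.
- by rewrite lee_fin invr_ge0 ltW.
Qed.

Lemma integral_xi (h : R -> \bar R) : measurable_fun D h -> (forall x, D x -> (0 <= h x)%E) ->
  (\int[xi]_(x in D) h x = Z%:E * \int[mu]_(x in D) h x)%E.
Proof.
move=> mh h0.
have mD' : measurable D by exact: measurable_itv.
pose z := NngNum (ltW Zgt0).
transitivity (\int[mscale z mu]_(x in D) h x)%E.
  apply: eq_measure_integral => A mA AD.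
  transitivity (Z%:E * mu A)%E; last by [].
  by rewrite normalizedE muleCA -EFinM divff ?lt0r_neq0 // mule1.
by rewrite ge0_integral_mscale.
Qed.

End Transfer.

Lemma integral_mean (R : realType) (a b : R) (mu : probability (measurableTypeR R) R) h :
  bdmeas a b h -> (\int[mu]_(x in `]a, b[) (h x)%:E = (mean a b mu h)%:E)%E.
Proof.
move=> bh; rewrite /mean /Rintegral fineK //.
by apply: integrable_fin_num; [exact: measurable_itv|exact: bdmeas_integrable].
Qed.

(** By the intermediate value theorem [G] keeps one sign on [(c, b)], and its value at the midpoint
    carries that sign. *)
Lemma sign_constant (R : realType) (a b c : R) (G : R -> R) : C0 a b G -> a <= c -> c < b ->
  (forall x, c < x < b -> G x != 0) -> exists s, forall x, c < x < b -> 0 < s * G x.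
Proof.
move=> cG ac cb G0.
pose x0 := (c + b) / 2.
have x0cb : c < x0 < b by rewrite /x0; apply/andP; split; lra.
exists (G x0) => x xcb; rewrite ltNge; apply/negP => neg.
have key u w : c < u < b -> c < w < b -> u <= w -> ~ (G u * G w <= 0).
  move=> /andP[cu ub] /andP[cw wb] uw h.
  have cG' : {within `[u, w], continuous G}.
    by apply: C0_within; apply: C0_sub cG; lra.
  have [|z] := @IVT R G u w 0 uw cG'.
    have [gu|gu] := lerP 0 (G u).
      have gu' : 0 < G u by rewrite lt_neqAle eq_sym G0 ?cu.
      have gw : G w <= 0 by rewrite -(pmulr_rle0 _ gu').
      by rewrite ge_min gw orbT le_max gu.
    have gw : 0 <= G w by rewrite -(nmulr_rle0 _ gu).
    by rewrite ge_min (ltW gu) le_max gw orbT.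
  rewrite in_itv /= => /andP[uz zw] Gz.
  have zcb : c < z < b by apply/andP; split; lra.
  by move: (G0 z zcb); rewrite Gz eqxx.
have [h|h] := lerP x0 x; first exact: (key x0 x).
by apply: (key x x0) => //; [exact: ltW|rewrite mulrC].
Qed.

Section Third.
Context {R : realType}.
Variables (a b : R) (p F G : R -> R) (xi : {measure set (measurableTypeR R) -> \bar R}).
Hypothesis hab : a < b.
Hypothesis hab0 : 0 < a + b.
Hypothesis hp0 : {in `[a, b], forall x, 0 < p x}.
Hypothesis hxi : has_density xi a b p.
Hypothesis FG : C1pair a b F G.
Hypothesis pF : forall x, a <= x <= b -> p x = F x.
Hypothesis dpG : forall x, a < x < b -> derive1 p x = G x.
Hypothesis hi : 0 \notin `]a, b[ -> {in `]a, b[, forall x, p^`() x != 0}.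
Hypothesis hii : 0 \in `]a, b[ ->
      {in `]a, - a[, forall x, p x = p (- x)} /\
      {in `]0, b[, forall x, p^`() x != 0}.

Lemma third_moment_neq0 lam phi v : 0 < lam -> ivp a b (normalized_pdf F xi) lam phi v ->
  (forall x, a < x < b -> 0 < v x) -> v b = 0 ->
  mean a b (normalized xi) (fun x => phi x ^+ 3) != 0.
Proof.
move=> lam0 Hsol v0 vb.
have [_ Z0] := xi_mass hab hp0 hxi FG pF.
set Z := fine _ in Z0.
have cr := normalized_pdf_C0 (xi := xi) FG.
have r0 := normalized_pdf_gt0 hab hp0 hxi FG pF.
have Hmu := normalized_density hab hp0 hxi FG pF.
have [cG dF] := FG.
have drho x : a < x < b -> der (normalized_pdf F xi) x (G x / Z).
  move=> /ltW2 /dF dFx; have := derM dFx (der_cst Z^-1 x).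
  by rewrite mulr0 addr0.
have [h0|h0] := boolP (0 \in `]a, b[); last first.
  have Gn x : a < x < b -> G x != 0.
    by move=> xab; rewrite -dpG //; apply: (hi h0); rewrite inE /= in_itv.
  have [s Hs] := sign_constant cG (lexx a) hab Gn.
  apply: (@third_moment_mono _ a b _ _ hab cr r0 Hmu lam phi v lam0 Hsol v0 vb _ s drho).
  by move=> x /Hs h; rewrite mulrA divr_gt0.
have [ev Gn'] := hii h0.
have /andP[a0 b0] : a < 0 < b by move: h0; rewrite inE /= in_itv.
have Gn x : 0 < x < b -> G x != 0.
  move=> /andP[x0 xb]; rewrite -dpG; last by rewrite xb (lt_trans a0).
  by apply: Gn'; rewrite inE /= in_itv /= x0 xb.
have [s Hs] := sign_constant cG (ltW a0) b0 Gn.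
have nab : - a < b by rewrite -subr_gt0 opprK addrC.
have evF x : a < x < - a -> F (- x) = F x.
  move=> /andP[ax xa]; rewrite -!pF; try by apply/andP; split; lra.
  by rewrite [RHS]ev // inE /= in_itv /= ax xa.
apply: (@third_moment_even _ a b _ _ hab cr r0 Hmu lam phi v lam0 Hsol v0 vb _ s drho a0 nab).
  move=> x /andP[x0 xa]; split; first by rewrite /normalized_pdf evF //; apply/andP; split; lra.
  (* [F] is even on a neighbourhood of [x]; differentiating this identity makes [G] odd. *)
  have d1 : der F x (G x) by apply: dF; apply/andP; split; lra.
  have d2 : der (fun y => F (- y)) x (G (- x) * -1).
    apply: der_comp; first exact: derN (der_id x).
    by apply: dF; apply/andP; split; lra.
  have d3 : der F x (G (- x) * -1).
    apply: der_near d2.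
    have : \forall y \near x, y \in `]0, (- a)[%R by apply: near_in_itvoo;
      rewrite in_itv /= x0 xa.
    by apply: filterS => y; rewrite in_itv /= => /andP[? ?]; apply: evF; apply/andP; split; lra.
  have [_ e1] := d1; have [_ e2] := d3; rewrite e1 in e2.
  by rewrite e2 mulrN1 mulNr opprK.
by move=> x /Hs h; rewrite mulrA divr_gt0.
Qed.

End Third.

Theorem corollary7p2p5 (R : realType) (a b : R) (p : R -> R)
    (xi : {measure set (measurableTypeR R) -> \bar R})
    (hab : a < b) (hab0 : 0 < a + b)
    (hpC1 : Ck a b 1 p)
    (hp0 : {in `[a, b], forall x, 0 < p x})
    (hxi : has_density xi a b p)
    (hi : 0 \notin `]a, b[ -> {in `]a, b[, forall x, p^`() x != 0})
    (hii : 0 \in `]a, b[ ->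
      {in `]a, - a[, forall x, p x = p (- x)} /\
      {in `]0, b[, forall x, p^`() x != 0}) :
  exists f g : R -> R, is_minimizer xi a b f g.
Proof.
have [F [G [FG pF dpG]]] := Ck1_C1pair hab hpC1.
have [xiZ Z0] := xi_mass hab hp0 hxi FG pF.
set Z := fine _ in Z0 xiZ.
have cr := normalized_pdf_C0 (xi := xi) FG.
have r0 := normalized_pdf_gt0 hab hp0 hxi FG pF.
have Hmu := normalized_density hab hp0 hxi FG pF.
set mu := normalized xi in Hmu.
have [lam [phi [v [lam0 Hsol v0 vb phib]]]] := eigenpair hab cr r0.
have m3 := third_moment_neq0 hab hab0 hp0 hxi FG pF dpG hi hii lam0 Hsol v0 vb.
have [Ft [Gt [FGt Ent0 strict]]] := ratio_lt_gap hab cr r0 Hmu lam0 Hsol v0 vb m3.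
have hsup := LS_constants_has_sup hab Hmu FGt Ent0.
pose L := sup (LS_constants a b mu).
have LL : LambdaLS xi a b = L by [].
have L0 : 0 <= L := sup_LS_constants_ge0 hab Hmu FGt Ent0.
have Llam : L < lam := sup_LS_constants_lt hab Hmu FGt Ent0 strict.
have LSL : LS_constants a b mu L := sup_LS_constants_mem hab Hmu FGt Ent0.
have HL e : 0 < e -> ~ LS_constants a b mu (L + e).
  move=> e0 h; have : L + e <= L by apply: ub_le_sup => //; exact: (proj2 hsup).
  by rewrite gerDl leNgt e0.
have [f [cf E1 HG]] := minimizing_limit hab cr r0 Hmu L0 HL.
have [Q [HQ HC]] := near_minimizer_sequence hab Hmu L0 LSL cf HG.
pose D : set (measurableTypeR R) := `]a, b[%classic.
have mD : measurable D by exact: measurable_itv.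
have bQ k := bdmeas_C0 hab (@C0_horner _ a b (Q k)).
have bQ' k := bdmeas_C0 hab (@C0_horner _ a b (deriv (Q k))).
have bf := bdmeas_C0 hab cf.
have p8 k : 0 < (8^-1 : R) ^+ k by rewrite exprn_gt0 // invr_gt0.
have muD : (mu D < +oo)%E by apply: (le_lt_trans (probability_le1 mu mD)); rewrite ltry.
have [||g [mg Hg]] := @L2_complete _ _ R mu D (fun k => horner (deriv (Q k))) mD muD.
- by move=> k; exact: (bQ' k).1.
- move=> k m km; rewrite integral_mean; first by rewrite lee_fin HC.
  by apply: bdmeasX; exact: bdmeasB.
pose I := (\int[mu]_(x in D) (g x ^+ 2)%:E)%E.
pose x_ k := mean a b mu (fun x => (deriv (Q k)).[x] ^+ 2).
have I0 : (0 <= I)%E by apply: integral_ge0 => x _; rewrite lee_fin sqr_ge0.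
(* With its converse [loJ] below, this shows that the energies [x_ k] tend to the energy of [g]; the
   case [t = 1] gives finiteness. *)
have up t k : 0 < t -> (I <= ((1 + t) * x_ k + (1 + t^-1) * 8^-1 ^+ k)%:E)%E.
  move=> t0; apply: le_trans (sqr_perturb mu mD t0 mg (bQ' k).1) _.
  rewrite [leRHS]EFinD; apply: leeD.
    by rewrite integral_mean; [rewrite -EFinM|exact: bdmeasX].
  rewrite [leRHS]EFinM; apply: lee_wpmul2l; last exact: Hg.
  by rewrite lee_fin addr_ge0 // invr_ge0 ltW.
have Ifin : I \is a fin_num.
  by rewrite ge0_fin_numE //; apply: le_lt_trans (up 1 0%N ltr01) _; rewrite ltry.
pose J := fine I.
have IJ : I = J%:E by rewrite fineK.
have J0 : 0 <= J by rewrite fine_ge0.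
have upJ t k : 0 < t -> J <= (1 + t) * x_ k + (1 + t^-1) * 8^-1 ^+ k.
  by move=> t0; have := up t k t0; rewrite IJ lee_fin.
have loJ t k : 0 < t -> x_ k <= (1 + t) * J + (1 + t^-1) * 8^-1 ^+ k.
  move=> t0; have := sqr_perturb mu mD t0 (bQ' k).1 mg.
  rewrite integral_mean; last exact: bdmeasX.
  rewrite -/I IJ => h; rewrite -lee_fin; apply: le_trans h _.
  rewrite [leRHS]EFinD; apply: leeD; first by rewrite -EFinM.
  rewrite [leRHS]EFinM; apply: lee_wpmul2l.
    by rewrite lee_fin addr_ge0 // invr_ge0 ltW.
  apply: le_trans (Hg k).
  by rewrite le_eqVlt; apply/orP; left; apply/eqP; apply: eq_integral => x _;
    rewrite -sqrrN opprB.
have small (e K : R) : 0 < e -> exists N, forall k, (N <= k)%N -> K * 2^-1 ^+ k <= e.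
  move=> e0; have : geometric K (2^-1) @ \oo --> (0 : R).
    by apply: cvg_geometric; rewrite ger0_norm; lra.
  move=> /cvgrPdist_lt/(_ e e0)[N _ HN]; exists N => k /HN /=.
  by rewrite sub0r normrN => h; rewrite (le_trans (ler_norm _)) // ltW.
set S := Ent_sq mu a b f.
have h2 k : 0 < (2^-1 : R) ^+ k by rewrite exprn_gt0 // invr_gt0.
have h21 k : (2^-1 : R) ^+ k <= 1 by rewrite exprn_ile1 //; lra.
have h8 k : (8^-1 : R) ^+ k = (2^-1 ^+ k) ^+ 3.
  by rewrite -exprM mulnC exprM; congr (_ ^+ k); field.
have h82 k : (8^-1 : R) ^+ k <= 2^-1 ^+ k.
  by rewrite h8 exprSr ler_piMl ?(ltW (h2 k)) // exprn_ile1 // ltW.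
(* From below by the log-Sobolev inequality for [Q k], from above by near-minimality, with the
   entropies close to [S]. *)
have xlim e : 0 < e -> exists N, forall k, (N <= k)%N -> `|L / 2 * S - x_ k| <= e.
  move=> e0; have S0 := normr_ge0 S; have SS := ler_norm S.
  pose e1 := Num.min 1 (e / (L + 1)).
  have L1 : 0 < L + 1 by rewrite ltr_wpDl.
  have e10 : 0 < e1 by rewrite lt_min ltr01 divr_gt0.
  have e11 : e1 <= 1 by rewrite ge_min lexx.
  have e1L : L * e1 <= e.
    have : e1 * (L + 1) <= e by rewrite -ler_pdivlMr // ge_min lexx orbT.
    lra.
  have [d [d0 Hd]] := near_minimizer_Ent hab Hmu L cf e10.
  have [N1 HN1] := small d 1 d0; have [N2 HN2] := small e (`|S| + 1) e0.
  exists (maxn N1 N2) => k; rewrite geq_max => /andP[/HN1 k1 /HN2 k2].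
  rewrite mul1r in k1.
  have := Hd _ _ (le_trans (h82 k) k1) (HQ k); rewrite -/S ler_norml => /andP[s1 s2].
  have q1 := LS_poly (Q k) LSL; have [_ q2] := HQ k; rewrite -/(x_ k) in q1 q2.
  have w1 : L / 2 * (S - e1) <= L / 2 * Ent_sq mu a b (horner (Q k)).
    by rewrite ler_wpM2l ?divr_ge0 //; lra.
  have w2 : (L + 8^-1 ^+ k) / 2 * Ent_sq mu a b (horner (Q k)) <= (L + 8^-1 ^+ k) / 2 * (S + e1).
    by rewrite ler_wpM2l ?divr_ge0 ?addr_ge0 ?(ltW (p8 k)) //; lra.
  have w3 : 8^-1 ^+ k * (S + e1) <= 8^-1 ^+ k * (`|S| + 1) by rewrite ler_wpM2l ?(ltW (p8 k)) //; lra.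
  have w4 : 8^-1 ^+ k * (`|S| + 1) <= 2^-1 ^+ k * (`|S| + 1) by rewrite ler_wpM2r ?h82 //; lra.
  rewrite ler_norml; apply/andP; split; lra.
have JS : L / 2 * S = J.
  apply/eqP; rewrite -subr_eq0 -normr_le0; apply/ler_addgt0Pl => e e0; rewrite addr0.
  have e2 : 0 < e / 2 by rewrite divr_gt0.
  have [N1 HN1] := xlim _ e2; pose X := `|L / 2 * S| + e + J + 2.
  have [N2 HN2] := small _ X e2.
  pose k := maxn N1 N2; have k1 := HN1 k (leq_maxl _ _); have k2 := HN2 k (leq_maxr _ _).
  (* Take [t = h] in [upJ] and [loJ]: since [8^-k = h^3], the error [(1 + 1 / h) h^3] is at most
     [2 h]. *)
  pose h := (2^-1 : R) ^+ k; have hp : 0 < h := h2 k.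
  have hh : (1 + h^-1) * 8^-1 ^+ k <= 2 * h.
    rewrite h8 -/h; have -> : (1 + h^-1) * h ^+ 3 = h * (h ^+ 2 + h) by field; rewrite lt0r_neq0.
    rewrite mulrC ler_wpM2r ?(ltW hp) //.
    have : h ^+ 2 <= 1 by rewrite exprn_ile1 // ?(ltW hp) ?h21.
    by have := h21 k; rewrite -/h; lra.
  have u1 := upJ h k hp; have u2 := loJ h k hp.
  have xk : x_ k <= `|L / 2 * S| + e.
    by move: k1; rewrite ler_norml => /andP[? ?]; have := ler_norm (L / 2 * S); lra.
  have v1 : h * x_ k <= h * (`|L / 2 * S| + e) by rewrite ler_wpM2l ?(ltW hp).
  have v2 : 0 <= h * J by rewrite mulr_ge0 // ltW.
  have v3 : 0 <= h * (`|L / 2 * S| + e) by rewrite mulr_ge0 ?(ltW hp) // addr_ge0 // ltW.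
  rewrite -/h /X in k2.
  move: k1; rewrite !ler_norml => /andP[? ?]; apply/andP; split; lra.
have mf : measurable_fun D f by case: bf.
have xi_fin (u : R -> R) : measurable_fun D u -> (\int[mu]_(x in D) (u x ^+ 2)%:E < +oo)%E ->
  L2 xi a b u.
  move=> mu_ fin; split => //; apply/integrableP.
  have mu2 : measurable_fun D (fun x => (u x ^+ 2)%:E).
    by apply/measurable_EFinP; exact: measurable_funX.
  split => //.
  rewrite [X in (X < _)%E](_ : _ = \int[xi]_(x in D) (u x ^+ 2)%:E)%E; last first.
    by apply: eq_integral => x _ /=; rewrite ger0_norm // sqr_ge0.
  rewrite (integral_xi hab hp0 hxi FG pF mu2); last by move=> x _; rewrite lee_fin sqr_ge0.
  by rewrite lte_mul_pinfty // lee_fin ltW.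
exists f, g; split.
- split.
  + by apply: xi_fin => //; rewrite integral_mean ?ltry //; exact: bdmeasX.
  + by apply: xi_fin => //; rewrite -/I IJ ltry.
  exists (fun n => horner (Q n)); first by move=> n; exact: Cinfty_horner.
  have bound n : (0%:E <= \int[xi]_(x in D)
      (((Q n).[x] - f x) ^+ 2 + (derive1 (horner (Q n)) x - g x) ^+ 2)%:E <= (2 * Z * 2^-1 ^+ n)%:E)%E.
    apply/andP; split.
      by apply: integral_ge0 => x _; rewrite lee_fin addr_ge0 ?sqr_ge0.
    have m1 : measurable_fun D (fun x => (((Q n).[x] - f x) ^+ 2)%:E).
      by apply/measurable_EFinP; apply: measurable_funX; apply: measurable_funB => //;
        exact: (bQ n).1.
    have m2 : measurable_fun D (fun x => (((deriv (Q n)).[x] - g x) ^+ 2)%:E).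
      by apply/measurable_EFinP; apply: measurable_funX; apply: measurable_funB => //;
        exact: (bQ' n).1.
    have n1 x : D x -> (0 <= (((Q n).[x] - f x) ^+ 2)%:E)%E by rewrite lee_fin sqr_ge0.
    have n2 x : D x -> (0 <= (((deriv (Q n)).[x] - g x) ^+ 2)%:E)%E by rewrite lee_fin sqr_ge0.
    rewrite [leLHS](_ : _ = \int[xi]_(x in D)
        ((((Q n).[x] - f x) ^+ 2)%:E + (((deriv (Q n)).[x] - g x) ^+ 2)%:E))%E; last first.
      by apply: eq_integral => x _; rewrite EFinD -derivE.
    rewrite (integral_xi hab hp0 hxi FG pF); last 2 first.
    - exact: emeasurable_funD.
    - by move=> x Dx; apply: adde_ge0; [exact: n1|exact: n2].
    rewrite ge0_integralD // mulrAC EFinM muleC; apply: lee_wpmul2r.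
      by rewrite lee_fin ltW.
    have -> : 2 * 2^-1 ^+ n = 2^-1 ^+ n + 2^-1 ^+ n :> R by ring.
    rewrite EFinD; apply: leeD; last by apply: le_trans (Hg n) _; rewrite lee_fin.
    rewrite integral_mean; last by apply: bdmeasX; exact: bdmeasB.
    rewrite lee_fin; apply: le_trans (ler_norm _) _.
    apply: (mean_norm_le Hmu); first by apply: bdmeasX; exact: bdmeasB.
    move=> x /ltW2 xab; have h := (HQ n).1 x xab.
    rewrite normrX; apply: le_trans (_ : 8^-1 ^+ n ^+ 2 <= _).
      by rewrite ler_sqr ?nnegrE ?normr_ge0 ?(ltW (p8 n)).
    by rewrite expr2; apply: le_trans (h82 n);
      rewrite ler_piMl ?(ltW (p8 n)) // (le_trans (h82 n)).
  have lim0 : (2 * Z * 2^-1 ^+ n)%:E @[n --> \oo] --> (0 : R)%:E.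
    apply: cvg_EFin; first exact: nearW.
    have -> : fine \o (fun n => (2 * Z * 2^-1 ^+ n)%:E) = geometric (2 * Z) (2^-1) by [].
    by apply: cvg_geometric; rewrite ger0_norm; lra.
  apply: squeeze_cvge lim0; last exact: cvg_cst.
  by apply: nearW => n; exact: bound.
- move=> [c fc].
  have mc : measurable_fun D (fun x => ((f x - c) ^+ 2)%:E).
    by apply/measurable_EFinP; apply: measurable_funX; apply: measurable_funB => //;
      exact: measurable_cst.
  have int0 : (\int[xi]_(x in D) ((f x - c) ^+ 2)%:E = 0)%E.
    rewrite (ae_eq_integral (cst 0%E)) ?integral0 //.
    by apply: filterS fc => x /[apply] ->; rewrite subrr expr0n.
  have bc : C0 a b (fun x => (f x - c) ^+ 2) by apply: C0X; apply: C0B => //; exact: C0_cst.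
  have Ec : mean a b mu (fun x => (f x - c) ^+ 2) = 0.
    move: int0; rewrite (integral_xi hab hp0 hxi FG pF mc); last by move=> x _;
      rewrite lee_fin sqr_ge0.
    rewrite integral_mean; last exact: bdmeas_C0.
    by rewrite -EFinM => -[] /eqP; rewrite mulf_eq0 gt_eqF //= => /eqP.
  (* By continuity of [f], constancy almost everywhere is constancy on the whole open interval. *)
  have fcst x : a < x < b -> f x = c.
    move=> xab; apply/eqP; rewrite -subr_eq0 -sqrf_eq0; apply/eqP.
    exact: (mean_eq0 hab cr r0 Hmu bc (fun x _ => sqr_ge0 _) Ec xab).
  have c2 : c ^+ 2 = 1.
    rewrite -E1 (@mean_ext _ a b mu _ (fun=> c ^+ 2)); last by move=> x xab; rewrite fcst.
    by rewrite (mean_cst Hmu).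
  (* Strictly between [L] and [lam]: a near-minimizer [P] close to [c] has energy below
     [(L + e) / 2], hence below [lam' / 2], times its entropy, against [near_constant_ratio]. *)
  pose lam' := (L + lam) / 2.
  have l0 : 0 <= lam' by rewrite divr_ge0 // addr_ge0 // ltW.
  have ll : lam' < lam by rewrite /lam'; lra.
  have [d [d0 Hd]] := near_constant_ratio hab cr r0 Hmu lam0 Hsol v0 phib l0 ll.
  pose e := Num.min d (lam' - L).
  have e0 : 0 < e by rewrite lt_min d0 /lam'; lra.
  have [P [P1 P2]] := HG e e0.
  have Pd x : a < x < b -> `|P.[x] - c| <= d.
    move=> xab; rewrite -(fcst x xab); apply: le_trans (P1 x (ltW2 xab)) _.
    by rewrite ge_min lexx.
  have PE : 0 < Ent_sq mu a b (horner P) by exact: (near_minimizer_Ent_gt0 L0 e0 (conj P1 P2)).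
  have := Hd c _ _ c2 (C1pair_horner a b P) Pd.
  rewrite leNgt => /negP; apply; apply: lt_le_trans P2 _.
  have el : L + e <= lam' by rewrite addrC -lerBrDr ge_min lexx orbT.
  by rewrite ler_wpM2r ?(ltW PE) // ler_wpM2r.
by rewrite LL; exact: JS.
Qed.
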